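(* Let $\Sigma$ be a compact Riemann surface and let $g$ be a reducible conformal metric of constant curvature one on $\Sigma$ representing the divisor $D=\sum_{j=1}^n(\alpha_j-1)P_j$ with $\alpha_j>0$ and $\alpha_j\neq 1$ for all $j$; put $\Sigma^*=\Sigma\setminus\{p_1,\dots,p_n\}$. Let $f$ be a developing map of $g$, assumed multiplicative if $g$ is non-trivial, such that the character 1-form $\omega=\frac{df}{f}$ of $g$ equals $f^*\Theta$, where $\Theta=\frac{dw}{w}$. Let $Y=\frac{f(z)}{f'(z)}\frac{\partial}{\partial z}$ be the algebraic dual vector field of $\omega$, and let $\Psi(z)=\frac{4|f(z)|^2}{1+|f(z)|^2}$. Then the following hold. (1) The set of zeroes of the meromorphic vector field $Y$ coincides with the set of extremal points of $\Psi$. Each zero of $Y$ is simple, and $Y$ vanishes at each point $p_j$ for which $\alpha_j>0$ is a non-integer. The set of poles of $Y$ coincides with the set of saddle points of $\Psi$. Each pole of $Y$ is some conical singularity $p_j$ of $g$, where $\alpha_j$ is an integer greater than $1$ and the order of the pole $p_j$ of $Y$ equals $\alpha_j-1$. (2) Let $p_1,\dots,p_J$ be the saddle points of $\Psi$, $p_{J+1},\dots,p_n$ the singular extremal points of $\Psi$ (those that are conical singularities of $g$), and $e_1,\dots,e_S$ the smooth extremal points of $\Psi$, i.e. those on $\Sigma^*$. Then the canonical divisor of $\omega$ has the form $$(\omega)=\sum_{j=1}^J(\alpha_j-1)P_j-\sum_{k=J+1}^n P_k-\sum_{\ell=1}^S E_\ell .$$ In particular, each pole of $\omega$ is simple, i.e.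 $\omega$ is an abelian differential of the third kind. The residue of $\omega$ at the pole $e_\ell$ equals $1$ or $-1$ according as $e_\ell$ is a minimal or maximal point of $\Psi$; the residue of $\omega$ at the pole $p_k$ equals $\alpha_k$ or $-\alpha_k$ according as $p_k$ is a minimal or maximal point of $\Psi$. Moreover, the real part of $\omega$ is exact on $\Sigma':=\Sigma\setminus\{p_{J+1},\dots,p_n,e_1,\dots,e_S\}\supset\Sigma^*$, with $$2\,\mathrm{Re}\,\omega=d(\log|f|^2).$$ (3) The multiplicative developing map $f$ on $\Sigma'\supset\Sigma^*$ can be expressed by $$f(z)=\exp\Bigl(\int^z\omega\Bigr).$$ In particular, the local monodromy of $f$ around each $p_j$ ($1\le j\le J$) is trivial, and the limit $\lim_{p\to p_j}f(p)$ exists and belongs to $\mathbb{C}\setminus\{0\}$. If a function element $\mathfrak{f}$ of $f$ is continued analytically along a simple and sufficiently small loop winding counterclockwise around $p_k$ ($J+1\le k\le n$), then one obtains $\mathfrak{f}\,\exp(2\pi\sqrt{-1}\,\alpha_k)$. The limit $\lim_{p\to p_k}|f(p)|$ exists, and equals $0$ or $+\infty$ according as $p_k$ is a minimal or maximal point of $\Psi$. It is also the case for $e_\ell$.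
   Context: Conformal metrics: a conformal metric $g$ on $\Sigma$ has a conical singularity at $p$ with angle $2\pi\alpha>0$ if near $p$, $g=e^{2\varphi}|dz|^2$ with $z$ a local complex coordinate, $z(p)=0$, and $\varphi-(\alpha-1)\ln|z|$ continuous near $p$. For distinct points $p_1,\dots,p_n$ and $\alpha_j>0$, $g$ represents $D=\sum_j(\alpha_j-1)P_j$ ($P_j$ is $p_j$ viewed as a divisor, similarly $E_\ell$ for $e_\ell$) if $g$ is smooth on $\Sigma^*$ and has a conical singularity of angle $2\pi\alpha_j$ at each $p_j$. Constant curvature one means Gauss curvature $1$ on $\Sigma^*$. Developing maps: $\overline{\mathbb{C}}$ is the Riemann sphere with coordinate $w$ and standard metric $g_{\rm st}=\frac{4|dw|^2}{(1+|w|^2)^2}$, and $\mathrm{PSU}(2)$ is its group of orientation-preserving isometries, acting by Möbius transformations. A multi-valued locally univalent meromorphic function $f$ on $\Sigma^*$ is obtained by analytic continuation of a function element along all paths in $\Sigma^*$, all function elements being locally injective meromorphic functions. Its monodromy belongs to a group $G$ of Möbius transformations if continuation along any loop replaces a function element $\mathfrak{f}$ by $L\circ\mathfrak{f}$ with $L\in G$. A developing map of $g$ is a multi-valued locally univalent meromorphic function $f$ on $\Sigma^*$ with $g=f^*g_{\rm st}$; developing maps exist, have monodromy in $\mathrm{PSU}(2)$, and any two differ by post-composition with an element of $\mathrm{PSU}(2)$. Reducible metrics: $g$ is reducible if the monodromy group of a developing map has at least one fixed point on $\overline{\mathbb{C}}$. A reducible metric is trivial if the monodromy of a developing map is trivial,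 otherwise non-trivial. $\mathrm{U}(1)\subset\mathrm{PSU}(2)$ denotes the subgroup of maps $w\mapsto e^{2\sqrt{-1}\theta}w$, $\theta\in\mathbb{R}$. A developing map is multiplicative if its monodromy belongs to $\mathrm{U}(1)$. If $g$ is non-trivial reducible, its multiplicative developing map $f$ is unique up to $f\mapsto 1/f$, and its character 1-form is $\omega=d(\log f)=df/f$ (unique up to sign). If $g$ is trivial, every developing map is multiplicative, and a character 1-form is $df/f$ for any developing map $f$ of $g$. The form $\omega$ extends to a meromorphic 1-form on $\Sigma$, $Y$ to a meromorphic vector field on $\Sigma$, and $\Psi$ to a continuous function on $\Sigma$. An extremal point is a minimal or maximal point; a saddle point is a critical point which is not extremal. An abelian differential of the third kind is a meromorphic 1-form all of whose poles are simple. $\int^z\omega$ denotes an indefinite integral of $\omega$.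
   Formalization: At maximal points p_k the monodromy multiplier is exp(-2πi α_k) instead of exp(2πi α_k) (which fails for f = z^α at infinity), and Σ' ⊃ Σ* is replaced by Σ' ⊃ Σ* \ {e_1,…,e_S}, since the smooth extremal points are removed from Σ'. *)

(* Defs.v *)
From HB Require Import structures.
From mathcomp Require Import all_boot all_order all_algebra complex.
From mathcomp Require Import all_classical all_reals all_analysis.

Set Implicit Arguments.
Unset Strict Implicit.
Unset Printing Implicit Defensive.

Import Order.TTheory GRing.Theory Num.Theory.
Import numFieldNormedType.Exports.

Local Open Scope classical_set_scope.
Local Open Scope ring_scope.

(** * Complex numbers and the Riemann sphere *)

(* Packing R[i] as a numClosedFieldType gives it the topology and the
   normed-module structure over itself that MathComp-Analysis attaches to
   abstract number fields; hence [derivable] and [derive1] are complex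
   differentiation below. *)
Definition Cx (R : realType) : numClosedFieldType := R[i].

Definition cpair (R : realType) (x y : R) : Cx R := Complex x y.

Definition re (R : realType) (z : Cx R) : R := complex.Re z.

Definition im (R : realType) (z : Cx R) : R := complex.Im z.

Definition cmod (R : realType) (z : Cx R) : R := Normc.normc z.

Definition cexp (R : realType) (z : Cx R) : Cx R :=
  cpair (expR (re z) * cos (im z)) (expR (re z) * sin (im z)).

(* [None] is the point at infinity. *)
Definition sphere (R : realType) : Type := option (Cx R).

Definition fin (R : realType) (w : sphere R) : Cx R := odflt 0 w.

Definition sphere_inv (R : realType) (w : sphere R) : sphere R :=
  match w with
  | None => Some 0
  | Some z => if z == 0 then None else Some z^-1
  end.

(* Meant for a != 0, so that infinity is fixed. *)
Definition sphere_scale (R : realType) (a : Cx R) (w : sphere R) : sphere R :=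
  omap ( *%R a) w.

Definition sphere_mod (R : realType) (w : sphere R) : \bar R :=
  match w with None => +oo%E | Some z => (cmod z)%:E end.

Definition mobius (R : realType) (a b c d : Cx R) (w : sphere R) : sphere R :=
  match w with
  | Some z =>
      if c * z + d == 0 then None else Some ((a * z + b) / (c * z + d))
  | None => if c == 0 then None else Some (a / c)
  end.

Definition is_mobius (R : realType) : set (sphere R -> sphere R) :=
  [set L | exists a b c d : Cx R, a * d - b * c != 0 /\ L = mobius a b c d].

Definition PSU2 (R : realType) : set (sphere R -> sphere R) :=
  [set L | exists a b : Cx R,
     a * a^* + b * b^* = 1 /\ L = mobius a b (- b^*) (a^*)].

Definition U1 (R : realType) : set (sphere R -> sphere R) :=
  [set L | exists theta : R, L = sphere_scale (cexp (cpair 0 (2 * theta)))].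

(** * Holomorphic and meromorphic functions of one variable *)

Definition holomorphic_at (R : realType) (h : Cx R -> Cx R) (z0 : Cx R) :
    Prop :=
  \forall z \near z0, derivable h z 1.

(* Holomorphic as a map to the sphere, and not constantly infinite near z0. *)
Definition meromorphic_at (R : realType) (F : Cx R -> sphere R) (z0 : Cx R) :
    Prop :=
  exists h : Cx R -> Cx R, holomorphic_at h z0 /\
    ((\forall z \near z0, F z = Some (h z)) \/
     ((\forall z \near z0, F z = sphere_inv (Some (h z))) /\
      (\forall z \near z0^', h z != 0))).

(* F vanishes to order m at z0; a pole of order k has m = - k. *)
Definition order_at (R : realType) (F : Cx R -> sphere R) (z0 : Cx R)
    (m : int) : Prop :=
  exists h : Cx R -> Cx R, [/\ holomorphic_at h z0, h z0 != 0 &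
    \forall z \near z0^', F z = Some ((z - z0) ^ m * h z)].

(* a is the coefficient of (z - z0)^-1; P is the principal part (its constant
   coefficient is irrelevant). *)
Definition residue_at (R : realType) (F : Cx R -> sphere R) (z0 a : Cx R) :
    Prop :=
  exists (P : {poly Cx R}) (h : Cx R -> Cx R), [/\ holomorphic_at h z0,
    \forall z \near z0^', F z = Some (P.[(z - z0)^-1] + h z) & a = P`_1].

(** * Real calculus in the plane *)

Definition pdx (R : realType) (u : Cx R -> R) (z : Cx R) : R :=
  derive1 (fun t : R => u (z + cpair t 0)) 0.

Definition pdy (R : realType) (u : Cx R -> R) (z : Cx R) : R :=
  derive1 (fun t : R => u (z + cpair 0 t)) 0.

Fixpoint Ck_on (R : realType) (k : nat) (U : set (Cx R)) (u : Cx R -> R) :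
    Prop :=
  (forall z, U z -> {for z, continuous u}) /\
  match k with
  | 0%N => True
  | k'.+1 =>
    [/\ forall z, U z ->
          derivable (fun t : R => u (z + cpair t 0)) 0 1 /\
          derivable (fun t : R => u (z + cpair 0 t)) 0 1,
        Ck_on k' U (pdx u) & Ck_on k' U (pdy u)]
  end.

Definition smooth_on (R : realType) (U : set (Cx R)) (u : Cx R -> R) : Prop :=
  forall k, Ck_on k U u.

Definition laplacian (R : realType) (u : Cx R -> R) (z : Cx R) : R :=
  pdx (pdx u) z + pdy (pdy u) z.

(** * Riemann surfaces *)

(* A holomorphic atlas; [param i] is the inverse of the chart [zcoord i] and is
   only relevant on [zcoord i @` dom i].  The global conditions (Hausdorff,
   connected, compact) are imposed on S separately. *)
Record riemann_surface (R : realType) (S : topologicalType) := RiemannSurface {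
  chart : Type;
  dom : chart -> set S;
  zcoord : chart -> S -> Cx R;
  param : chart -> Cx R -> S;
  dom_open : forall i, open (dom i);
  dom_cover : forall p, exists i, dom i p;
  zcoord_open : forall i, open (zcoord i @` dom i);
  zcoord_continuous : forall i p, dom i p -> {for p, continuous (zcoord i)};
  param_continuous :
    forall i p, dom i p -> {for zcoord i p, continuous (param i)};
  zcoordK : forall i p, dom i p -> param i (zcoord i p) = p;
  transition_holomorphic : forall i j p, dom i p -> dom j p ->
    holomorphic_at (zcoord j \o param i) (zcoord i p) }.

(* du/dz_i at p *)
Definition dcoord (R : realType) (S : topologicalType)
    (X : riemann_surface R S) (i : chart X) (u : S -> Cx R) (p : S) : Cx R :=
  derive1 (u \o param i) (zcoord i p).

(** * Meromorphic 1-forms and vector fields *)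

(* The family w stands for the 1-form w_i dz_i. *)
Definition meromorphic_form (R : realType) (S : topologicalType)
    (X : riemann_surface R S) (w : chart X -> S -> sphere R) : Prop :=
  (forall i p, dom i p -> meromorphic_at (w i \o param i) (zcoord i p)) /\
  (forall i j p, dom i p -> dom j p ->
     w i p = sphere_scale (dcoord i (zcoord j) p) (w j p)).

(* The family v stands for the vector field v_i d/dz_i. *)
Definition meromorphic_vector_field (R : realType) (S : topologicalType)
    (X : riemann_surface R S) (v : chart X -> S -> sphere R) : Prop :=
  (forall i p, dom i p -> meromorphic_at (v i \o param i) (zcoord i p)) /\
  (forall i j p, dom i p -> dom j p ->
     v i p = sphere_scale (dcoord j (zcoord i) p) (v j p)).

(* The next four notions apply to both kinds of families, except for the
   residue, which only makes sense for 1-forms. *)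
Definition is_zero (R : realType) (S : topologicalType)
    (X : riemann_surface R S) (w : chart X -> S -> sphere R) (p : S) : Prop :=
  forall i, dom i p -> w i p = Some 0.

Definition is_pole (R : realType) (S : topologicalType)
    (X : riemann_surface R S) (w : chart X -> S -> sphere R) (p : S) : Prop :=
  forall i, dom i p -> w i p = None.

Definition has_order (R : realType) (S : topologicalType)
    (X : riemann_surface R S) (w : chart X -> S -> sphere R) (p : S)
    (m : int) : Prop :=
  forall i, dom i p -> order_at (w i \o param i) (zcoord i p) m.

Definition has_residue (R : realType) (S : topologicalType)
    (X : riemann_surface R S) (w : chart X -> S -> sphere R) (p : S)
    (a : Cx R) : Prop :=
  forall i, dom i p -> residue_at (w i \o param i) (zcoord i p) a.

Definition third_kind (R : realType) (S : topologicalType)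
    (X : riemann_surface R S) (w : chart X -> S -> sphere R) : Prop :=
  meromorphic_form w /\ forall p, is_pole w p -> has_order w p (-1).

(** * Conformal metrics with conical singularities *)

(* The family g stands for the metric e^{2 g_i} |dz_i|^2 on the open set W. *)
Definition conformal_metric (R : realType) (S : topologicalType)
    (X : riemann_surface R S) (W : set S) (g : chart X -> S -> R) : Prop :=
  (forall i, smooth_on (zcoord i @` (dom i `&` W)) (g i \o param i)) /\
  (forall i j p, W p -> dom i p -> dom j p ->
     g i p = g j p + ln (cmod (dcoord i (zcoord j) p))).

(* conical singularity of angle 2 pi a at p *)
Definition conical_at (R : realType) (S : topologicalType)
    (X : riemann_surface R S) (g : chart X -> S -> R) (p : S) (a : R) : Prop :=
  exists i, dom i p /\ exists u : S -> R,
    (\forall q \near p, {for q, continuous u}) /\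
    (\forall q \near p^',
       g i q - (a - 1) * ln (cmod (zcoord i q - zcoord i p)) = u q).

Definition represents (R : realType) (S : topologicalType)
    (X : riemann_surface R S) (n : nat) (pt : 'I_n -> S) (alpha : 'I_n -> R)
    (g : chart X -> S -> R) : Prop :=
  conformal_metric (~` range pt) g /\
  forall j, conical_at g (pt j) (alpha j).

Definition gauss_curvature (R : realType) (S : topologicalType)
    (X : riemann_surface R S) (g : chart X -> S -> R) (i : chart X) (p : S) :
    R :=
  - expR (- (2 * g i p)) * laplacian (g i \o param i) (zcoord i p).

Definition curvature_one (R : realType) (S : topologicalType)
    (X : riemann_surface R S) (W : set S) (g : chart X -> S -> R) : Prop :=
  forall i p, W p -> dom i p -> gauss_curvature g i p = 1.

(** * Multi-valued functions *)

(* gamma is used on [0, 1] only. *)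
Definition path_in (R : realType) (S : topologicalType) (W : set S)
    (gamma : R -> S) (x y : S) : Prop :=
  [/\ {within `[0, 1], continuous gamma}, gamma 0 = x, gamma 1 = y &
      forall t, t \in `[0, 1] -> W (gamma t)].

(* A function element at p is a total function considered near p only, and
   [el p F] selects the admissible ones.  [Ft t] is the function element
   at [gamma t] obtained by continuing F, and G is the final one. *)
Definition continuation (R : realType) (S : topologicalType) (T : Type)
    (el : S -> (S -> T) -> Prop) (gamma : R -> S) (F G : S -> T) : Prop :=
  exists Ft : R -> S -> T, [/\ Ft 0 = F, Ft 1 = G &
    forall t, t \in `[0, 1] -> el (gamma t) (Ft t) /\
      \forall s \near t, s \in `[0, 1] ->
        \forall q \near gamma s, Ft s q = Ft t q].

Record multivalued (R : realType) (S : topologicalType) (T : Type) (W : set S)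
    (el : S -> (S -> T) -> Prop) := Multivalued {
  mv_base : S;
  mv_germ : S -> T;
  mv_base_in : W mv_base;
  mv_continuable : forall (gamma : R -> S) y, path_in W gamma mv_base y ->
    exists G, continuation el gamma mv_germ G }.

Definition elements (R : realType) (S : topologicalType) (T : Type)
    (W : set S) (el : S -> (S -> T) -> Prop) (f : multivalued R W el)
    (q : S) (F : S -> T) : Prop :=
  exists gamma : R -> S, path_in W gamma (mv_base f) q /\
    continuation el gamma (mv_germ f) F.

Definition univalent_element (R : realType) (S : topologicalType)
    (X : riemann_surface R S) (p : S) (F : S -> sphere R) : Prop :=
  (forall i : chart X, dom i p -> meromorphic_at (F \o param i) (zcoord i p)) /\
  exists U, nbhs p U /\ forall x y, U x -> U y -> F x = F y -> x = y.

(* function elements of the indefinite integral of the 1-form w *)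
Definition integral_element (R : realType) (S : topologicalType)
    (X : riemann_surface R S) (w : chart X -> S -> sphere R) (p : S)
    (h : S -> Cx R) : Prop :=
  (forall i : chart X, dom i p -> holomorphic_at (h \o param i) (zcoord i p)) /\
  \forall q \near p, forall i, dom i q -> w i q = Some (dcoord i h q).

Definition monodromy_in (R : realType) (S : topologicalType) (W : set S)
    (el : S -> (S -> sphere R) -> Prop) (f : multivalued R W el)
    (G : set (sphere R -> sphere R)) : Prop :=
  forall q F (gamma : R -> S) F', elements f q F -> path_in W gamma q q ->
    continuation el gamma F F' ->
    exists2 L, G L & \forall x \near q, F' x = L (F x).

Definition monodromy_group (R : realType) (S : topologicalType) (W : set S)
    (el : S -> (S -> sphere R) -> Prop) (f : multivalued R W el) :
    set (sphere R -> sphere R) :=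
  [set L | is_mobius L /\ exists q F (gamma : R -> S) F',
     [/\ elements f q F, path_in W gamma q q, continuation el gamma F F' &
         \forall x \near q, F' x = L (F x)]].

(** * Developing maps and reducible metrics *)

(* [pullback_density F z] |dz|^2 is the pullback by F of the spherical metric
   4 |dw|^2 / (1 + |w|^2)^2, computed in the coordinate 1/w at the poles. *)
Definition spherical_density (R : realType) (h : Cx R -> Cx R) (z : Cx R) :
    R :=
  4 * cmod (derive1 h z) ^+ 2 / (1 + cmod (h z) ^+ 2) ^+ 2.

Definition pullback_density (R : realType) (F : Cx R -> sphere R) (z : Cx R) :
    R :=
  if F z is Some _ then spherical_density (@fin R \o F) z
  else spherical_density (@fin R \o @sphere_inv R \o F) z.

Definition developing (R : realType) (S : topologicalType)
    (X : riemann_surface R S) (W : set S) (g : chart X -> S -> R)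
    (f : multivalued R W (univalent_element X)) : Prop :=
  forall q F i, elements f q F -> dom i q ->
    expR (2 * g i q) = pullback_density (F \o param i) (zcoord i q).

Definition reducible (R : realType) (S : topologicalType)
    (X : riemann_surface R S) (W : set S) (g : chart X -> S -> R) : Prop :=
  exists f : multivalued R W (univalent_element X), developing g f /\
    exists w : sphere R, forall L, monodromy_group f L -> L w = w.

Definition trivial_reducible (R : realType) (S : topologicalType)
    (X : riemann_surface R S) (W : set S) (g : chart X -> S -> R) : Prop :=
  reducible W g /\
  exists f : multivalued R W (univalent_element X), developing g f /\
    monodromy_in f [set id].

Definition nontrivial_reducible (R : realType) (S : topologicalType)
    (X : riemann_surface R S) (W : set S) (g : chart X -> S -> R) : Prop :=
  reducible W g /\ ~ trivial_reducible W g.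

Definition multiplicative_map (R : realType) (S : topologicalType)
    (X : riemann_surface R S) (W : set S)
    (f : multivalued R W (univalent_element X)) : Prop :=
  monodromy_in f (@U1 R).

(** * The objects attached to a multiplicative developing map *)

(* Each of the next three is the extension to the whole surface of an object
   given by a formula in terms of f; the formula is only used where it makes
   sense, and determines the extension. *)

(* w = df / f *)
Definition character_form (R : realType) (S : topologicalType)
    (X : riemann_surface R S) (W : set S)
    (f : multivalued R W (univalent_element X))
    (w : chart X -> S -> sphere R) : Prop :=
  meromorphic_form w /\
  forall q F i, elements f q F -> dom i q ->
    F q <> None -> F q <> Some 0 ->
    w i q = Some (dcoord i (@fin R \o F) q / fin (F q)).

(* v = (f / f') d/dz *)
Definition dual_vector_field (R : realType) (S : topologicalType)
    (X : riemann_surface R S) (W : set S)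
    (f : multivalued R W (univalent_element X))
    (v : chart X -> S -> sphere R) : Prop :=
  meromorphic_vector_field v /\
  forall q F i, elements f q F -> dom i q ->
    F q <> None -> F q <> Some 0 ->
    v i q = Some (fin (F q) / dcoord i (@fin R \o F) q).

Definition height (R : realType) (w : sphere R) : R :=
  if w is Some z then 4 * cmod z ^+ 2 / (1 + cmod z ^+ 2) else 4.

Definition height_function (R : realType) (S : topologicalType)
    (X : riemann_surface R S) (W : set S)
    (f : multivalued R W (univalent_element X)) (Psi : S -> R) : Prop :=
  continuous Psi /\ forall q F, elements f q F -> Psi q = height (F q).

(** * Extremal points and saddle points *)

Definition minimal_point (R : realType) (S : topologicalType) (Psi : S -> R)
    (p : S) : Prop :=
  \forall q \near p, Psi p <= Psi q.

Definition maximal_point (R : realType) (S : topologicalType) (Psi : S -> R)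
    (p : S) : Prop :=
  \forall q \near p, Psi q <= Psi p.

Definition extremal_point (R : realType) (S : topologicalType) (Psi : S -> R)
    (p : S) : Prop :=
  minimal_point Psi p \/ maximal_point Psi p.

(* u is real-differentiable at p, with differential Re (a_i dz_i). *)
Definition real_differential (R : realType) (S : topologicalType)
    (X : riemann_surface R S) (u : S -> R) (p : S) (a : chart X -> Cx R) :
    Prop :=
  forall i, dom i p ->
    (fun z => (u (param i z) - u p - re (a i * (z - zcoord i p)))
              / cmod (z - zcoord i p)) @ (zcoord i p)^' --> (0 : R).

Definition critical_point (R : realType) (S : topologicalType)
    (X : riemann_surface R S) (Psi : S -> R) (p : S) : Prop :=
  real_differential Psi p (fun _ : chart X => 0).

Definition saddle_point (R : realType) (S : topologicalType)
    (X : riemann_surface R S) (Psi : S -> R) (p : S) : Prop :=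
  critical_point X Psi p /\ ~ extremal_point Psi p.

(** * Small loops *)

Definition simple_loop (R : realType) (S : Type) (gamma : R -> S) : Prop :=
  forall s t, s \in `[0, 1[ -> t \in `[0, 1[ -> gamma s = gamma t -> s = t.

(* gamma winds once counterclockwise around p in the chart i: the argument
   theta of z_i - z_i(p) increases by 2 pi along gamma. *)
Definition winds_once (R : realType) (S : topologicalType)
    (X : riemann_surface R S) (i : chart X) (p : S) (gamma : R -> S) : Prop :=
  exists theta : R -> R, [/\ {within `[0, 1], continuous theta},
    forall t, t \in `[0, 1] -> zcoord i (gamma t) - zcoord i p =
      cpair (cmod (zcoord i (gamma t) - zcoord i p)) 0
      * cexp (cpair 0 (theta t)) &
    theta 1 = theta 0 + 2 * pi].

(* Continuing any function element of f along a simple, sufficiently small,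
   counterclockwise loop around p multiplies it by c. *)
Definition local_multiplier (R : realType) (S : topologicalType)
    (X : riemann_surface R S) (W : set S)
    (f : multivalued R W (univalent_element X)) (p : S) (c : Cx R) : Prop :=
  forall i : chart X, dom i p ->
    exists V, [/\ open_nbhs p V, V `<=` dom i, V `\ p `<=` W &
      forall (gamma : R -> S) q F F',
        path_in (V `\ p) gamma q q -> simple_loop gamma ->
        winds_once i p gamma -> elements f q F ->
        continuation (univalent_element X) gamma F F' ->
        \forall x \near q, F' x = sphere_scale c (F x)].

(* On a punctured neighbourhood V of p, continuation along every loop is
   trivial, and each function element of f extends to a single-valued branch
   G with a limit in C \ {0} at p. *)
Definition locally_trivial_at (R : realType) (S : topologicalType)
    (X : riemann_surface R S) (W : set S)
    (f : multivalued R W (univalent_element X)) (p : S) : Prop :=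
  exists V, [/\ open_nbhs p V, V `\ p `<=` W,
    (forall (gamma : R -> S) q F F',
       path_in (V `\ p) gamma q q -> elements f q F ->
       continuation (univalent_element X) gamma F F' ->
       \forall x \near q, F' x = F x) &
    (forall q F, (V `\ p) q -> elements f q F ->
       exists G : S -> Cx R,
         [/\ \forall x \near q, F x = Some (G x),
             forall x, (V `\ p) x -> elements f x (fun y => Some (G y)) &
             exists2 c : Cx R, c != 0 & G @ p^' --> c])].

(* Main.v *)
Require Import Defs.
From HB Require Import structures.
From mathcomp Require Import all_boot all_order all_algebra complex.
From mathcomp Require Import all_classical all_reals all_analysis.
From mathcomp Require Import ring lra zify.

Set Implicit Arguments.
Unset Strict Implicit.
Unset Printing Implicit Defensive.

Import Order.TTheory GRing.Theory Num.Theory.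
Import numFieldNormedType.Exports.

Local Open Scope classical_set_scope.
Local Open Scope ring_scope.

(** Why the theorem holds.  Put W for the complement of the cone points.
   On W, the form omega is single-valued and equals d (log F) for every function
   element F of f, so that any element is locally a constant times the
   exponential of a primitive of omega.  The height Psi
   determines |f|: the function L = ln (Psi / (4 - Psi)), called logit Psi
   below, is ln |f|^2, and the pullback of the spherical metric reads

     e^(2 g) = |omega|^2 Psi (4 - Psi) / 4        (metric_formula).

   Fix a point p with coordinate z, z (p) = 0.  Near p, write
   omega = z^m h dz with h holomorphic and h (0) <> 0.  Integrating,
   omega = d (z^(m+1) K + c log z) with K holomorphic and c the residue, and
   comparison with the elements of f along the half plane of logarithms of z
   gives (local_structure)

     L = 2 Re (z^(m+1) K) + 2 c ln |z| + const,   c real.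

   The rest is a case distinction on m (local_trichotomy).
   - If m <= -2, then L tends to +oo along one ray and to -oo along another,
     which contradicts the continuity of Psi at p.
   - If m = -1, then c = h (0) <> 0, so that L tends to -oo or to +oo according
     to the sign of c, and Psi (p) is 0 or 4.
   - If m >= 0, then c = 0 and L extends continuously to p, so that
     0 < Psi (p) < 4; as L - L (p) behaves like Re z^(m+1), the point p is not
     extremal, and it is critical exactly when m >= 1.
   Inserting this in the formula of the metric and comparing with the conical
   exponent, a being the angle of the cone divided by 2 pi (a = 1 on W), yields
   a = m + 1 in the last case and a = |c| in the second (metric_exponent).
   Hence extremal points are the simple poles of omega, saddle points are its
   zeros; the divisor and the residues are read off, and Y is 1 / omega.

   To write f as exp of the integral of omega, integral_multivalued continues
   primitives of omega along all paths that avoid the extremal points.  An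
   element of f and the exponential of a primitive differ by a locally constant
   factor, and both sets of elements spread over punctured discs, so that they
   determine each other.
   Around a saddle point omega has a holomorphic primitive, whence the trivial
   local monodromy; around an extremal point the primitive is
   c log z + holomorphic and a loop multiplies f by exp (2 pi i c)
   (irregular_multiplier).

   The complex analysis in one variable is developed from Goursat's theorem on
   rectangles: Cauchy formula, differentiability of the derivative,
   primitives, finite order of zeros. *)

(** * The complex plane: modulus and convergence *)

Section ComplexModulus.
Context {R : realType}.
Implicit Types (z w : Cx R).

Lemma cmodE z : `|z| = (cmod z)%:C%C :> Cx R.
Proof. by []. Qed.

Lemma cmod_ge0 z : 0 <= cmod z.
Proof. by case: z => a b; exact: sqrtr_ge0. Qed.

Lemma cmod0 : cmod (0 : Cx R) = 0.
Proof. exact: Normc.normc0. Qed.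

Lemma cmod_eq0 z : (cmod z == 0) = (z == 0).
Proof.
by apply/eqP/eqP => [/Normc.eq0_normc//|->]; exact: cmod0.
Qed.

Lemma cmod_gt0 z : (0 < cmod z) = (z != 0).
Proof. by rewrite lt_def cmod_ge0 andbT cmod_eq0. Qed.

Lemma cmodM z w : cmod (z * w) = cmod z * cmod w.
Proof. exact: Normc.normcM. Qed.

Lemma cmodV z : cmod z^-1 = (cmod z)^-1.
Proof. exact: Normc.normcV. Qed.

Lemma cmod1 : cmod (1 : Cx R) = 1.
Proof. exact: Normc.normc1. Qed.

Lemma cmodX z n : cmod (z ^+ n) = cmod z ^+ n.
Proof. by elim: n => [|n IH]; rewrite ?expr0 ?cmod1// !exprS cmodM IH. Qed.

Lemma cmodXz z (m : int) : cmod (z ^ m) = cmod z ^ m.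
Proof. by case: m => n; rewrite ?NegzE -?exprnP ?cmodX// -!exprnN cmodV cmodX. Qed.

Lemma cmodD z w : cmod (z + w) <= cmod z + cmod w.
Proof. exact: le_normcD. Qed.

Lemma cmodN z : cmod (- z) = cmod z.
Proof. exact: normcN. Qed.

Lemma cmodBC z w : cmod (z - w) = cmod (w - z).
Proof. by rewrite -cmodN opprB. Qed.

Lemma cmodB z w : cmod (z - w) <= cmod z + cmod w.
Proof. by rewrite -(cmodN w) cmodD. Qed.

Lemma cmod_le_add z w : cmod z <= cmod w + cmod (z - w).
Proof. by rewrite -{1}(subrK w z) addrC cmodD. Qed.

Lemma cmod_re z : `|re z| <= cmod z.
Proof. by case: z => a b /=; rewrite /cmod/= -sqrtr_sqr ler_wsqrtr// lerDl sqr_ge0. Qed.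

Lemma cmod_im z : `|im z| <= cmod z.
Proof. by case: z => a b /=; rewrite /cmod/= -sqrtr_sqr ler_wsqrtr// lerDr sqr_ge0. Qed.

Lemma cmod_sum z : cmod z <= `|re z| + `|im z|.
Proof.
case: z => a b /=; rewrite /cmod /re /im /=.
rewrite -(ger0_norm (addr_ge0 (normr_ge0 a) (normr_ge0 b))) -sqrtr_sqr ler_wsqrtr//.
rewrite sqrrD !real_normK ?num_real// -addrA (addrC (_ *+ 2)) addrA lerDl.
by rewrite mulrn_wge0// mulr_ge0.
Qed.

Lemma cmod_sqr z : cmod z ^+ 2 = re z ^+ 2 + im z ^+ 2.
Proof. by case: z => a b; rewrite /cmod /= sqr_sqrtr// addr_ge0 ?sqr_ge0. Qed.

Lemma cmod_pair0 (x : R) : cmod (cpair x 0) = `|x|.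
Proof. by rewrite /cmod /= expr0n addr0 sqrtr_sqr. Qed.

Lemma ltc_cmod z (e : R) : (`|z| < (e%:C)%C :> Cx R) = (cmod z < e).
Proof. by rewrite cmodE ltcR. Qed.

Lemma reD z w : re (z + w) = re z + re w. Proof. by case: z w => [? ?] []. Qed.
Lemma imD z w : im (z + w) = im z + im w. Proof. by case: z w => [? ?] []. Qed.
Lemma reN z : re (- z) = - re z. Proof. by case: z. Qed.
Lemma imN z : im (- z) = - im z. Proof. by case: z. Qed.
Lemma reB z w : re (z - w) = re z - re w. Proof. by rewrite reD reN. Qed.
Lemma imB z w : im (z - w) = im z - im w. Proof. by rewrite imD imN. Qed.
Lemma reM z w : re (z * w) = re z * re w - im z * im w.
Proof. by case: z w => [? ?] []. Qed.
Lemma imM z w : im (z * w) = re z * im w + im z * re w.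
Proof. by case: z w => [? ?] []. Qed.
Lemma re_cpair (x y : R) : re (cpair x y) = x. Proof. by []. Qed.
Lemma im_cpair (x y : R) : im (cpair x y) = y. Proof. by []. Qed.

Lemma cx_eqP z w : re z = re w -> im z = im w -> z = w.
Proof. by case: z w => [a b] [c d] /= -> ->. Qed.

Lemma cpairK z : cpair (re z) (im z) = z. Proof. by case: z. Qed.

Lemma cpairD (a b c d : R) : cpair (a + c) (b + d) = cpair a b + cpair c d.
Proof. by []. Qed.

Definition cxE := (reD, imD, reN, imN, reM, imM, re_cpair, im_cpair).

Lemma nbhs_cxP (z0 : Cx R) (P : Cx R -> Prop) :
  (\forall z \near z0, P z) <->
  exists2 e : R, 0 < e & forall z, cmod (z - z0) < e -> P z.
Proof.
split=> [/nbhs_ballP[e /= e0 He]|[e e0 He]].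
  exists (re e) => [|z ze]; first by move: e0; rewrite ltcE /= => /andP[].
  apply: He; rewrite /ball/= distrC.
  have -> : e = ((re e)%:C)%C.
    by move: e0; rewrite ltcE /= => /andP[/eqP + _]; case: (e) => a b /= ->.
  by rewrite ltc_cmod.
apply/nbhs_ballP; exists (e%:C)%C => /=; first by rewrite ltcR.
by move=> z; rewrite /ball/= distrC ltc_cmod => /He.
Qed.

Lemma dnbhs_cxP (z0 : Cx R) (P : Cx R -> Prop) :
  (\forall z \near z0^', P z) <->
  exists2 e : R, 0 < e & forall z, z != z0 -> cmod (z - z0) < e -> P z.
Proof.
rewrite /dnbhs /within /=; split.
  move=> /nbhs_cxP[e e0 He]; exists e => // z zz0 /He; exact.
move=> [e e0 He]; apply/nbhs_cxP; exists e => // z ze zz0; exact: He.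
Qed.

Lemma near_dnbhs_cx (z0 : Cx R) (P : Cx R -> Prop) :
  (\forall z \near z0, P z) -> \forall z \near z0^', P z.
Proof. by move=> /nbhs_cxP[e e0 He]; apply/dnbhs_cxP; exists e => // z _ /He. Qed.

Lemma cvg_cxP (T : Type) (F : set_system T) {FF : Filter F} (f : T -> Cx R) (l : Cx R) :
  f @ F --> l <-> forall e : R, 0 < e -> \forall t \near F, cmod (f t - l) < e.
Proof.
split=> [fl e e0|H]; first by
  apply: (fl (fun w => cmod (w - l) < e)); apply/nbhs_cxP; exists e.
move=> A /nbhs_cxP[e e0 He]; rewrite /nbhs/=; apply: filterS (H _ e0) => t; exact: He.
Qed.

Lemma cont_cxP (F : Cx R -> Cx R) z : {for z, continuous F} <->
  forall e : R, 0 < e -> exists2 d : R, 0 < d &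
    forall w, cmod (w - z) < d -> cmod (F w - F z) < e.
Proof.
split=> [Fz e e0|H A /nbhs_cxP[e e0 He]].
  have /(_ _)/nbhs_cxP := Fz (fun w => cmod (w - F z) < e); apply.
  by apply/nbhs_cxP; exists e.
have [d d0 Hd] := H _ e0.
by apply/nbhs_cxP; exists d => // w /Hd /He.
Qed.

Lemma contR_cxP (F : Cx R -> R) z : {for z, continuous F} <->
  forall e : R, 0 < e -> exists2 d : R, 0 < d &
    forall w, cmod (w - z) < d -> `|F w - F z| < e.
Proof.
split=> [Fz e e0|H A /nbhs_ballP[e /= e0 He]].
  have /(_ _)/nbhs_cxP := Fz (fun w : R => `|w - F z| < e); apply.
  by apply/nbhs_ballP; exists e => // w; rewrite /ball/= (distrC w).
have [d d0 Hd] := H _ e0.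
by apply/nbhs_cxP; exists d => // w /Hd wd; apply: He; rewrite /ball/= distrC.
Qed.

Lemma re_continuous : continuous (@re R : Cx R -> R).
Proof.
move=> z A /nbhs_ballP[e /= e0 He]; apply/nbhs_cxP; exists e => // w zw.
apply: He; rewrite /ball/=; move: zw.
by rewrite distrC -reB; apply: le_lt_trans; exact: cmod_re.
Qed.

Lemma im_continuous : continuous (@im R : Cx R -> R).
Proof.
move=> z A /nbhs_ballP[e /= e0 He]; apply/nbhs_cxP; exists e => // w zw.
apply: He; rewrite /ball/=; move: zw.
by rewrite distrC -imB; apply: le_lt_trans; exact: cmod_im.
Qed.

Lemma cmod_continuous : continuous (@cmod R : Cx R -> R).
Proof.
move=> z A /nbhs_ballP[e /= e0 He]; apply/nbhs_cxP; exists e => // w zw.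
apply: He; rewrite /ball/=; move: zw.
apply: le_lt_trans; rewrite ler_norml; apply/andP; split.
  rewrite lerBrDl -lerBrDr opprK; exact: cmod_le_add.
by rewrite lerBlDl cmodBC; exact: cmod_le_add.
Qed.

Lemma cpair_cvg (T : Type) (F : set_system T) {FF : Filter F} (f g : T -> R) (a b : R) :
  f @ F --> a -> g @ F --> b -> (fun t => cpair (f t) (g t)) @ F --> (cpair a b : Cx R).
Proof.
move=> fa gb A /nbhs_cxP[e e0 He].
have e2 : 0 < e / 2 by rewrite divr_gt0.
have /cvgrPdist_lt/(_ _ e2) fa' := fa; have /cvgrPdist_lt/(_ _ e2) gb' := gb.
rewrite /nbhs /=; near=> t; apply: He.
apply: le_lt_trans (cmod_sum _) _; rewrite reB imB /= (splitr e) ltrD// distrC.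
  by near: t.
by near: t.
Unshelve. all: by end_near. Qed.

End ComplexModulus.

(** * Complex derivatives *)

Section ComplexDerivative.
Context {R : realType}.
Implicit Types (z w : Cx R) (F G : Cx R -> Cx R).

(** The epsilon form of complex differentiability, in terms of the real
   modulus; it avoids the topology of the abstract number field in estimates. *)
Definition cder F z (l : Cx R) : Prop :=
  forall e : R, 0 < e -> exists2 d : R, 0 < d &
    forall w, cmod (w - z) < d -> cmod (F w - F z - l * (w - z)) <= e * cmod (w - z).

Lemma cderP F z l : cder F z l <-> is_derive z (1 : Cx R) F l.
Proof.
split=> [H|[]].
  suff K : (fun h : Cx R => h^-1 *: ((F \o shift z) (h *: (1 : Cx R)) - F z)) @ 0^' --> l.
    by split; [apply/cvg_ex; exists l | exact: cvg_lim].
  apply/cvg_cxP => e e0.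
  have e2 : 0 < e / 2 by rewrite divr_gt0.
  have [d d0 Hd] := H _ e2.
  apply/dnbhs_cxP; exists d => // h h0; rewrite subr0 => hd.
  rewrite /= /GRing.scale /= mulr1.
  have := Hd (h + z); rewrite addrK => /(_ hd) K.
  have -> : h^-1 * (F (h + z) - F z) - l = h^-1 * (F (h + z) - F z - l * h).
    by field.
  rewrite cmodM cmodV mulrC ltr_pdivrMr ?cmod_gt0//.
  apply: le_lt_trans K _; rewrite ltr_pM2r ?cmod_gt0//.
  by rewrite ltr_pdivrMr// ltr_pMr// ltr1n.
rewrite /derivable /derive => dF <- e e0.
have /cvg_cxP/(_ _ e0)/dnbhs_cxP[d d0 Hd] := dF.
exists d => // w wd.
have [->|wz] := eqVneq w z; first by rewrite !subrr mulr0 subr0 cmod0 mulr0.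
have wz0 : w - z != 0 by rewrite subr_eq0.
have := Hd (w - z) wz0; rewrite subr0 => /(_ wd).
rewrite /= /GRing.scale /= mulr1 subrK => K.
set l0 := lim _ in K *.
have -> : F w - F z - l0 * (w - z) = (w - z) * ((w - z)^-1 * (F w - F z) - l0).
  by field.
by rewrite cmodM mulrC ler_wpM2r ?cmod_ge0// ltW.
Qed.

Lemma cder_derive1 F z l : cder F z l -> derive1 F z = l.
Proof. by move/cderP => H; rewrite derive1E derive_val. Qed.

Lemma cder_derivable F z l : cder F z l -> derivable F z (1 : Cx R).
Proof. by move/cderP => []. Qed.

Lemma derivable_cder F z : derivable F z (1 : Cx R) -> cder F z (derive1 F z).
Proof. by move=> H; apply/cderP; rewrite derive1E; exact/derivableP. Qed.

Lemma cder_uniq F z l l' : cder F z l -> cder F z l' -> l = l'.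
Proof. by move=> /cder_derive1 <- /cder_derive1. Qed.

Lemma cder_cst (c : Cx R) z : cder (fun=> c) z 0.
Proof. by apply/cderP; exact: is_derive_cst. Qed.

Lemma cder_id z : cder (fun w => w) z 1.
Proof. by apply/cderP; exact: is_derive_id. Qed.

Lemma cderD F G z a b : cder F z a -> cder G z b -> cder (fun w => F w + G w) z (a + b).
Proof. by move=> /cderP ? /cderP ?; apply/cderP; exact: is_deriveD. Qed.

Lemma cderN F z a : cder F z a -> cder (fun w => - F w) z (- a).
Proof. by move=> /cderP ?; apply/cderP; exact: is_deriveN. Qed.

Lemma cderB F G z a b : cder F z a -> cder G z b -> cder (fun w => F w - G w) z (a - b).
Proof. by move=> ? /cderN; exact: cderD. Qed.

Lemma cderM F G z a b : cder F z a -> cder G z b ->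
  cder (fun w => F w * G w) z (a * G z + F z * b).
Proof.
move=> Fa0 Gb0; have Fa := (cderP _ _ _).1 Fa0; have Gb := (cderP _ _ _).1 Gb0.
apply: (cderP _ _ _).2.
have := @is_deriveM _ _ F G z 1 _ _ Fa Gb.
by rewrite /GRing.scale /= addrC (mulrC (G z)).
Qed.

Lemma cderZ F c z a : cder F z a -> cder (fun w => c * F w) z (c * a).
Proof. by move=> Fa; have := cderM (cder_cst c z) Fa; rewrite mul0r add0r. Qed.

Lemma cder_cont F z a : cder F z a -> {for z, continuous F}.
Proof.
move=> Fa; apply/cont_cxP => e e0.
have K0 : 0 < 1 + cmod a by rewrite ltr_wpDr// cmod_ge0.
have [d d0 Hd] := Fa _ ltr01.
exists (Num.min d (e / (1 + cmod a))) => [|w].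
  by rewrite lt_min d0 divr_gt0.
rewrite lt_min ltr_pdivlMr// => /andP[/Hd wd we].
apply: le_lt_trans (cmod_le_add _ (a * (w - z))) _.
rewrite mul1r in wd; apply: le_lt_trans we.
by rewrite [leRHS]mulrDr mulr1 addrC cmodM (mulrC (cmod a)) lerD2r.
Qed.

Lemma cderV F z a : F z != 0 -> cder F z a -> cder (fun w => (F w)^-1) z (- a / F z ^+ 2).
Proof.
move=> Fz /cderP[dF <-]; apply/cderP; split; first exact: derivableV.
rewrite deriveV// /GRing.scale /= mulNr mulrC mulNr; congr (- _).
Qed.

Lemma cder_eq F G z a b : cder F z a -> (\forall w \near z, F w = G w) -> a = b -> cder G z b.
Proof.
move=> H /nbhs_cxP[e e0 He] <- t t0; have [d d0 Hd] := H _ t0.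
exists (Num.min d e) => [|w]; first by rewrite lt_min d0.
rewrite lt_min => /andP[wd we]; rewrite -!He ?subrr ?cmod0//; exact: Hd.
Qed.

Lemma cder_comp F G z a b : cder F z a -> cder G (F z) b -> cder (fun w => G (F w)) z (b * a).
Proof.
move=> Fa Gb e e0.
set K := cmod a + 1.
have K0 : 0 < K by rewrite ltr_wpDl// cmod_ge0.
have B0 : 0 < cmod b + 1 by rewrite ltr_wpDl// cmod_ge0.
have [d1 d10 H1] := Fa _ ltr01.
have e2 : 0 < e / 2 / K by rewrite !divr_gt0.
have e3 : 0 < e / 2 / (cmod b + 1) by rewrite !divr_gt0.
have [d2 d20 H2] := Gb _ e2.
have [d3 d30 H3] := Fa _ e3.
exists (Num.min d1 (Num.min d3 (d2 / K))) => [|w].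
  by rewrite !lt_min d10 d30 divr_gt0.
rewrite !lt_min => /and3P[wd1 wd3]; rewrite ltr_pdivlMr// mulrC => wd2.
have FK : cmod (F w - F z) <= K * cmod (w - z).
  have := H1 _ wd1; rewrite mul1r => h.
  apply: le_trans (cmod_le_add _ (a * (w - z))) _.
  by rewrite mulrDl cmodM mul1r lerD2l.
have -> : G (F w) - G (F z) - b * a * (w - z) =
  (G (F w) - G (F z) - b * (F w - F z)) + b * (F w - F z - a * (w - z)).
  by ring.
apply: le_trans (cmodD _ _) _.
rewrite [e]splitr mulrDl lerD//.
  have := H2 (F w) (le_lt_trans FK wd2) => /le_trans; apply.
  have -> : e / 2 * cmod (w - z) = e / 2 / K * (K * cmod (w - z)).
    by field; rewrite gt_eqF.
  by rewrite ler_wpM2l// ltW.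
rewrite cmodM; have h := H3 _ wd3.
 have -> : e / 2 * cmod (w - z) =
    (cmod b + 1) * (e / 2 / (cmod b + 1) * cmod (w - z)).
  by field; rewrite gt_eqF.
by apply: ler_pM; rewrite ?cmod_ge0// lerDl.
Qed.

Lemma cderX F n z a : cder F z a -> cder (fun w => F w ^+ n.+1) z (n.+1%:R * F z ^+ n * a).
Proof.
move=> Fa; elim: n => [|n IH].
  by rewrite mul1r expr0 mul1r.
apply: (cder_eq (cderM Fa IH)).
  by apply/nbhs_cxP; exists 1 => // w _; rewrite -exprS.
by rewrite [n.+2%:R]mulrS [F z ^+ n.+1]exprS; ring.
Qed.

End ComplexDerivative.

(** * Mean value inequalities *)

Section MeanValue.
Context {R : realType}.
Implicit Types (z w : Cx R) (F G : Cx R -> Cx R).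

Lemma is_derive_eps (f : R -> R) (t l : R) :
  (forall e : R, 0 < e -> exists2 d : R, 0 < d & forall s, `|s - t| < d ->
     `|f s - f t - l * (s - t)| <= e * `|s - t|) ->
  is_derive t (1 : R) f l.
Proof.
move=> H.
suff K : (fun h : R => h^-1 *: ((f \o shift t) (h *: (1 : R)) - f t)) @ 0^' --> l.
  by split; [apply/cvg_ex; exists l | exact: cvg_lim].
apply/cvgrPdist_le => e e0.
have [d d0 Hd] := H _ e0.
near=> h.
have h0 : h != 0 by near: h; exact: nbhs_dnbhs_neq.
have hd : `|h| < d.
  by near: h; apply: dnbhs0_lt.
rewrite /= /GRing.scale /= mulr1 distrC.
have -> : h^-1 * (f (h + t) - f t) - l = h^-1 * (f (h + t) - f t - l * h).
  by field.
rewrite normrM normfV mulrC ler_pdivrMr ?normr_gt0//.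
by have := Hd (h + t); rewrite addrK; exact.
Unshelve. all: by end_near. Qed.

Definition seg (y x : Cx R) (t : R) : Cx R := y + cpair t 0 * (x - y).

Lemma seg0 x y : seg y x 0 = y.
Proof. by rewrite /seg (_ : cpair 0 0 = 0)// mul0r addr0. Qed.

Lemma seg1 x y : seg y x 1 = x.
Proof. by rewrite /seg (_ : cpair 1 0 = 1)// mul1r addrC subrK. Qed.

Lemma seg_ball z0 (r : R) x y t : cmod (x - z0) < r -> cmod (y - z0) < r ->
  0 <= t <= 1 -> cmod (seg y x t - z0) < r.
Proof.
move=> xr yr /andP[t0 t1].
have -> : seg y x t - z0 = cpair (1 - t) 0 * (y - z0) + cpair t 0 * (x - z0).
  rewrite /seg (_ : cpair (1 - t) 0 = 1 - cpair t 0); last by apply: cx_eqP; rewrite !cxE/= ?subr0.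
  by ring.
apply: le_lt_trans (cmodD _ _) _.
rewrite !cmodM !cmod_pair0 !ger0_norm ?subr_ge0//.
have [->|tn0] := eqVneq t 0; first by rewrite mul0r addr0 subr0 mul1r.
have tp : 0 < t by rewrite lt_def tn0.
rewrite (_ : r = (1 - t) * r + t * r); last by ring.
by rewrite ler_ltD ?ltr_pM2l// ler_wpM2l ?subr_ge0// ltW.
Qed.

Lemma line_derive F (a v c l : Cx R) (t : R) : cder F (a + cpair t 0 * v) l ->
  is_derive t (1 : R) (fun s : R => re (c * F (a + cpair s 0 * v))) (re (c * l * v)).
Proof.
move=> Fl; apply: is_derive_eps => e e0.
set K := cmod c * cmod v + 1.
have K0 : 0 < K by rewrite ltr_wpDl// mulr_ge0// cmod_ge0.
have eK : 0 < e / K by rewrite divr_gt0.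
have [d d0 Hd] := Fl _ eK.
exists (d / (cmod v + 1)) => [|s].
  by rewrite divr_gt0// ltr_wpDl// cmod_ge0.
rewrite ltr_pdivlMr ?ltr_wpDl// ?cmod_ge0// => st.
have E : a + cpair s 0 * v - (a + cpair t 0 * v) = cpair (s - t) 0 * v.
  rewrite (_ : cpair (s - t) 0 = cpair s 0 - cpair t 0); last by apply: cx_eqP; rewrite !cxE/= ?subr0.
  by ring.
have := Hd (a + cpair s 0 * v); rewrite E cmodM cmod_pair0.
have st' : `|s - t| * cmod v < d.
  by apply: le_lt_trans st; rewrite ler_wpM2l// lerDl.
move=> /(_ st') h.
have -> : re (c * F (a + cpair s 0 * v)) - re (c * F (a + cpair t 0 * v)) - re (c * l * v) * (s - t)
  = re (c * (F (a + cpair s 0 * v) - F (a + cpair t 0 * v) - l * (cpair (s - t) 0 * v))).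
  have -> : re (c * l * v) * (s - t) = re (c * l * v * cpair (s - t) 0).
    by rewrite [RHS]reM !re_cpair im_cpair mulr0 subr0.
  by rewrite -!reB; congr (re _); ring.
apply: le_trans (cmod_re _) _; rewrite cmodM.
apply: le_trans (ler_wpM2l (cmod_ge0 _) h) _.
rewrite [leLHS](_ : _ = e * `|s - t| * (cmod c * cmod v / K)); last by ring.
rewrite ler_piMr ?mulr_ge0//; first exact: ltW.
by rewrite ler_pdivrMr// mul1r lerDl.
Qed.

(** Hypotheses on t are symmetric in a and b so that the order of the end
   points does not matter. *)
Lemma real_mvi (f df : R -> R) (c e a b : R) :
  (forall t, `|t - a| <= `|b - a| -> `|t - b| <= `|b - a| ->
    is_derive t (1 : R) f (df t) /\ `|df t - c| <= e) ->
  `|f b - f a - c * (b - a)| <= e * `|b - a|.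
Proof.
wlog ab : a b f df c / a <= b => [hw H|H].
  have [ab|/ltW ba] := leP a b; first exact: (hw _ _ _ df).
  have := hw (- a) (- b) (fun t => f (- t)) (fun t => - df (- t)) (- c).
  rewrite lerN2 !opprK => /(_ ba).
  rewrite (_ : - c * (- b + a) = c * (b - a)); last by ring.
  rewrite (_ : - b + a = - (b - a)) ?normrN; last by ring.
  move=> K; apply: K => t t1 t2.
  have [||ft dt] := H (- t).
  - by rewrite -normrN opprD !opprK.
  - by rewrite -normrN opprD !opprK.
  split.
    have := @is_derive1_comp _ f (fun s => - s) t (df (- t)) (- 1) ft (is_deriveNid _ _).
    by rewrite mulrN1.
  by rewrite -normrN opprD opprK.
have [<-|nab] := eqVneq a b; first by rewrite !subrr mulr0 subr0 normr0 mulr0.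
have {nab}ab' : a < b by rewrite lt_neqAle nab.
have fd (t : R) : t \in `[a, b]%R -> is_derive t (1 : R) f (df t) /\ `|df t - c| <= e.
  rewrite in_itv /= => /andP[at_ tb]; apply: H.
    by rewrite !ger0_norm ?subr_ge0// lerD2r.
  by rewrite distrC !ger0_norm ?subr_ge0// lerD2l lerN2.
have [||t tab ->] := @MVT R f df a b ab'.
- by move=> t /subset_itv_oo_cc /fd[].
- by apply: derivable_within_continuous => t /fd[[]].
rewrite -mulrBl normrM ler_wpM2r//.
by have [] := fd _ (subset_itv_oo_cc tab).
Qed.

(** The derivative of F is tested against the conjugate of F x - F y, which
   reduces the complex statement to the real mean value theorem on the segment. *)
Lemma mvi F F' x y (M : R) :
  (forall t, 0 <= t <= 1 -> cder F (seg y x t) (F' (seg y x t)) /\ cmod (F' (seg y x t)) <= M) ->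
  cmod (F x - F y) <= M * cmod (x - y).
Proof.
move=> H.
set D := F x - F y.
have [->|D0] := eqVneq D 0.
  rewrite cmod0 mulr_ge0 ?cmod_ge0//.
  by have [|_] := H 0; rewrite ?lexx ?ler01//; apply: le_trans; exact: cmod_ge0.
set c := cpair (re D) (- im D).
have cD : cmod c = cmod D by rewrite /cmod /c /= sqrrN; case: (D).
pose f s := re (c * F (seg y x s)).
pose df s := re (c * F' (seg y x s) * (x - y)).
have K : `|f 1 - f 0 - 0 * (1 - 0)| <= cmod D * M * cmod (x - y) * `|(1 : R) - 0|.
  apply: (@real_mvi f df) => t; rewrite subr0 [`|1 - 0|]ger0_norm ?subr0// => t1 t2.
  have t01 : 0 <= t <= 1.
    have := le_trans (ler_norm _) t1; have := ler_norm (1 - t); rewrite distrC => h1 h2.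
    by apply/andP; split=> //; have := le_trans h1 t2; rewrite lerBlDr lerDl.
  split; first by have [ft _] := H t t01; exact: line_derive ft.
  have [_ tM] := H t t01.
  apply: le_trans (cmod_re _) _; rewrite !cmodM cD.
  by rewrite ler_wpM2r ?cmod_ge0// ler_wpM2l ?cmod_ge0.
move: K; rewrite mul0r !subr0 normr1 mulr1 {1}/f seg1 /f seg0 -reB -mulrBr -/D.
have -> : re (c * D) = cmod D ^+ 2.
  by rewrite cmod_sqr reM /= mulNr opprK !expr2.
rewrite ger0_norm ?sqr_ge0// expr2 -mulrA ler_pM2l// cmod_gt0//.
Qed.

Lemma mvi_ball F F' z0 (r M : R) x y :
  (forall z, cmod (z - z0) < r -> cder F z (F' z) /\ cmod (F' z) <= M) ->
  cmod (x - z0) < r -> cmod (y - z0) < r -> cmod (F x - F y) <= M * cmod (x - y).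
Proof. by move=> H xr yr; apply: mvi => t t01; apply: H; exact: seg_ball. Qed.

Lemma cder0_cst F z0 (r : R) x y : (forall z, cmod (z - z0) < r -> cder F z 0) ->
  cmod (x - z0) < r -> cmod (y - z0) < r -> F x = F y.
Proof.
move=> H xr yr; apply/eqP; rewrite -subr_eq0 -cmod_eq0 eq_le cmod_ge0 andbT.
rewrite -(mul0r (cmod (x - y))); apply: (@mvi_ball _ (fun=> 0) z0 r) => // z /H ?.
by rewrite cmod0.
Qed.

(** The Cauchy-Riemann criterion: the hypotheses say that the partial
   derivatives of K are k and i k. *)
Lemma cder_partials (K k : Cx R -> Cx R) z0 (r : R) : 0 < r ->
  (forall z, cmod (z - z0) < r -> [/\
     is_derive (re z) (1 : R) (fun t : R => re (K (cpair t (im z)))) (re (k z)),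
     is_derive (re z) (1 : R) (fun t : R => im (K (cpair t (im z)))) (im (k z)),
     is_derive (im z) (1 : R) (fun t : R => re (K (cpair (re z) t))) (- im (k z)) &
     is_derive (im z) (1 : R) (fun t : R => im (K (cpair (re z) t))) (re (k z))]) ->
  {for z0, continuous k} -> cder K z0 (k z0).
Proof.
move=> r0 H /cont_cxP kc e e0.
have e4 : 0 < e / 4 by rewrite divr_gt0.
have [d d0 Hd] := kc _ e4.
have m0 : 0 < Num.min r d / 2 by rewrite divr_gt0// lt_min r0.
exists (Num.min r d / 2) => // z zd.
have near0 w : `|re w - re z0| <= `|re z - re z0| -> `|im w - im z0| <= `|im z - im z0| ->
    cmod (w - z0) < r /\ cmod (w - z0) < d.
  move=> a b; apply/andP; rewrite -lt_min; apply: le_lt_trans (cmod_sum _) _.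
  rewrite !reB !imB [ltRHS]splitr ltrD//.
    by apply: le_lt_trans a _; apply: le_lt_trans zd; rewrite -reB cmod_re.
  by apply: le_lt_trans b _; apply: le_lt_trans zd; rewrite -imB cmod_im.
have knear w : `|re w - re z0| <= `|re z - re z0| -> `|im w - im z0| <= `|im z - im z0| ->
    `|re (k w) - re (k z0)| <= e / 4 /\ `|im (k w) - im (k z0)| <= e / 4.
  move=> a b; have [_ /Hd/ltW h] := near0 _ a b.
  by rewrite -reB -imB; split; apply: le_trans h; rewrite ?cmod_re ?cmod_im.
set m := cpair (re z) (im z0).
have Er : `|re (K m) - re (K z0) - re (k z0) * (re z - re z0)| <= e / 4 * cmod (z - z0).
  rewrite -[in re (K z0)](cpairK z0).
  apply: le_trans (_ : e / 4 * `|re z - re z0| <= _).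
    apply: (@real_mvi (fun t => re (K (cpair t (im z0)))) (fun t => re (k (cpair t (im z0))))) => t tz _.
    split; last by have [] := knear (cpair t (im z0)) tz; rewrite ?subrr ?normr0.
    by have [] := H (cpair t (im z0)); have [] := near0 (cpair t (im z0)) tz; rewrite ?subrr ?normr0.
  by rewrite ler_wpM2l// ?(ltW e4)// -reB cmod_re.
have Ei : `|im (K m) - im (K z0) - im (k z0) * (re z - re z0)| <= e / 4 * cmod (z - z0).
  rewrite -[in im (K z0)](cpairK z0).
  apply: le_trans (_ : e / 4 * `|re z - re z0| <= _).
    apply: (@real_mvi (fun t => im (K (cpair t (im z0)))) (fun t => im (k (cpair t (im z0))))) => t tz _.
    split; last by have [] := knear (cpair t (im z0)) tz; rewrite ?subrr ?normr0.
    by have [] := H (cpair t (im z0)); have [] := near0 (cpair t (im z0)) tz; rewrite ?subrr ?normr0.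
  by rewrite ler_wpM2l// ?(ltW e4)// -reB cmod_re.
have Fr : `|re (K z) - re (K m) - (- im (k z0)) * (im z - im z0)| <= e / 4 * cmod (z - z0).
  rewrite -[in re (K z)](cpairK z).
  apply: le_trans (_ : e / 4 * `|im z - im z0| <= _).
    apply: (@real_mvi (fun t => re (K (cpair (re z) t))) (fun t => - im (k (cpair (re z) t)))) => t tz _.
    split; last by rewrite -opprD normrN; have [] := knear (cpair (re z) t) (lexx _) tz.
    by have [] := H (cpair (re z) t); have [] := near0 (cpair (re z) t) (lexx _) tz.
  by rewrite ler_wpM2l// ?(ltW e4)// -imB cmod_im.
have Fi : `|im (K z) - im (K m) - re (k z0) * (im z - im z0)| <= e / 4 * cmod (z - z0).
  rewrite -[in im (K z)](cpairK z).
  apply: le_trans (_ : e / 4 * `|im z - im z0| <= _).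
    apply: (@real_mvi (fun t => im (K (cpair (re z) t))) (fun t => re (k (cpair (re z) t)))) => t tz _.
    split; last by have [] := knear (cpair (re z) t) (lexx _) tz.
    by have [] := H (cpair (re z) t); have [] := near0 (cpair (re z) t) (lexx _) tz.
  by rewrite ler_wpM2l// ?(ltW e4)// -imB cmod_im.
apply: le_trans (cmod_sum _) _.
have := ler_normD (re (K z) - re (K m) - (- im (k z0)) * (im z - im z0))
  (re (K m) - re (K z0) - re (k z0) * (re z - re z0)).
have := ler_normD (im (K z) - im (K m) - re (k z0) * (im z - im z0))
  (im (K m) - im (K z0) - im (k z0) * (re z - re z0)).
set a := `|_ + _|; set b := `|_ + _|.
have -> : `|re (K z - K z0 - k z0 * (z - z0))| = b.
  by rewrite /b !cxE; congr (`|_|); ring.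
have -> : `|im (K z - K z0 - k z0 * (z - z0))| = a.
  by rewrite /a !cxE; congr (`|_|); ring.
move=> ha hb; lra.
Qed.

End MeanValue.

(** * The complex exponential *)

Section ComplexExponential.
Context {R : realType}.
Implicit Types (z w l : Cx R).

Lemma cexpD z w : cexp (z + w) = cexp z * cexp w.
Proof.
by apply: cx_eqP; rewrite /cexp !cxE expRD ?cosD ?sinD; ring.
Qed.

Lemma cexp0 : cexp (0 : Cx R) = 1.
Proof. by apply: cx_eqP; rewrite /cexp /= expR0 ?cos0 ?sin0 ?mulr1 ?mulr0. Qed.

Lemma cmod_cexp z : cmod (cexp z) = expR (re z).
Proof.
apply/eqP; rewrite -(@eqrXn2 _ 2) ?cmod_ge0 ?expR_ge0//; apply/eqP.
by rewrite cmod_sqr /cexp !cxE !exprMn -mulrDr cos2Dsin2 mulr1.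
Qed.

Lemma cexp_neq0 z : cexp z != 0.
Proof. by rewrite -cmod_gt0 cmod_cexp expR_gt0. Qed.

Lemma cexp_2pi : cexp (cpair 0 (2 * pi) : Cx R) = 1.
Proof. by apply: cx_eqP; rewrite /cexp !cxE expR0 mulr_natl ?cos2pi ?sin2pi ?mulr1 ?mulr0. Qed.

(** Polar coordinates; the real part of a logarithm is forced. *)
Lemma cexp_surj z : z != 0 -> exists2 l, cexp l = z & re l = ln (cmod z).
Proof.
move=> z0; have m0 : 0 < cmod z by rewrite cmod_gt0.
have [x [y [Exy xy1]]] : exists x y : R, z = cpair (cmod z * x) (cmod z * y) /\ x ^+ 2 + y ^+ 2 = 1.
  exists (re z / cmod z), (im z / cmod z); split.
    by apply: cx_eqP; rewrite !cxE mulrCA divff ?gt_eqF// mulr1.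
  by rewrite !exprMn -mulrDl -cmod_sqr -exprMn divff ?gt_eqF// expr1n.
have [t [ct st]] : exists t : R, cos t = x /\ sin t = y.
  have x1 : -1 <= x <= 1.
    rewrite -ler_norml -(@ler_pXn2r _ 2) ?nnegrE// expr1n real_normK ?num_real//.
    by rewrite -xy1 lerDl sqr_ge0.
  have sE : sin (acos x) = `|y|.
    rewrite sin_acos// (_ : 1 - x ^+ 2 = y ^+ 2) ?sqrtr_sqr//.
    by rewrite -xy1; ring.
  have cE : cos (acos x) = x by apply: acosK; rewrite in_itv.
  have [y0|y0] := leP 0 y.
    by exists (acos x); rewrite cE sE ger0_norm.
  by exists (- acos x); rewrite cosN sinN cE sE ltr0_norm// opprK.
exists (cpair (ln (cmod z)) t) => //.
by rewrite Exy /cexp !cxE -Exy lnK// ct st.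
Qed.

Lemma is_deriveMcst (f : R -> R) (x l c : R) : is_derive x (1 : R) f l ->
  is_derive x (1 : R) (fun t => f t * c) (l * c).
Proof.
move=> fl; have := is_deriveM fl (is_derive_cst c x (1 : R)).
by rewrite scaler0 add0r /GRing.scale /= (mulrC c).
Qed.

Lemma is_deriveMcstl (f : R -> R) (x l c : R) : is_derive x (1 : R) f l ->
  is_derive x (1 : R) (fun t => c * f t) (c * l).
Proof.
move=> fl; have := is_deriveM (is_derive_cst c x (1 : R)) fl.
by rewrite scaler0 addr0 /GRing.scale /=.
Qed.

Lemma cexp_continuous : continuous (@cexp R : Cx R -> Cx R).
Proof.
move=> z; have FF : Filter (nbhs (z : Cx R)) by exact: nbhs_filter.
have reE : expR (re t) @[t --> (z : Cx R)] --> expR (re z).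
  exact: (continuous_comp (@re_continuous R z) (@continuous_expR R _)).
by apply: (@cpair_cvg R _ _ FF); apply: (@cvgM _ _ _ FF) => //;
  [exact: (continuous_comp (@im_continuous R z) (@continuous_cos R _))
  |exact: (continuous_comp (@im_continuous R z) (@continuous_sin R _))].
Qed.

Lemma cder_cexp z : cder (@cexp R) z (cexp z).
Proof.
apply: (@cder_partials R (@cexp R) (@cexp R) z 1 ltr01) => [w _|]; last exact: cexp_continuous.
rewrite /cexp /=; split.
- exact: is_deriveMcst.
- exact: is_deriveMcst.
- by rewrite -mulrN; apply: is_deriveMcstl.
- exact: is_deriveMcstl.
Qed.

Lemma cder_cexp_comp (F : Cx R -> Cx R) z a : cder F z a ->
  cder (fun w => cexp (F w)) z (cexp (F z) * a).
Proof. by move=> Fa; apply: cder_comp Fa (cder_cexp _). Qed.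

End ComplexExponential.

(** * Integrals along the sides of rectangles *)

Section RealIntegral.
Context {R : realType}.
Notation mu := (@lebesgue_measure R).

Definition rint (f : R -> R) (a b : R) : R := (\int[mu]_(x in `[a, b]) f x)%R.

Definition antid (Q q : R -> R) (a b : R) : Prop :=
  {within `[a, b], continuous Q} /\ forall x, a < x < b -> is_derive x (1 : R) Q (q x).

Lemma rint_antid (f : R -> R) (a b : R) : a < b ->
  (forall x, a <= x <= b -> {for x, continuous f}) -> antid (rint f a) f a b.
Proof.
move=> ab fc.
have fI : mu.-integrable `[a, b] (EFin \o f).
  apply: continuous_compact_integrable; first exact: segment_compact.
  by apply: continuous_in_subspaceT => x; rewrite inE /= in_itv /= => /fc.
split; first exact: (parameterized_integral_continuous (ltW ab) fI).
move=> x /andP[ax xb].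
have [|d1 d2] := continuous_FTC1_closed xb fI ax _.
  by apply: fc; rewrite !ltW.
by rewrite -d2 derive1E; exact/derivableP.
Qed.

Lemma rint_aa f a : rint f a a = 0.
Proof. by rewrite /rint set_itv1 Rintegral_set1. Qed.

(** An integral is compared with the increment of any function whose
   derivative is uniformly close to the integrand. *)
Lemma rint_est (f Q q : R -> R) (a b B : R) : a < b ->
  (forall x, a <= x <= b -> {for x, continuous f}) -> antid Q q a b ->
  (forall x, a < x < b -> `|f x - q x| <= B) ->
  `|rint f a b - (Q b - Q a)| <= B * (b - a).
Proof.
move=> ab fc [Qc Qd] fq.
have [Fc Fd] := rint_antid ab fc.
have [||t tab] := @MVT R (rint f a \- Q) (f \- q) a b ab.
- move=> t; rewrite in_itv /= => tab.
  exact: is_deriveB (Fd _ tab) (Qd _ tab).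
- move=> t; apply: cvgB; [exact: Fc|exact: Qc].
rewrite /= rint_aa => E.
rewrite (_ : rint f a b - (Q b - Q a) = rint f a b - Q b - (0 - Q a)); last by ring.
rewrite E normrM (ger0_norm (_ : 0 <= b - a)) ?subr_ge0 ?(ltW ab)//.
by rewrite ler_wpM2r ?subr_ge0 ?(ltW ab)//; apply: fq; move: tab; rewrite in_itv.
Qed.

End RealIntegral.

Section ComplexIntegral.
Context {R : realType}.

Definition cint (f : R -> Cx R) (a b : R) : Cx R :=
  cpair (rint (fun t => re (f t)) a b) (rint (fun t => im (f t)) a b).

Definition ccont (f : R -> Cx R) (a b : R) : Prop := forall x, a <= x <= b ->
  {for x, continuous (fun t => re (f t))} /\ {for x, continuous (fun t => im (f t))}.

Definition cantid (Q q : R -> Cx R) (a b : R) : Prop :=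
  antid (fun t => re (Q t)) (fun t => re (q t)) a b /\
  antid (fun t => im (Q t)) (fun t => im (q t)) a b.

Lemma antidD (P p Q q : R -> R) a b : antid P p a b -> antid Q q a b ->
  antid (fun t => P t + Q t) (fun t => p t + q t) a b.
Proof.
move=> [Pc Pd] [Qc Qd]; split.
  by move=> t; apply: cvgD; [exact: Pc|exact: Qc].
by move=> x xab; exact: is_deriveD (Pd _ xab) (Qd _ xab).
Qed.

Lemma antidZ (c : R) (P p : R -> R) a b : antid P p a b ->
  antid (fun t => c * P t) (fun t => c * p t) a b.
Proof.
move=> [Pc Pd]; split.
  by move=> t; apply: cvgM; [exact: cvg_cst|exact: Pc].
by move=> x xab; exact: is_deriveMcstl (Pd _ xab).
Qed.

Lemma cantidD (P p Q q : R -> Cx R) a b : cantid P p a b -> cantid Q q a b ->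
  cantid (fun t => P t + Q t) (fun t => p t + q t) a b.
Proof.
move=> [P1 P2] [Q1 Q2]; rewrite /cantid; split.
  by under eq_fun do rewrite reD; under [fun t => re (p t + _)]eq_fun do rewrite reD; exact: antidD.
by under eq_fun do rewrite imD; under [fun t => im (p t + _)]eq_fun do rewrite imD; exact: antidD.
Qed.

Lemma cantidZ (c : Cx R) (P p : R -> Cx R) a b : cantid P p a b ->
  cantid (fun t => c * P t) (fun t => c * p t) a b.
Proof.
move=> [P1 P2]; rewrite /cantid; split.
  under eq_fun do rewrite reM -mulNr; under [fun t => re (c * p t)]eq_fun do rewrite reM -mulNr.
  by apply: antidD; exact: antidZ.
under eq_fun do rewrite imM; under [fun t => im (c * p t)]eq_fun do rewrite imM.
by apply: antidD; exact: antidZ.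
Qed.

Lemma cint_antid f a b : a < b -> ccont f a b -> cantid (cint f a) f a b.
Proof. by move=> ab fc; split; apply: rint_antid => // x /fc[]. Qed.

Lemma cint_est (f Q q : R -> Cx R) (a b B : R) : a < b -> ccont f a b ->
  cantid Q q a b -> (forall x, a < x < b -> cmod (f x - q x) <= B) ->
  cmod (cint f a b - (Q b - Q a)) <= 2 * B * (b - a).
Proof.
move=> ab fc [Q1 Q2] fq; apply: le_trans (cmod_sum _) _.
rewrite !(reB, imB) /= -mulrA mulr_natl mulr2n lerD//.
  apply: (@rint_est R _ (fun t => re (Q t)) (fun t => re (q t))) => // x xab; first by have [] := fc x xab.
  by rewrite -reB (le_trans (cmod_re _))// fq.
apply: (@rint_est R _ (fun t => im (Q t)) (fun t => im (q t))) => // x xab; first by have [] := fc x xab.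
by rewrite -imB (le_trans (cmod_im _))// fq.
Qed.

Lemma cint_lin_est (f g h : R -> Cx R) (w : Cx R) (a b B : R) : a < b ->
  ccont f a b -> ccont g a b -> ccont h a b ->
  (forall x, a < x < b -> cmod (f x - (g x + w * h x)) <= B) ->
  cmod (cint f a b - (cint g a b + w * cint h a b)) <= 2 * B * (b - a).
Proof.
move=> ab fc gc hc H.
have Q := cantidD (cint_antid ab gc) (cantidZ w (cint_antid ab hc)).
have := cint_est ab fc Q H.
have cint_aa k : cint k a a = 0 by rewrite /cint !rint_aa.
by rewrite !cint_aa mulr0 addr0 subr0.
Qed.

Lemma cantid_sub f g a b c d : cantid f g a b -> a <= c -> d <= b -> c < d -> cantid f g c d.
Proof.
move=> [[c1 d1] [c2 d2]] ac db cd.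
have sub : `[c, d] `<=` `[a, b] by apply: subset_itv; rewrite bnd_simp.
split; split.
- exact: continuous_subspaceW c1.
- by move=> x /andP[cx xd]; apply: d1; rewrite (le_lt_trans ac)// (lt_le_trans xd).
- exact: continuous_subspaceW c2.
- by move=> x /andP[cx xd]; apply: d2; rewrite (le_lt_trans ac)// (lt_le_trans xd).
Qed.

Lemma cint_split f a b c : a < b -> b < c -> ccont f a c ->
  cint f a c = cint f a b + cint f b c.
Proof.
move=> ab bc fc.
have fbc : ccont f b c by move=> x /andP[bx xc]; apply: fc; rewrite (le_trans (ltW ab)).
have Q := cantid_sub (cint_antid (lt_trans ab bc) fc) (ltW ab) (lexx _) bc.
have h : cmod (cint f b c - (cint f a c - cint f a b)) <= 2 * 0 * (c - b).
  by apply: cint_est Q _ => // x _; rewrite subrr cmod0.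
apply/eqP; rewrite addrC -subr_eq eq_sym -subr_eq0 -cmod_eq0 eq_le cmod_ge0 andbT.
by rewrite mulr0 mul0r in h.
Qed.

End ComplexIntegral.

Section Rectangles.
Context {R : realType}.
Implicit Types (k G : Cx R -> Cx R) (z w : Cx R).

Definition ci : Cx R := cpair 0 1.

(** The integral of k dz over the positively oriented boundary of a rectangle. *)
Definition rbd k (x0 x1 y0 y1 : R) : Cx R :=
  cint (fun t => k (cpair t y0)) x0 x1 - cint (fun t => k (cpair t y1)) x0 x1
  + ci * (cint (fun t => k (cpair x1 t)) y0 y1 - cint (fun t => k (cpair x0 t)) y0 y1).

Definition rect (x0 x1 y0 y1 : R) z : Prop := (x0 <= re z <= x1) /\ (y0 <= im z <= y1).

Definition frame (x0 x1 y0 y1 : R) z : Prop :=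
  rect x0 x1 y0 y1 z /\ (re z = x0 \/ re z = x1 \/ im z = y0 \/ im z = y1).

Lemma continuous_hline k y t : {for cpair t y, continuous k} ->
  {for t, continuous (fun s => re (k (cpair s y)))} /\
  {for t, continuous (fun s => im (k (cpair s y)))}.
Proof.
move=> kc.
have c1 : (fun s : R => cpair s y) @ t --> (cpair t y : Cx R).
  by apply: cpair_cvg; [exact: cvg_id|exact: cvg_cst].
have c2 : (fun s : R => k (cpair s y)) @ t --> k (cpair t y).
  exact: (cvg_comp _ _ c1 kc).
by split; [exact: (cvg_comp _ _ c2 (@re_continuous R _))
          |exact: (cvg_comp _ _ c2 (@im_continuous R _))].
Qed.

Lemma continuous_vline k x t : {for cpair x t, continuous k} ->
  {for t, continuous (fun s => re (k (cpair x s)))} /\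
  {for t, continuous (fun s => im (k (cpair x s)))}.
Proof.
move=> kc.
have c1 : (fun s : R => cpair x s) @ t --> (cpair x t : Cx R).
  by apply: cpair_cvg; [exact: cvg_cst|exact: cvg_id].
have c2 : (fun s : R => k (cpair x s)) @ t --> k (cpair x t).
  exact: (cvg_comp _ _ c1 kc).
by split; [exact: (cvg_comp _ _ c2 (@re_continuous R _))
          |exact: (cvg_comp _ _ c2 (@im_continuous R _))].
Qed.

Lemma ccont_h k y x0 x1 : (forall t, x0 <= t <= x1 -> {for cpair t y, continuous k}) ->
  ccont (fun t => k (cpair t y)) x0 x1.
Proof. by move=> H t /H; exact: continuous_hline. Qed.

Lemma ccont_v k x y0 y1 : (forall t, y0 <= t <= y1 -> {for cpair x t, continuous k}) ->
  ccont (fun t => k (cpair x t)) y0 y1.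
Proof. by move=> H t /H; exact: continuous_vline. Qed.

Lemma re_Nci z : re (- ci * z) = im z.
Proof. by rewrite /ci !cxE; ring. Qed.

Lemma is_derive_hline G z l : cder G z l ->
  is_derive (re z) (1 : R) (fun t => re (G (cpair t (im z)))) (re l) /\
  is_derive (re z) (1 : R) (fun t => im (G (cpair t (im z)))) (im l).
Proof.
have E t : cpair 0 (im z) + cpair t 0 * 1 = cpair t (im z) :> Cx R.
  by apply: cx_eqP; rewrite !cxE/=; ring.
move=> Gl; have Gl' : cder G (cpair 0 (im z) + cpair (re z) 0 * 1) l by rewrite E cpairK.
split.
  have := line_derive 1 Gl'; under eq_fun do rewrite E mul1r.
  by rewrite mulr1 mul1r.
have := line_derive (- ci) Gl'; under eq_fun do rewrite E re_Nci.
by rewrite mulr1 re_Nci.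
Qed.

Lemma is_derive_vline G z l : cder G z l ->
  is_derive (im z) (1 : R) (fun t => re (G (cpair (re z) t))) (- im l) /\
  is_derive (im z) (1 : R) (fun t => im (G (cpair (re z) t))) (re l).
Proof.
have E t : cpair (re z) 0 + cpair t 0 * ci = cpair (re z) t :> Cx R.
  by apply: cx_eqP; rewrite !cxE/=; ring.
move=> Gl; have Gl' : cder G (cpair (re z) 0 + cpair (im z) 0 * ci) l by rewrite E cpairK.
split.
  have := line_derive 1 Gl'; under eq_fun do rewrite E mul1r.
  by rewrite mul1r !cxE/= mulr0 mulr1 sub0r.
have := line_derive (- ci) Gl'; under eq_fun do rewrite E re_Nci.
have -> // : re (- ci * l * ci) = re l.
by rewrite !cxE/=; ring.
Qed.

Lemma cantid_h G g y x0 x1 : x0 < x1 -> (forall t, x0 <= t <= x1 -> cder G (cpair t y) (g (cpair t y))) ->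
  cantid (fun t => G (cpair t y)) (fun t => g (cpair t y)) x0 x1.
Proof.
move=> x01 H.
have C : ccont (fun t => G (cpair t y)) x0 x1.
  by apply: ccont_h => t /H; exact: cder_cont.
have D t : x0 <= t <= x1 -> _ := fun h => is_derive_hline (H t h).
split; split => [|t /andP[? ?]].
- by apply: continuous_in_subspaceT => x; rewrite inE /= in_itv /= => /C[].
- by have [] := D t; rewrite ?ltW.
- by apply: continuous_in_subspaceT => x; rewrite inE /= in_itv /= => /C[].
- by have [] := D t; rewrite ?ltW.
Qed.

Lemma cantid_v G g x y0 y1 : y0 < y1 -> (forall t, y0 <= t <= y1 -> cder G (cpair x t) (g (cpair x t))) ->
  cantid (fun t => G (cpair x t)) (fun t => ci * g (cpair x t)) y0 y1.
Proof.
move=> x01 H.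
have C : ccont (fun t => G (cpair x t)) y0 y1.
  by apply: ccont_v => t /H; exact: cder_cont.
have D t : y0 <= t <= y1 -> _ := fun h => is_derive_vline (H t h).
have r1 t : re (ci * g (cpair x t)) = - im (g (cpair x t)) by rewrite !cxE/=; ring.
have i1 t : im (ci * g (cpair x t)) = re (g (cpair x t)) by rewrite !cxE/=; ring.
split; split => [|t /andP[? ?]].
- by apply: continuous_in_subspaceT => z; rewrite inE /= in_itv /= => /C[].
- by rewrite r1; have [] := D t; rewrite ?ltW.
- by apply: continuous_in_subspaceT => z; rewrite inE /= in_itv /= => /C[].
- by rewrite i1; have [] := D t; rewrite ?ltW.
Qed.

Lemma cmod_ci : cmod ci = 1.
Proof. by rewrite /cmod /= expr0n add0r expr1n sqrtr1. Qed.

Lemma ci2 : ci * ci = -1.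
Proof. by apply: cx_eqP; rewrite !cxE/=; ring. Qed.

Lemma frame_h x0 x1 y0 y1 t : y0 < y1 -> x0 <= t <= x1 ->
  frame x0 x1 y0 y1 (cpair t y0) /\ frame x0 x1 y0 y1 (cpair t y1).
Proof.
move=> y01 tx; rewrite /frame /rect /= tx !lexx (ltW y01); split; split=> //;
 by [right; right; left|right; right; right].
Qed.

Lemma frame_v x0 x1 y0 y1 t : x0 < x1 -> y0 <= t <= y1 ->
  frame x0 x1 y0 y1 (cpair x0 t) /\ frame x0 x1 y0 y1 (cpair x1 t).
Proof.
move=> x01 ty; rewrite /frame /rect /= ty !lexx (ltW x01); split; split=> //;
 by [left|right; left].
Qed.

(** Exact forms G' dz integrate to zero over the boundary, so that a function
   close to G' has a small boundary integral. *)
Lemma rbd_exact_est k G g x0 x1 y0 y1 B : x0 < x1 -> y0 < y1 ->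
  (forall z, frame x0 x1 y0 y1 z -> [/\ {for z, continuous k}, cder G z (g z) & cmod (k z - g z) <= B]) ->
  cmod (rbd k x0 x1 y0 y1) <= 4 * B * ((x1 - x0) + (y1 - y0)).
Proof.
move=> x01 y01 H.
have lt_le x (a b : R) : a < x < b -> a <= x <= b by move=> /andP[/ltW -> /ltW ->].
have h0 : cmod (cint (fun t => k (cpair t y0)) x0 x1 - (G (cpair x1 y0) - G (cpair x0 y0))) <= 2 * B * (x1 - x0).
  apply: cint_est (cantid_h (g := g) x01 _) _ => //.
  - by apply: ccont_h => t tx; have [] := H _ (frame_h y01 tx).1.
  - by move=> t tx; have [] := H _ (frame_h y01 tx).1.
  - by move=> t /lt_le tx; have [] := H _ (frame_h y01 tx).1.
have h1 : cmod (cint (fun t => k (cpair t y1)) x0 x1 - (G (cpair x1 y1) - G (cpair x0 y1))) <= 2 * B * (x1 - x0).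
  apply: cint_est (cantid_h (g := g) x01 _) _ => //.
  - by apply: ccont_h => t tx; have [] := H _ (frame_h y01 tx).2.
  - by move=> t tx; have [] := H _ (frame_h y01 tx).2.
  - by move=> t /lt_le tx; have [] := H _ (frame_h y01 tx).2.
have vv x : (forall t, y0 <= t <= y1 -> frame x0 x1 y0 y1 (cpair x t)) ->
  cmod (ci * cint (fun t => k (cpair x t)) y0 y1 - (G (cpair x y1) - G (cpair x y0))) <= 2 * B * (y1 - y0).
  move=> fx.
  have P : cantid (fun t => - ci * G (cpair x t)) (fun t => - ci * (ci * g (cpair x t))) y0 y1.
    by apply: cantidZ; apply: cantid_v => // t /fx /H[].
  have -> : ci * cint (fun t => k (cpair x t)) y0 y1 - (G (cpair x y1) - G (cpair x y0)) =
    ci * (cint (fun t => k (cpair x t)) y0 y1 - (- ci * G (cpair x y1) - - ci * G (cpair x y0))).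
    by rewrite !mulrBr !mulrA !mulrN ci2 !opprK !mul1r.
  rewrite cmodM cmod_ci mul1r; apply: cint_est P _ => //.
    by apply: ccont_v => t /fx /H[].
  by move=> t /lt_le /fx /H[_ _]; rewrite mulrA mulNr ci2 opprK mul1r.
have v0 := vv x0 (fun t tx => (frame_v x01 tx).1).
have v1 := vv x1 (fun t tx => (frame_v x01 tx).2).
move: h0 h1 v0 v1; rewrite /rbd.
set A := cint _ _ _; set C := cint _ _ _; set D := cint _ _ _; set E := cint _ _ _ => h0 h1 v0 v1.
rewrite [X in cmod X](_ : _ = (A - (G (cpair x1 y0) - G (cpair x0 y0)))
 - (C - (G (cpair x1 y1) - G (cpair x0 y1))) + ((ci * E - (G (cpair x1 y1) - G (cpair x1 y0)))
   - (ci * D - (G (cpair x0 y1) - G (cpair x0 y0))))); last by ring.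
apply: le_trans (cmodD _ _) _.
have c1 := cmodB (A - (G (cpair x1 y0) - G (cpair x0 y0))) (C - (G (cpair x1 y1) - G (cpair x0 y1))).
have c2 := cmodB (ci * E - (G (cpair x1 y1) - G (cpair x1 y0))) (ci * D - (G (cpair x0 y1) - G (cpair x0 y0))).
lra.
Qed.

(** The linear combination version of rbd_exact_est, used to differentiate
   boundary integrals with respect to a parameter w. *)
Lemma rbd_lin_est k1 k2 k3 w x0 x1 y0 y1 B : x0 < x1 -> y0 < y1 ->
  (forall z, frame x0 x1 y0 y1 z -> [/\ {for z, continuous k1}, {for z, continuous k2},
     {for z, continuous k3} & cmod (k1 z - (k2 z + w * k3 z)) <= B]) ->
  cmod (rbd k1 x0 x1 y0 y1 - (rbd k2 x0 x1 y0 y1 + w * rbd k3 x0 x1 y0 y1))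
    <= 4 * B * ((x1 - x0) + (y1 - y0)).
Proof.
move=> x01 y01 H.
have lt_le x (a b : R) : a < x < b -> a <= x <= b by move=> /andP[/ltW -> /ltW ->].
have hh y : (forall t, x0 <= t <= x1 -> frame x0 x1 y0 y1 (cpair t y)) ->
  cmod (cint (fun t => k1 (cpair t y)) x0 x1 - (cint (fun t => k2 (cpair t y)) x0 x1 + w * cint (fun t => k3 (cpair t y)) x0 x1)) <= 2 * B * (x1 - x0).
  move=> fy; apply: cint_lin_est => //; try by apply: ccont_h => t /fy /H[].
  by move=> t /lt_le /fy /H[].
have vv x : (forall t, y0 <= t <= y1 -> frame x0 x1 y0 y1 (cpair x t)) ->
  cmod (cint (fun t => k1 (cpair x t)) y0 y1 - (cint (fun t => k2 (cpair x t)) y0 y1 + w * cint (fun t => k3 (cpair x t)) y0 y1)) <= 2 * B * (y1 - y0).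
  move=> fx; apply: cint_lin_est => //; try by apply: ccont_v => t /fx /H[].
  by move=> t /lt_le /fx /H[].
have h0 := hh y0 (fun t tx => (frame_h y01 tx).1).
have h1 := hh y1 (fun t tx => (frame_h y01 tx).2).
have v0 := vv x0 (fun t tx => (frame_v x01 tx).1).
have v1 := vv x1 (fun t tx => (frame_v x01 tx).2).
move: h0 h1 v0 v1; rewrite /rbd.
set A1 := cint _ _ _; set A2 := cint _ _ _; set A3 := cint _ _ _.
set C1 := cint _ _ _; set C2 := cint _ _ _; set C3 := cint _ _ _.
set D1 := cint _ _ _; set D2 := cint _ _ _; set D3 := cint _ _ _.
set E1 := cint _ _ _; set E2 := cint _ _ _; set E3 := cint _ _ _.
move=> h0 h1 v0 v1.
rewrite [X in cmod X](_ : _ = (A1 - (A2 + w * A3)) - (C1 - (C2 + w * C3))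
  + ci * ((E1 - (E2 + w * E3)) - (D1 - (D2 + w * D3)))); last by ring.
apply: le_trans (cmodD _ _) _; rewrite cmodM cmod_ci mul1r.
have c1 := cmodB (A1 - (A2 + w * A3)) (C1 - (C2 + w * C3)).
have c2 := cmodB (E1 - (E2 + w * E3)) (D1 - (D2 + w * D3)).
lra.
Qed.

Lemma rbd_split_x k x0 x x1 y0 y1 : x0 < x -> x < x1 -> y0 < y1 ->
  (forall z, rect x0 x1 y0 y1 z -> {for z, continuous k}) ->
  rbd k x0 x1 y0 y1 = rbd k x0 x y0 y1 + rbd k x x1 y0 y1.
Proof.
move=> x0x xx1 y01 H.
have h y : y0 <= y <= y1 -> ccont (fun t => k (cpair t y)) x0 x1.
  by move=> yy; apply: ccont_h => t tx; apply: H.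
rewrite /rbd (cint_split x0x xx1 (h y0 _)) ?lexx ?(ltW y01)//.
by rewrite (cint_split x0x xx1 (h y1 _)) ?lexx ?(ltW y01)//; ring.
Qed.

Lemma rbd_split_y k x0 x1 y0 y y1 : x0 < x1 -> y0 < y -> y < y1 ->
  (forall z, rect x0 x1 y0 y1 z -> {for z, continuous k}) ->
  rbd k x0 x1 y0 y1 = rbd k x0 x1 y0 y + rbd k x0 x1 y y1.
Proof.
move=> x01 y0y yy1 H.
have h x : x0 <= x <= x1 -> ccont (fun t => k (cpair x t)) y0 y1.
  by move=> yy; apply: ccont_v => t tx; apply: H.
rewrite /rbd (cint_split y0y yy1 (h x0 _)) ?lexx ?(ltW x01)//.
by rewrite (cint_split y0y yy1 (h x1 _)) ?lexx ?(ltW x01)//; ring.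
Qed.

End Rectangles.

Lemma cder_val (R : realType) (F : Cx R -> Cx R) z a b : cder F z a -> a = b -> cder F z b.
Proof. by move=> ? <-. Qed.

(** * Goursat's theorem *)

Section Goursat.
Context {R : realType}.
Implicit Types (k G : Cx R -> Cx R) (z w : Cx R).

(** The corners of nested intervals of length X / 2^n have a common limit. *)
Lemma nested_point (u : nat -> R) (X : R) : 0 <= X ->
  (forall n, u n <= u n.+1 /\ u n.+1 + X / 2 ^+ n.+1 <= u n + X / 2 ^+ n) ->
  exists A, forall n, u n <= A <= u n + X / 2 ^+ n.
Proof.
move=> X0 H.
have up n m : (n <= m)%N -> u n <= u m.
  elim: m => [|m IH]; first by rewrite leqn0 => /eqP ->.
  by rewrite leq_eqVlt => /orP[/eqP ->//|/IH/le_trans]; apply; have [] := H m.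
have dn n m : (n <= m)%N -> u m + X / 2 ^+ m <= u n + X / 2 ^+ n.
  elim: m => [|m IH]; first by rewrite leqn0 => /eqP ->.
  rewrite leq_eqVlt => /orP[/eqP ->//|/IH].
  by apply: le_trans; have [] := H m.
have pos n : 0 <= X / 2 ^+ n by rewrite divr_ge0// exprn_ge0.
have ub n m : u m <= u n + X / 2 ^+ n.
  have [mn|/ltnW nm] := leqP m n; first by rewrite (le_trans (up _ _ mn))// lerDl.
  by apply: le_trans (dn _ _ nm); rewrite lerDl.
have hs : has_sup (range u).
  by split; [exists (u 0%N), 0%N|exists (u 0%N + X / 2 ^+ 0) => _ [m _ <-]].
exists (sup (range u)) => n; apply/andP; split.
  by apply: ub_le_sup; [exact: hs.2|exists n].
by apply: ge_sup; [exact: hs.1|move=> _ [m _ <-]].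
Qed.

(** Otherwise iterated quartering produces nested rectangles without the
   property, which shrink to a point where the local hypothesis fails. *)
Lemma rect_bisection (P : R -> R -> R -> R -> Prop) (x0 x1 y0 y1 : R) :
  x0 < x1 -> y0 < y1 ->
  (forall a b c d : R, x0 <= a -> a < b -> b <= x1 -> y0 <= c -> c < d -> d <= y1 ->
     let m := (a + b) / 2 in let n := (c + d) / 2 in
     P a m c n -> P m b c n -> P a m n d -> P m b n d -> P a b c d) ->
  (forall z, rect x0 x1 y0 y1 z -> exists2 e : R, 0 < e & forall a b c d : R,
     x0 <= a -> a < b -> b <= x1 -> y0 <= c -> c < d -> d <= y1 ->
     rect a b c d z -> (b - a) + (d - c) < e -> P a b c d) ->
  P x0 x1 y0 y1.
Proof.
move=> x01 y01 Hq Hl; apply: contrapT => nP.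
set X := x1 - x0; set Y := y1 - y0.
have X0 : 0 < X by rewrite subr_gt0.
have Y0 : 0 < Y by rewrite subr_gt0.
have p2 n : 0 < (2 : R) ^+ n by rewrite exprn_gt0.
pose bad n (p : R * R) := [/\ x0 <= p.1, p.1 + X / 2 ^+ n <= x1, y0 <= p.2, p.2 + Y / 2 ^+ n <= y1
  & ~ P p.1 (p.1 + X / 2 ^+ n) p.2 (p.2 + Y / 2 ^+ n)].
have step n p : bad n p -> exists q, [/\ bad n.+1 q, p.1 <= q.1, q.1 + X / 2 ^+ n.+1 <= p.1 + X / 2 ^+ n,
   p.2 <= q.2 & q.2 + Y / 2 ^+ n.+1 <= p.2 + Y / 2 ^+ n].
  case: p => a c [/= ax bx cy dy nPp].
  set X' := X / 2 ^+ n.+1; set Y' := Y / 2 ^+ n.+1.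
  have X'0 : 0 < X' by rewrite divr_gt0.
  have Y'0 : 0 < Y' by rewrite divr_gt0.
  have EX : X / 2 ^+ n = X' + X' by rewrite /X' exprS; field; rewrite gt_eqF.
  have EY : Y / 2 ^+ n = Y' + Y' by rewrite /Y' exprS; field; rewrite gt_eqF.
  rewrite EX EY in bx dy nPp *.
  apply: contrapT => nq; apply: nPp.
  have mE : (a + (a + (X' + X'))) / 2 = a + X' by field.
  have nE : (c + (c + (Y' + Y'))) / 2 = c + Y' by field.
  apply: (Hq a _ c); try lra.
  - rewrite mE nE; apply: contrapT => np; apply: nq; exists (a, c) => /=.
    by split; rewrite ?/bad -?/X' -?/Y' /=; try (split=> //); lra.
  - rewrite mE nE; apply: contrapT => np; apply: nq; exists (a + X', c) => /=.
    split; rewrite ?/bad -?/X' -?/Y' /=; [split; rewrite -?addrA//|..]; lra.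
  - rewrite mE nE; apply: contrapT => np; apply: nq; exists (a, c + Y') => /=.
    split; rewrite ?/bad -?/X' -?/Y' /=; [split; rewrite -?addrA//|..]; lra.
  - rewrite mE nE; apply: contrapT => np; apply: nq; exists (a + X', c + Y') => /=.
    split; rewrite ?/bad -?/X' -?/Y' /=; [split; rewrite -?addrA//|..]; lra.
have [f Hf] : exists f : nat -> R * R -> R * R, forall n p, bad n p ->
   [/\ bad n.+1 (f n p), p.1 <= (f n p).1, (f n p).1 + X / 2 ^+ n.+1 <= p.1 + X / 2 ^+ n,
   p.2 <= (f n p).2 & (f n p).2 + Y / 2 ^+ n.+1 <= p.2 + Y / 2 ^+ n].
  have /choice[f Hf] : forall np : nat * (R * R), exists q, bad np.1 np.2 ->
     [/\ bad np.1.+1 q, np.2.1 <= q.1, q.1 + X / 2 ^+ np.1.+1 <= np.2.1 + X / 2 ^+ np.1,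
      np.2.2 <= q.2 & q.2 + Y / 2 ^+ np.1.+1 <= np.2.2 + Y / 2 ^+ np.1].
    move=> [n p] /=; have [b|nb] := pselect (bad n p); last by exists p.
    by have [q hq] := step _ _ b; exists q.
  by exists (fun n p => f (n, p)) => n p; exact: (Hf (n, p)).
pose u := fix u n := if n is n'.+1 then f n' (u n') else (x0, y0).
have bu n : bad n (u n).
  elim: n => [|n IH]; last by have [] := Hf _ _ IH.
  have e1 : x0 + X = x1 by rewrite /X; ring.
  have e2 : y0 + Y = y1 by rewrite /Y; ring.
  by rewrite /bad /= expr0 !divr1 e1 e2 !lexx; split.
have [A HA] := @nested_point (fun n => (u n).1) X (ltW X0) (fun n => let: And5 _ a b _ _ := Hf _ _ (bu n) in conj a b).
have [B HB] := @nested_point (fun n => (u n).2) Y (ltW Y0) (fun n => let: And5 _ _ _ a b := Hf _ _ (bu n) in conj a b).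
have [|e e0 He] := Hl (cpair A B).
  split=> /=; [have := HA 0%N|have := HB 0%N]; rewrite /= expr0 divr1 /X /Y; lra.
have [n hn] : exists n, (X + Y) / e < 2 ^+ n.
  have h0 : 0 <= (X + Y) / e by rewrite divr_ge0 ?ltW// addr_gt0.
  exists (Num.trunc ((X + Y) / e)).+1.
  apply: (@lt_trans _ _ (Num.trunc ((X + Y) / e)).+1%:R).
    by have := truncnS_gt ((X + Y) / e).
  by rewrite -natrX ltr_nat ltn_expl.
have [ax bx cy dy nPn] := bu n.
apply: nPn; apply: He => //.
- by rewrite ltrDl divr_gt0.
- by rewrite ltrDl divr_gt0.
- rewrite (_ : _ + _ = (X + Y) / 2 ^+ n); last by ring.
  by rewrite ltr_pdivrMr// mulrC -ltr_pdivrMr.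
Qed.

Lemma rect_sub a b c d x0 x1 y0 y1 z : x0 <= a -> b <= x1 -> y0 <= c -> d <= y1 ->
  rect a b c d z -> rect x0 x1 y0 y1 z.
Proof.
move=> xa bx yc dy [/andP[h1 h2] /andP[h3 h4]]; split; apply/andP; split.
- exact: le_trans h1.
- exact: le_trans bx.
- exact: le_trans h3.
- exact: le_trans dy.
Qed.

(** Goursat: the derivative is not assumed continuous.  Near a point where k
   is differentiable, k is affine up to o(size), so that its boundary integral
   over a small rectangle is o(size^2); both sides of such an estimate behave
   additively under subdivision. *)
Lemma goursat k x0 x1 y0 y1 : x0 < x1 -> y0 < y1 ->
  (forall z, rect x0 x1 y0 y1 z -> exists l, cder k z l) -> rbd k x0 x1 y0 y1 = 0.
Proof.
move=> x01 y01 H.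
have kc z : rect x0 x1 y0 y1 z -> {for z, continuous k}.
  by move=> /H[l]; exact: cder_cont.
suff Q e : 0 < e -> cmod (rbd k x0 x1 y0 y1) <= e * ((x1 - x0) ^+ 2 + (y1 - y0) ^+ 2).
  apply/eqP; rewrite -cmod_eq0 eq_le cmod_ge0 andbT; apply/ler_addgt0Pl => e e0; rewrite addr0.
  set D := (x1 - x0) ^+ 2 + (y1 - y0) ^+ 2 in Q.
  have D0 : 0 < D by rewrite addr_gt0// exprn_gt0// subr_gt0.
  by have := Q (e / D); rewrite divfK ?gt_eqF//; apply; rewrite divr_gt0.
move=> e0.
apply: (@rect_bisection (fun a b c d => cmod (rbd k a b c d) <= e * ((b - a) ^+ 2 + (d - c) ^+ 2))) => //.
  move=> a b c d xa ab bx yc cd dy m n p1 p2 p3 p4.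
  have kc' z : rect a b c d z -> {for z, continuous k} by move=> /(rect_sub xa bx yc dy) /kc.
  have am : a < m by rewrite /m; lra.
  have mb : m < b by rewrite /m; lra.
  have cn : c < n by rewrite /n; lra.
  have nd : n < d by rewrite /n; lra.
  rewrite (rbd_split_x am mb cd kc').
  rewrite (rbd_split_y am cn nd) => [|z zr]; last first.
    by apply: kc'; apply: rect_sub zr; rewrite ?lexx ?ltW.
  rewrite (rbd_split_y mb cn nd) => [|z zr]; last first.
    by apply: kc'; apply: rect_sub zr; rewrite ?lexx ?ltW.
  have c1 := cmodD (rbd k a m c n) (rbd k a m n d).
  have c2 := cmodD (rbd k m b c n) (rbd k m b n d).
  apply: le_trans (cmodD _ _) _.
  have E : e * ((b - a) ^+ 2 + (d - c) ^+ 2) =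
    e * ((m - a) ^+ 2 + (n - c) ^+ 2) + e * ((b - m) ^+ 2 + (n - c) ^+ 2)
    + (e * ((m - a) ^+ 2 + (d - n) ^+ 2) + e * ((b - m) ^+ 2 + (d - n) ^+ 2)).
    by rewrite /m /n; field.
  rewrite E; lra.
move=> z /H[l kl].
have e8 : 0 < e / 8 by rewrite divr_gt0.
have [d d0 Hd] := kl _ e8.
exists d => // a b c dd xa ab bx yc cd dy zr bad.
set D := (b - a) + (dd - c).
have D0 : 0 < D by rewrite addr_gt0// subr_gt0.
pose G w := (k z - l * z) * w + l / 2 * (w * w).
have Gd w : cder G w (k z + l * (w - z)).
  apply: (cder_val (cderD (cderZ (k z - l * z) (cder_id w))
    (cderZ (l / 2) (cderM (cder_id w) (cder_id w))))).
  by field.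
have := @rbd_exact_est R k G (fun w => k z + l * (w - z)) a b c dd (e / 8 * D) ab cd.
have -> : 4 * (e / 8 * D) * D = e * (D ^+ 2 / 2) by field.
move=> K; apply: le_trans (K _) _.
  move=> w [wr _]; split=> //; first by apply: kc; exact: rect_sub wr.
  have wz : cmod (w - z) <= D.
    apply: le_trans (cmod_sum _) _; rewrite !cxE.
    case: zr wr => /andP[? ?] /andP[? ?] [/andP[? ?] /andP[? ?]].
    by rewrite /D lerD// ler_norml; apply/andP; split; lra.
  rewrite opprD addrA; apply: le_trans (Hd _ (le_lt_trans wz bad)) _.
  by rewrite ler_wpM2l// ltW.
rewrite ler_pM2l// /D.
have := sqr_ge0 ((b - a) - (dd - c)); set u := b - a; set v := dd - c => uv.
nra.
Qed.

End Goursat.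

(** * The Cauchy formula on rectangles *)

Section Cauchy.
Context {R : realType}.
Implicit Types (h k G : Cx R -> Cx R) (z w : Cx R).

Definition irect (x0 x1 y0 y1 : R) z : Prop := (x0 < re z < x1) /\ (y0 < im z < y1).

Lemma rbd_bound k x0 x1 y0 y1 B : x0 < x1 -> y0 < y1 ->
  (forall z, frame x0 x1 y0 y1 z -> {for z, continuous k} /\ cmod (k z) <= B) ->
  cmod (rbd k x0 x1 y0 y1) <= 4 * B * ((x1 - x0) + (y1 - y0)).
Proof.
move=> x01 y01 H; apply: (@rbd_exact_est R k (fun=> 0) (fun=> 0)) => // z /H[? ?].
by split=> //; [exact: cder_cst|rewrite subr0].
Qed.

Lemma rbd_shrink k x0 x1 y0 y1 a b c d z : x0 < a -> b < x1 -> y0 < c -> d < y1 ->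
  irect a b c d z ->
  (forall w, rect x0 x1 y0 y1 w -> {for w, continuous k}) ->
  (forall w, rect x0 x1 y0 y1 w -> w != z -> exists l, cder k w l) ->
  rbd k x0 x1 y0 y1 = rbd k a b c d.
Proof.
move=> xa bx yc dy [/andP[az zb] /andP[cz zd]] kc kd.
have ab := lt_trans az zb; have cd := lt_trans cz zd.
have xb := lt_trans xa ab; have yd := lt_trans yc cd.
have Z a' b' c' d' : x0 <= a' -> a' < b' -> b' <= x1 -> y0 <= c' -> c' < d' -> d' <= y1 ->
   ~ rect a' b' c' d' z -> rbd k a' b' c' d' = 0.
  move=> xa' ab' bx' yc' cd' dy' nz; apply: goursat => // w wr.
  by apply: kd; [exact: rect_sub wr|apply/eqP => wz; rewrite wz in wr].
have kc' a' b' c' d' : x0 <= a' -> b' <= x1 -> y0 <= c' -> d' <= y1 ->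
  forall w, rect a' b' c' d' w -> {for w, continuous k}.
  by move=> ? ? ? ? w wr; apply: kc; exact: rect_sub wr.
have [xa' bx' yc' dy'] := And4 (ltW xa) (ltW bx) (ltW yc) (ltW dy).
rewrite (rbd_split_x xb bx (lt_trans yd dy) kc).
rewrite (rbd_split_x xa ab (lt_trans yd dy) (kc' _ _ _ _ (lexx _) bx' (lexx _) (lexx _))).
rewrite (rbd_split_y ab yd dy (kc' _ _ _ _ xa' bx' (lexx _) (lexx _))).
rewrite (rbd_split_y ab yc cd (kc' _ _ _ _ xa' bx' (lexx _) dy')).
rewrite (Z x0 a) ?lexx ?(ltW (lt_trans ab bx)) ?(lt_trans yd)//; last first.
  by move=> [/andP[_]]; rewrite leNgt az.
rewrite (Z b x1) ?lexx ?(ltW xb) ?(lt_trans yd)//; last first.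
  by move=> [/andP[]]; rewrite leNgt zb.
rewrite (Z _ _ y0 c) ?lexx ?(ltW (lt_trans cd dy))//; last first.
  by move=> [_ /andP[_]]; rewrite leNgt cz.
rewrite (Z _ _ d y1) ?lexx ?(ltW yd)//; last first.
  by move=> [_ /andP[]]; rewrite leNgt zd.
by rewrite !(add0r, addr0).
Qed.

(** Continuity at the exceptional point bounds k there, and shrinking the
   rectangle around it makes its contribution arbitrarily small. *)
Lemma goursat_punctured k x0 x1 y0 y1 z : irect x0 x1 y0 y1 z ->
  (forall w, rect x0 x1 y0 y1 w -> {for w, continuous k}) ->
  (forall w, rect x0 x1 y0 y1 w -> w != z -> exists l, cder k w l) ->
  rbd k x0 x1 y0 y1 = 0.
Proof.
move=> [/andP[xz zx] /andP[yz zy]] kc kd.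
set p := re z in xz zx; set q := im z in yz zy.
have z_rect : rect x0 x1 y0 y1 z by split; rewrite !ltW.
have [d d0 Hd] := (cont_cxP _ _).1 (kc z z_rect) _ ltr01.
set M := cmod (k z) + 1.
have M0 : 0 < M by rewrite ltr_wpDl ?cmod_ge0.
apply/eqP; rewrite -cmod_eq0 eq_le cmod_ge0 andbT; apply/ler_addgt0Pl => e e0; rewrite addr0.
pose t := Num.min (Num.min (d / 4) (e / (16 * M))) (Num.min (Num.min (p - x0) (x1 - p) / 2) (Num.min (q - y0) (y1 - q) / 2)).
have t0 : 0 < t.
  by rewrite /t !lt_min !divr_gt0 ?mulr_gt0// lt_min !subr_gt0 ?xz ?zx ?yz ?zy.
have : t <= t by []; rewrite {2}/t !le_min => /andP[/andP[td te] /andP[tx ty]].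
have tx1 : t < p - x0.
  apply: le_lt_trans tx _; rewrite ltr_pdivrMr// mulr_natr mulr2n -[ltLHS]addr0 ler_ltD ?subr_gt0//.
  by rewrite ge_min lexx.
have tx2 : t < x1 - p.
  apply: le_lt_trans tx _; rewrite ltr_pdivrMr// mulr_natr mulr2n -[ltLHS]addr0 ler_ltD ?subr_gt0//.
  by rewrite ge_min lexx orbT.
have ty1 : t < q - y0.
  apply: le_lt_trans ty _; rewrite ltr_pdivrMr// mulr_natr mulr2n -[ltLHS]addr0 ler_ltD ?subr_gt0//.
  by rewrite ge_min lexx.
have ty2 : t < y1 - q.
  apply: le_lt_trans ty _; rewrite ltr_pdivrMr// mulr_natr mulr2n -[ltLHS]addr0 ler_ltD ?subr_gt0//.
  by rewrite ge_min lexx orbT.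
have a1 : x0 < p - t by lra.
have a2 : p - t < p + t by lra.
have a3 : p + t < x1 by lra.
have b1 : y0 < q - t by lra.
have b2 : q - t < q + t by lra.
have b3 : q + t < y1 by lra.
rewrite (rbd_shrink a1 a3 b1 b3 _ kc kd); last by split; rewrite -/p -/q; lra.
have := @rbd_bound k (p - t) (p + t) (q - t) (q + t) M a2 b2.
move=> H; apply: le_trans (H _) _.
  move=> w [[/andP[w1 w2] /andP[w3 w4]] _]; split.
    by apply: kc; split; apply/andP; split; lra.
  have : cmod (w - z) < d.
    apply: le_lt_trans (cmod_sum _) _; rewrite !cxE -/p -/q.
    have h1 : `|re w - p| <= t by rewrite ler_norml; apply/andP; split; lra.
    have h2 : `|im w - q| <= t by rewrite ler_norml; apply/andP; split; lra.
    lra.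
  by move=> /Hd/ltW h; apply: le_trans (cmod_le_add _ (k z)) _; rewrite lerD2l.
rewrite ler_pdivlMr ?mulr_gt0// in te.
lra.
Qed.

Lemma rint_mean (f : R -> R) (a b : R) : a < b ->
  (forall x, a <= x <= b -> {for x, continuous f}) ->
  exists2 x, a <= x <= b & rint f a b = f x * (b - a).
Proof.
move=> ab fc; have [Fc Fd] := rint_antid ab fc.
have Fd' (t : R) : t \in `]a, b[%R -> is_derive t (1 : R) (rint f a) (f t).
  by rewrite in_itv => /Fd.
have [t tab] := MVT ab Fd' Fc.
rewrite rint_aa subr0 => ->; exists t => //.
by have := subset_itv_oo_cc tab; rewrite in_itv.
Qed.

Lemma frame_neq x0 x1 y0 y1 z w : irect x0 x1 y0 y1 z -> frame x0 x1 y0 y1 w -> w - z != 0.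
Proof.
move=> [/andP[a b] /andP[c d]] [_ H]; rewrite subr_eq0; apply/eqP => E; subst w.
by case: H => [|[|[|]]] E; rewrite E ltxx in a b c d.
Qed.

Lemma frame_dist x0 x1 y0 y1 z : irect x0 x1 y0 y1 z ->
  exists2 d : R, 0 < d & forall w, frame x0 x1 y0 y1 w -> d <= cmod (w - z).
Proof.
move=> [/andP[a b] /andP[c d]].
exists (Num.min (Num.min (re z - x0) (x1 - re z)) (Num.min (im z - y0) (y1 - im z))).
  by rewrite !lt_min !subr_gt0 a b c d.
move=> w [_ H].
have h1 := cmod_re (w - z); have h2 := cmod_im (w - z); rewrite !cxE in h1 h2.
rewrite !ge_min; case: H => [E|[E|[E|E]]]; rewrite E in h1 h2.
- by rewrite -[re z - _]ger0_norm ?subr_ge0 ?(ltW a)// distrC h1.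
- by rewrite -[x1 - _]ger0_norm ?subr_ge0 ?(ltW b)// h1 !orbT.
- by rewrite -[im z - _]ger0_norm ?subr_ge0 ?(ltW c)// distrC h2 !orbT.
- by rewrite -[y1 - _]ger0_norm ?subr_ge0 ?(ltW d)// h2 !orbT.
Qed.

Lemma cont_inv z w : w - z != 0 -> {for w, continuous (fun v : Cx R => (v - z)^-1)}.
Proof.
move=> wz; apply: (cder_cont (cderV (F := fun v => v - z) wz _)).
exact: (cderB (cder_id w) (cder_cst z w)).
Qed.

Lemma contM_cx h k w : {for w, continuous h} -> {for w, continuous k} ->
  {for w, continuous (fun v => h v * k v)}.
Proof. by move=> hc kc; exact: (cvgM hc kc). Qed.

Lemma cont_invX n z w : w - z != 0 ->
  {for w, continuous (fun v : Cx R => ((v - z) ^+ n.+1)^-1)}.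
Proof.
move=> wz; have D := cderX n (cderB (cder_id w) (cder_cst z w)).
by apply: (cder_cont (cderV (F := fun v => (v - z) ^+ n.+1) _ D)); rewrite expf_neq0.
Qed.

(** The winding number of the boundary around an interior point: each of the
   four sides is seen from z under a positive angle. *)
Lemma rbd_inv_neq0 x0 x1 y0 y1 z : irect x0 x1 y0 y1 z ->
  rbd (fun w => (w - z)^-1) x0 x1 y0 y1 != 0.
Proof.
move=> zr; have [/andP[a b] /andP[c d]] := zr.
have x01 := lt_trans a b; have y01 := lt_trans c d.
have kc w : frame x0 x1 y0 y1 w -> {for w, continuous (fun v : Cx R => (v - z)^-1)}.
  by move=> /(frame_neq zr); exact: cont_inv.
have reV v : re v^-1 = re v / (cmod v ^+ 2) by rewrite cmod_sqr; case: (v).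
have imV v : im v^-1 = - im v / (cmod v ^+ 2) by rewrite cmod_sqr mulNr; case: (v).
have sq0 w : frame x0 x1 y0 y1 w -> 0 < cmod (w - z) ^+ 2.
  by move=> /(frame_neq zr) h; rewrite exprn_gt0// cmod_gt0.
suff : 0 < im (rbd (fun w => (w - z)^-1) x0 x1 y0 y1).
  by apply: contraTneq => ->; rewrite /= ltxx.
rewrite /rbd /ci !cxE /= mul0r add0r mul1r.
have [t0 tx0 ->] := rint_mean x01 (fun t tx => (continuous_hline (kc _ (frame_h y01 tx).1)).2).
have [t1 tx1 ->] := rint_mean x01 (fun t tx => (continuous_hline (kc _ (frame_h y01 tx).2)).2).
have [s0 sy0 ->] := rint_mean y01 (fun t ty => (continuous_vline (kc _ (frame_v x01 ty).2)).1).
have [s1 sy1 ->] := rint_mean y01 (fun t ty => (continuous_vline (kc _ (frame_v x01 ty).1)).1).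
have x01' : 0 < x1 - x0 by rewrite subr_gt0.
have y01' : 0 < y1 - y0 by rewrite subr_gt0.
have H0 : 0 < im (cpair t0 y0 - z)^-1.
  rewrite imV divr_gt0 ?sq0//; last exact: (frame_h y01 tx0).1.
  by rewrite !cxE; lra.
have H1 : im (cpair t1 y1 - z)^-1 < 0.
  rewrite -oppr_gt0 imV mulNr opprK divr_gt0 ?sq0//; last exact: (frame_h y01 tx1).2.
  by rewrite !cxE; lra.
have H2 : 0 < re (cpair x1 s0 - z)^-1.
  rewrite reV divr_gt0 ?sq0//; last exact: (frame_v x01 sy0).2.
  by rewrite !cxE; lra.
have H3 : re (cpair x0 s1 - z)^-1 < 0.
  rewrite -oppr_gt0 reV -mulNr divr_gt0 ?sq0//; last exact: (frame_v x01 sy1).1.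
  by rewrite !cxE; lra.
rewrite addr_gt0// subr_gt0; first by rewrite ltr_pM2r//; exact: lt_trans H0.
by rewrite ltr_pM2r//; exact: lt_trans H2.
Qed.

End Cauchy.

Section CauchyFormula.
Context {R : realType}.
Implicit Types (h k G : Cx R -> Cx R) (z w : Cx R).

Lemma frame_bounded h x0 x1 y0 y1 : x0 < x1 -> y0 < y1 ->
  (forall w, frame x0 x1 y0 y1 w -> {for w, continuous h}) ->
  exists2 M : R, 0 < M & forall w, frame x0 x1 y0 y1 w -> cmod (h w) <= M.
Proof.
move=> x01 y01 hc.
have hb (f : R -> R) (a b : R) : a < b -> (forall t, a <= t <= b -> {for t, continuous f}) ->
   exists M, forall t, a <= t <= b -> f t <= M.
  move=> ab fc; have [|c _ cM] := @EVT_max R f a b (ltW ab).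
    by apply: continuous_in_subspaceT => t; rewrite inE /= in_itv /= => /fc.
  by exists (f c) => t tab; apply: cM; rewrite in_itv.
have mh y : (forall t, x0 <= t <= x1 -> frame x0 x1 y0 y1 (cpair t y)) ->
   exists M, forall t, x0 <= t <= x1 -> cmod (h (cpair t y)) <= M.
  move=> fy.
  have [||M1 H1] := hb (fun t => `|re (h (cpair t y))|) x0 x1 => //.
    move=> t /fy/hc/continuous_hline[c _].
    exact: (continuous_comp c (@norm_continuous _ _ _)).
  have [||M2 H2] := hb (fun t => `|im (h (cpair t y))|) x0 x1 => //.
    move=> t /fy/hc/continuous_hline[_ c].
    exact: (continuous_comp c (@norm_continuous _ _ _)).
  exists (M1 + M2) => t tx; apply: le_trans (cmod_sum _) _.
  by apply: lerD; [exact: H1|exact: H2].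
have mv x : (forall t, y0 <= t <= y1 -> frame x0 x1 y0 y1 (cpair x t)) ->
   exists M, forall t, y0 <= t <= y1 -> cmod (h (cpair x t)) <= M.
  move=> fx.
  have [||M1 H1] := hb (fun t => `|re (h (cpair x t))|) y0 y1 => //.
    move=> t /fx/hc/continuous_vline[c _].
    exact: (continuous_comp c (@norm_continuous _ _ _)).
  have [||M2 H2] := hb (fun t => `|im (h (cpair x t))|) y0 y1 => //.
    move=> t /fx/hc/continuous_vline[_ c].
    exact: (continuous_comp c (@norm_continuous _ _ _)).
  exists (M1 + M2) => t tx; apply: le_trans (cmod_sum _) _.
  by apply: lerD; [exact: H1|exact: H2].
have [A HA] := mh y0 (fun t tx => (frame_h y01 tx).1).
have [B HB] := mh y1 (fun t tx => (frame_h y01 tx).2).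
have [C HC] := mv x0 (fun t tx => (frame_v x01 tx).1).
have [D HD] := mv x1 (fun t tx => (frame_v x01 tx).2).
exists (Num.max (Num.max A B) (Num.max (Num.max C D) 1)).
  by rewrite !lt_max ltr01 !orbT.
move=> w [[wx wy] H]; rewrite -(cpairK w) !le_max.
case: H => [E|[E|[E|E]]].
- by rewrite E HC ?orbT.
- by rewrite E HD ?orbT.
- by rewrite E HA ?orbT.
- by rewrite E HB ?orbT.
Qed.

Lemma cder_sq (F : Cx R -> Cx R) z l (C d : R) : 0 < d -> 0 <= C ->
  (forall w, cmod (w - z) < d -> cmod (F w - F z - l * (w - z)) <= C * cmod (w - z) ^+ 2) ->
  cder F z l.
Proof.
move=> d0 C0 H e e0; exists (Num.min d (e / (C + 1))).
  by rewrite lt_min d0 divr_gt0// ltr_wpDl.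
move=> w; rewrite lt_min ltr_pdivlMr ?ltr_wpDl// => /andP[/H h we].
apply: le_trans h _; rewrite expr2 mulrA ler_wpM2r ?cmod_ge0//.
apply: le_trans (ltW we); rewrite mulrC ler_wpM2l ?cmod_ge0//.
by rewrite lerDl.
Qed.

(** Differentiation of Cauchy integrals under the integral sign, for the two
   exponents needed to differentiate the Cauchy formula twice. *)
Lemma cder_kernel h x0 x1 y0 y1 z n : (n < 2)%N -> irect x0 x1 y0 y1 z ->
  (forall w, frame x0 x1 y0 y1 w -> {for w, continuous h}) ->
  cder (fun z => rbd (fun v => h v * ((v - z) ^+ n.+1)^-1) x0 x1 y0 y1) z
    (rbd (fun v => n.+1%:R * h v * ((v - z) ^+ n.+2)^-1) x0 x1 y0 y1).
Proof.
move=> n2 zr hc.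
have x01 : x0 < x1 by case: zr => /andP[h1 h2] _; exact: lt_trans h2.
have y01 : y0 < y1 by case: zr => _ /andP[h1 h2]; exact: lt_trans h2.
have [d d0 dz] := frame_dist zr.
have [M M0 hM] := frame_bounded x01 y01 hc.
set c := 2 / d.
have c0 : 0 < c by rewrite divr_gt0.
set C : R := M * (c ^+ 3 + 3 * c ^+ 4).
have c0' := ltW c0.
have C0 : 0 <= C.
  by apply: mulr_ge0; [exact: ltW|apply: addr_ge0; [exact: exprn_ge0|apply: mulr_ge0 => //; exact: exprn_ge0]].
pose L := (x1 - x0) + (y1 - y0).
have L0 : 0 < L by rewrite addr_gt0 ?subr_gt0.
apply: (@cder_sq _ _ _ (4 * C * L) (d / 2)); first by rewrite divr_gt0.
  by apply: mulr_ge0 (ltW L0); exact: mulr_ge0.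
move=> w wd.
have wfar v : frame x0 x1 y0 y1 v -> d / 2 <= cmod (v - w).
  move=> /dz dv; have := cmodD (v - w) (w - z); rewrite addrA subrK; lra.
have zfar v : frame x0 x1 y0 y1 v -> d / 2 <= cmod (v - z).
  by move=> /dz; apply: le_trans; rewrite ler_pdivrMr// ler_pMr// ler1n.
have d20 : 0 < d / 2 by rewrite divr_gt0.
have far_neq v u : d / 2 <= cmod (v - u) -> v - u != 0.
  by move=> /(lt_le_trans d20); rewrite cmod_gt0.
have far_inv v u : d / 2 <= cmod (v - u) -> cmod (v - u)^-1 <= c.
  move=> vu; rewrite cmodV /c -[2 / d]invf_div lef_pV2// posrE//.
  exact: lt_le_trans vu.
rewrite -addrA -opprD (mulrC (rbd _ _ _ _ _) (w - z)).
have -> : 4 * C * L * cmod (w - z) ^+ 2 = 4 * (C * cmod (w - z) ^+ 2) * L by ring.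
apply: rbd_lin_est => // v fv.
have vz := far_neq _ _ (zfar v fv); have vw := far_neq _ _ (wfar v fv).
split.
- by apply: contM_cx (hc _ fv) _; exact: cont_invX.
- by apply: contM_cx (hc _ fv) _; exact: cont_invX.
- apply: contM_cx; last exact: cont_invX.
  by apply: contM_cx (hc _ fv); exact: (cder_cont (cder_cst _ _)).
set a := (v - w)^-1; set b := (v - z)^-1.
have ac : cmod a <= c by exact/far_inv/wfar.
have bc : cmod b <= c by exact/far_inv/zfar.
have a0 := cmod_ge0 a; have b0 := cmod_ge0 b.
have E1 : h v * ((v - w) ^+ n.+1)^-1 - (h v * ((v - z) ^+ n.+1)^-1 + (w - z) * (n.+1%:R * h v * ((v - z) ^+ n.+2)^-1))
   = (w - z) ^+ 2 * (h v * (a * b ^+ 2 * (if n == 0%N then 1 else a + 2 * b))).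
  rewrite /a /b; case: (n) n2 => [|[|//]] _; rewrite ?expr1 /=; field;
    by rewrite vz vw.
rewrite E1 cmodM cmodX mulrC ler_wpM2r ?exprn_ge0 ?cmod_ge0//.
rewrite cmodM /C; apply: ler_pM; rewrite ?cmod_ge0 ?hM//.
rewrite 2!cmodM [cmod (b ^+ 2)]cmodX.
have ab3 : cmod a * cmod b ^+ 2 <= c ^+ 3.
  rewrite [c ^+ 3]exprS; apply: ler_pM => //; first exact: exprn_ge0.
  by rewrite !expr2; exact: ler_pM.
case: ifP => _.
  by rewrite cmod1 mulr1; apply: le_trans ab3 _; rewrite lerDl mulr_ge0// exprn_ge0// ltW.
have ab : cmod (a + 2 * b) <= 3 * c.
  apply: le_trans (cmodD _ _) _; rewrite mulr_natl mulr2n.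
  apply: le_trans (lerD (lexx _) (cmodD _ _)) _; lra.
apply: (@le_trans _ _ (c ^+ 3 * (3 * c))).
  by apply: ler_pM; rewrite ?cmod_ge0// mulr_ge0// exprn_ge0.
by rewrite [leLHS](_ : _ = 3 * c ^+ 4) ?lerDr ?exprn_ge0 ?(ltW c0)//; ring.
Qed.

(** Goursat applied to the difference quotient of h at z, which is continuous
   at z. *)
Lemma cauchy_formula h x0 x1 y0 y1 z : irect x0 x1 y0 y1 z ->
  (forall w, rect x0 x1 y0 y1 w -> exists l, cder h w l) ->
  rbd (fun v => h v * ((v - z) ^+ 1)^-1) x0 x1 y0 y1 =
  h z * rbd (fun v => 1 * ((v - z) ^+ 1)^-1) x0 x1 y0 y1.
Proof.
move=> zr hd; have [/andP[a b] /andP[c d]] := zr.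
have x01 := lt_trans a b; have y01 := lt_trans c d.
have zrr : rect x0 x1 y0 y1 z by split; rewrite !ltW.
have [l hl] := hd z zrr.
pose k v := if v == z then l else (h v - h z) / (v - z).
have kd w : rect x0 x1 y0 y1 w -> w != z -> exists l, cder k w l.
  move=> /hd[m hm] wz.
  have wz0 : w - z != 0 by rewrite subr_eq0.
  have D := cderM (cderB hm (cder_cst (h z) w)) (cderV (F := fun v => v - z) wz0 (cderB (cder_id w) (cder_cst z w))).
  eexists; apply: (cder_eq D) => //.
  have wz1 : 0 < cmod (w - z) by rewrite cmod_gt0.
  apply/nbhs_cxP; exists (cmod (w - z)) => // v vw; rewrite /k ifF//.
  by apply/negbTE; apply: contraTneq vw => ->; rewrite cmodBC ltxx.
have kc w : rect x0 x1 y0 y1 w -> {for w, continuous k}.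
  have [->{w} _|wz /kd[//|m]] := eqVneq w z; last exact: cder_cont.
  apply/cont_cxP => e e0.
  have e2 : 0 < e / 2 by rewrite divr_gt0.
  have [t t0 Ht] := hl _ e2; exists t => // w wt.
  have [->|wz] := eqVneq w z; first by rewrite subrr cmod0.
  rewrite /k eqxx (negbTE wz).
  have wz0 : w - z != 0 by rewrite subr_eq0.
  have -> : (h w - h z) / (w - z) - l = (h w - h z - l * (w - z)) / (w - z).
    by field.
  rewrite cmodM cmodV ltr_pdivrMr ?cmod_gt0//; apply: le_lt_trans (Ht _ wt) _.
  by rewrite ltr_pM2r ?cmod_gt0// ltr_pdivrMr// ltr_pMr// ltr1n.
have k0 := goursat_punctured zr kc kd.
have fr w : frame x0 x1 y0 y1 w -> rect x0 x1 y0 y1 w by case.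
have := @rbd_lin_est R (fun v => h v * ((v - z) ^+ 1)^-1) k (fun v => 1 * ((v - z) ^+ 1)^-1) (h z) x0 x1 y0 y1 0 x01 y01.
rewrite k0 add0r mulr0 mul0r => H; apply/eqP; rewrite -subr_eq0 -cmod_eq0 eq_le cmod_ge0 andbT; apply: H.
move=> w wf; have wz := frame_neq zr wf; split.
- apply: contM_cx; last exact: cont_invX.
  by have [m] := hd _ (fr _ wf); exact: cder_cont.
- exact: kc (fr _ wf).
- apply: contM_cx; last exact: cont_invX.
  exact: (cder_cont (cder_cst _ _)).
rewrite /k ifF; last by apply/negbTE; rewrite -subr_eq0.
rewrite [X in cmod X](_ : _ = 0) ?cmod0//; field; exact: wz.
Qed.

(** Derivatives of holomorphic functions are holomorphic: the Cauchy formula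
   writes h as a quotient of two functions that can be differentiated twice. *)
Lemma cder_derive1_ex h x0 x1 y0 y1 z : irect x0 x1 y0 y1 z ->
  (forall w, rect x0 x1 y0 y1 w -> exists l, cder h w l) ->
  exists l, cder (derive1 h) z l.
Proof.
move=> zr hd; have [/andP[a b] /andP[c d]] := zr.
pose A n z := rbd (fun v => h v * ((v - z) ^+ n.+1)^-1) x0 x1 y0 y1.
pose C n z := rbd (fun v => 1 * ((v - z) ^+ n.+1)^-1) x0 x1 y0 y1.
pose A' n z := rbd (fun v => n.+1%:R * h v * ((v - z) ^+ n.+2)^-1) x0 x1 y0 y1.
pose C' n z := rbd (fun v => n.+1%:R * 1 * ((v - z) ^+ n.+2)^-1) x0 x1 y0 y1.
have hc w : frame x0 x1 y0 y1 w -> {for w, continuous h}.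
  by move=> [wr _]; have [l] := hd w wr; exact: cder_cont.
have cc (w : Cx R) : frame x0 x1 y0 y1 w -> {for w, continuous (fun=> 1 : Cx R)}.
  by move=> _; exact: (cder_cont (cder_cst _ _)).
have dA w n : (n < 2)%N -> irect x0 x1 y0 y1 w -> cder (A n) w (A' n w).
  by move=> n2 wr; exact: cder_kernel.
have dC w n : (n < 2)%N -> irect x0 x1 y0 y1 w -> cder (C n) w (C' n w).
  by move=> n2 wr; exact: (cder_kernel (h := fun=> 1)).
have A1 : A' 0%N = A 1%N by apply/funext => w; rewrite /A' /A; under eq_fun do rewrite mul1r.
have C1 : C' 0%N = C 1%N by apply/funext => w; rewrite /C' /C mul1r.
have Cn0 w : irect x0 x1 y0 y1 w -> C 0%N w != 0.
  have -> : C 0%N w = rbd (fun v => (v - w)^-1) x0 x1 y0 y1.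
    by rewrite /C; congr (rbd _ x0 x1 y0 y1); apply/funext => v; rewrite mul1r expr1.
  exact: rbd_inv_neq0.
have hE w : irect x0 x1 y0 y1 w -> h w = A 0%N w / C 0%N w.
  by move=> wr; rewrite [A 0%N w](cauchy_formula wr hd) mulfK ?Cn0.
have nr w : irect x0 x1 y0 y1 w -> \forall v \near w, irect x0 x1 y0 y1 v.
  move=> [/andP[p q] /andP[s t]]; apply/nbhs_cxP.
  exists (Num.min (Num.min (re w - x0) (x1 - re w)) (Num.min (im w - y0) (y1 - im w))).
    by rewrite !lt_min !subr_gt0 p q s t.
  move=> v; rewrite !lt_min => /andP[/andP[v1 v2] /andP[v3 v4]].
  have := le_lt_trans (cmod_re _) v1; have := le_lt_trans (cmod_re _) v2.
  have := le_lt_trans (cmod_im _) v3; have := le_lt_trans (cmod_im _) v4.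
  rewrite !cxE !ltr_norml => /andP[? ?] /andP[? ?] /andP[? ?] /andP[? ?].
  by split; apply/andP; split; lra.
pose H w := (A 1%N w * C 0%N w - A 0%N w * C 1%N w) * (C 0%N w ^+ 2)^-1.
have dh w : irect x0 x1 y0 y1 w -> derive1 h w = H w.
  move=> wr; apply: cder_derive1.
  have D := cderM (dA w 0%N isT wr) (cderV (Cn0 _ wr) (dC w 0%N isT wr)).
  apply: (cder_eq D).
    by apply: filterS (nr _ wr) => v /hE ->.
  by rewrite A1 C1 /H; field; rewrite Cn0.
have D1 := cderB (cderM (dA z 1%N isT zr) (dC z 0%N isT zr)) (cderM (dA z 0%N isT zr) (dC z 1%N isT zr)).
have D2 := cderX 1 (dC z 0%N isT zr).
have D3 := cderM D1 (cderV (F := fun w => C 0%N w ^+ 2) (expf_neq0 2 (Cn0 _ zr)) D2).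
eexists; apply: (cder_eq D3) => //.
by apply: filterS (nr _ zr) => v /dh ->.
Qed.

End CauchyFormula.

(** * Holomorphic functions on discs *)

Section HolomorphicDisc.
Context {R : realType}.
Implicit Types (h k G : Cx R -> Cx R) (z w : Cx R).

Definition disc_hol h z0 (r : R) : Prop :=
  forall z, cmod (z - z0) < r -> exists l, cder h z l.

Lemma holomorphic_atP h z0 : holomorphic_at h z0 <-> exists2 r : R, 0 < r & disc_hol h z0 r.
Proof.
split=> [/nbhs_cxP[r r0 H]|[r r0 H]].
  by exists r => // z /H /derivable_cder ?; eexists; eassumption.
by apply/nbhs_cxP; exists r => // z /H[l]; exact: cder_derivable.
Qed.

Lemma disc_hol_cder h z0 r z : disc_hol h z0 r -> cmod (z - z0) < r -> cder h z (derive1 h z).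
Proof. by move=> H /H[l hl]; rewrite (cder_derive1 hl). Qed.

Definition sq_rect z0 (s : R) z := rect (re z0 - s) (re z0 + s) (im z0 - s) (im z0 + s) z.
Definition sq_irect z0 (s : R) z := irect (re z0 - s) (re z0 + s) (im z0 - s) (im z0 + s) z.

Lemma sq_rect_disc z0 s z : 0 < s -> sq_rect z0 s z -> cmod (z - z0) < 3 * s.
Proof.
move=> s0 [/andP[a b] /andP[c d]]; apply: le_lt_trans (cmod_sum _) _.
have h1 : `|re (z - z0)| <= s by rewrite cxE reN ler_norml; apply/andP; split; lra.
have h2 : `|im (z - z0)| <= s by rewrite cxE imN ler_norml; apply/andP; split; lra.
lra.
Qed.

Lemma disc_sq_irect z0 s z : cmod (z - z0) < s -> sq_irect z0 s z.
Proof.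
move=> zs; have := le_lt_trans (cmod_re _) zs; have := le_lt_trans (cmod_im _) zs.
by rewrite !cxE !ltr_norml => /andP[? ?] /andP[? ?]; split; apply/andP; split; lra.
Qed.

Lemma disc_hol_derive1 h z0 r : disc_hol h z0 r -> disc_hol (derive1 h) z0 r.
Proof.
move=> H z zr; set s := (r - cmod (z - z0)) / 3.
have s0 : 0 < s by rewrite divr_gt0// subr_gt0.
apply: (@cder_derive1_ex _ _ (re z - s) (re z + s) (im z - s) (im z + s)).
  by apply: disc_sq_irect; rewrite subrr cmod0.
move=> w /(sq_rect_disc s0) wz; apply: H.
rewrite (_ : w - z0 = (w - z) + (z - z0)); last by ring.
by apply: le_lt_trans (cmodD _ _) _; rewrite -ltrBrDr; move: wz; rewrite /s mulrCA divff ?mulr1.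
Qed.

(** On a square inside the disc, integrating along horizontal and then
   vertical segments gives the same function as integrating in the other order,
   by Goursat; the two expressions give the two partial derivatives. *)
Lemma disc_primitive h z0 r : 0 < r -> disc_hol h z0 r ->
  exists K, forall z, cmod (z - z0) < r / 3 -> cder K z (h z).
Proof.
move=> r0 H; set s := r / 3.
have s0 : 0 < s by rewrite divr_gt0.
have s3 : 3 * s = r by rewrite /s; field.
have Hd w : sq_rect z0 s w -> exists l, cder h w l.
  by move=> /(sq_rect_disc s0); rewrite s3 => /H.
have Hc w : sq_rect z0 s w -> {for w, continuous h}.
  by move=> /Hd[l]; exact: cder_cont.
set x0 := re z0 - s; set x1 := re z0 + s; set y0 := im z0 - s; set y1 := im z0 + s.
have x01 : x0 < x1 by rewrite /x0 /x1; lra.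
have y01 : y0 < y1 by rewrite /y0 /y1; lra.
pose I1 y x := cint (fun t => h (cpair t y)) x0 x.
pose I2 x y := cint (fun t => h (cpair x t)) y0 y.
pose K z := I1 y0 (re z) + ci * I2 (re z) (im z).
have KE z : sq_irect z0 s z -> K z = I1 (im z) (re z) + ci * I2 x0 (im z).
  move=> [/andP[a b] /andP[c d]].
  have := @goursat R h x0 (re z) y0 (im z) a c.
  have Hd' w : rect x0 (re z) y0 (im z) w -> exists l, cder h w l.
    by move=> /(rect_sub (lexx _) (ltW b) (lexx _) (ltW d)) /Hd.
  move=> /(_ Hd'); rewrite /rbd /K /I1 /I2.
  set A := cint _ _ _; set B := cint _ _ _; set C := cint _ _ _; set D := cint _ _ _ => E.
  apply/eqP; rewrite -subr_eq0; apply/eqP; rewrite -[RHS]E; ring.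
have nearR (a b x : R) : a < x < b -> \forall t \near x, a < t < b.
  move=> xab; have : x \in `]a, b[%R by rewrite in_itv.
  by move=> /near_in_itvoo; apply: filterS => t; rewrite in_itv.
have ne (f g : R -> R) (x l : R) : (\forall t \near x, g t = f t) -> is_derive x (1 : R) g l -> is_derive x (1 : R) f l.
  by move=> fg; apply: near_eq_is_derive => //; rewrite oner_eq0.
have Kd z : sq_irect z0 s z -> cder K z (h z).
  move=> zi; have zi' := zi; move: zi' => [/andP[a b] /andP[c d]].
  pose t := Num.min (Num.min (re z - x0) (x1 - re z)) (Num.min (im z - y0) (y1 - im z)).
  have t0 : 0 < t by rewrite !lt_min !subr_gt0 a b c d.
  apply: (@cder_partials R K h z t) => //; last first.
    by apply: Hc; split; rewrite !ltW.
  move=> w; rewrite !lt_min => /andP[/andP[w1 w2] /andP[w3 w4]].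
  have {w1 w2 w3 w4}[/andP[a' b'] /andP[c' d']] : sq_irect z0 s w.
    have := le_lt_trans (cmod_re _) w1; have := le_lt_trans (cmod_re _) w2.
    have := le_lt_trans (cmod_im _) w3; have := le_lt_trans (cmod_im _) w4.
    rewrite !cxE !ltr_norml => /andP[? ?] /andP[? ?] /andP[? ?] /andP[? ?].
    by split; apply/andP; split; rewrite -/x0 -/x1 -/y0 -/y1; lra.
  have H1 : cantid (I1 (im w)) (fun t => h (cpair t (im w))) x0 x1.
    apply: cint_antid => //; apply: ccont_h => u ux; apply: Hc.
    by split=> //=; rewrite !ltW.
  have H2 : cantid (I2 (re w)) (fun t => h (cpair (re w) t)) y0 y1.
    apply: cint_antid => //; apply: ccont_v => u ux; apply: Hc.
    by split=> //=; rewrite !ltW.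
  have hx : x0 < re w < x1 by rewrite a'.
  have hy : y0 < im w < y1 by rewrite c'.
  have E1 : \forall u \near re w, K (cpair u (im w)) = I1 (im w) u + ci * I2 x0 (im w).
    by apply: filterS (nearR _ _ _ hx) => u ux; rewrite KE.
  have dc (f : R -> R) (u l m : R) : is_derive u (1 : R) f l -> is_derive u (1 : R) (fun v => f v + m) l.
    by move=> fl; have := is_deriveD fl (is_derive_cst m u (1 : R)); rewrite addr0.
  rewrite -[in h w](cpairK w); split.
  - apply: ne (dc _ _ _ (re (ci * I2 x0 (im w))) (H1.1.2 _ hx)).
    by apply: filterS E1 => u ->; rewrite reD.
  - apply: ne (dc _ _ _ (im (ci * I2 x0 (im w))) (H1.2.2 _ hx)).
    by apply: filterS E1 => u ->; rewrite imD.
  - rewrite -mulN1r.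
    apply: ne (dc _ _ _ (re (I1 y0 (re w))) (is_deriveMcstl (-1) (H2.2.2 _ hy))).
    by apply: filterS (nearR _ _ _ hy) => u _; rewrite /K /ci !cxE; ring.
  - apply: ne (dc _ _ _ (im (I1 y0 (re w))) (H2.1.2 _ hy)).
    by apply: filterS (nearR _ _ _ hy) => u _; rewrite /K /ci !cxE; ring.
by exists K => z /disc_sq_irect /Kd.
Qed.

Definition dquot h z0 z := if z == z0 then derive1 h z0 else (h z - h z0) / (z - z0).

Lemma dquotE h z0 z : h z = h z0 + (z - z0) * dquot h z0 z.
Proof.
rewrite /dquot; case: eqVneq => [->|zz0]; first by rewrite subrr mul0r addr0.
by field; rewrite subr_eq0.
Qed.

(** A difference quotient is holomorphic also at the centre: this is the second
   order Taylor formula there, available since the derivative of h is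
   differentiable. *)
Lemma disc_hol_dquot h z0 r : 0 < r -> disc_hol h z0 r -> disc_hol (dquot h z0) z0 r.
Proof.
move=> r0 H z zr.
have [->{z zr}|zz0] := eqVneq z z0; last first.
  have [m hm] := H _ zr.
  have wz0 : z - z0 != 0 by rewrite subr_eq0.
  have D := cderM (cderB hm (cder_cst (h z0) z)) (cderV (F := fun v => v - z0) wz0 (cderB (cder_id z) (cder_cst z0 z))).
  eexists; apply: (cder_eq D) => //.
  have wz1 : 0 < cmod (z - z0) by rewrite cmod_gt0.
  apply/nbhs_cxP; exists (cmod (z - z0)) => // v vw; rewrite /dquot ifF//.
  by apply/negbTE; apply: contraTneq vw => ->; rewrite cmodBC ltxx.
have [|l hl] := disc_hol_derive1 H (z := z0); first by rewrite subrr cmod0.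
exists (l / 2) => e e0.
have [d d0 Hd] := hl _ e0.
exists (Num.min d r) => [|z]; first by rewrite lt_min d0.
rewrite lt_min => /andP[zd zr].
have [->|zz0] := eqVneq z z0; first by rewrite !subrr mulr0 subr0 cmod0 mulr0.
have z10 : z - z0 != 0 by rewrite subr_eq0.
pose G w := h w - derive1 h z0 * w - l / 2 * (w - z0) ^+ 2.
pose g w := derive1 h w - derive1 h z0 - l * (w - z0).
have K : cmod (G z - G z0) <= e * cmod (z - z0) * cmod (z - z0).
  apply: (mvi (F' := g)) => t t01.
  have tz : cmod (seg z0 z t - z0) <= cmod (z - z0).
    rewrite /seg addrAC subrr add0r cmodM cmod_pair0.
    by case/andP: t01 => t0 t1; rewrite ger0_norm// ler_piMl ?cmod_ge0.
  set w := seg z0 z t in tz *; split; last first.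
    by apply: le_trans (Hd _ (le_lt_trans tz zd)) _; rewrite ler_wpM2l// ltW.
  have D := cderB (cderB (disc_hol_cder H (le_lt_trans tz zr)) (cderZ (derive1 h z0) (cder_id w)))
     (cderZ (l / 2) (cderX 1 (cderB (cder_id w) (cder_cst z0 w)))).
  suff <- : derive1 h w - derive1 h z0 * 1 - l / 2 * (2 * (w - z0) ^+ 1 * (1 - 0)) = g w by exact: D.
  rewrite /g subr0 !mulr1 expr1; congr (_ - _).
  by rewrite mulrA divfK// pnatr_eq0.
rewrite /dquot eqxx (negbTE zz0).
have -> : (h z - h z0) / (z - z0) - derive1 h z0 - l / 2 * (z - z0) = (G z - G z0) / (z - z0).
  by rewrite /G; field.
by rewrite cmodM cmodV ler_pdivrMr ?cmod_gt0.
Qed.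

(** Otherwise h / (z - z0)^n would be holomorphic for all n, and its Cauchy
   formula on a square bounds h (z1) by C 2^-n. *)
Lemma hol_factor h z0 : holomorphic_at h z0 -> (\forall z \near z0^', h z != 0) ->
  exists m k, [/\ holomorphic_at k z0, k z0 != 0 & \forall z \near z0, h z = (z - z0) ^+ m * k z].
Proof.
move=> /holomorphic_atP[r r0 H] /dnbhs_cxP[r' r'0 hn0]; apply: contrapT => nf.
have S n : exists2 k, disc_hol k z0 r & forall z, cmod (z - z0) < r -> h z = (z - z0) ^+ n * k z.
  elim: n => [|n [k kh hk]]; first by exists h => // z _; rewrite expr0 mul1r.
  have [k0|k0] := eqVneq (k z0) 0; last first.
    exfalso; apply: nf; exists n, k; split=> //; first by apply/holomorphic_atP; exists r.
    by apply/nbhs_cxP; exists r.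
  exists (dquot k z0); first exact: disc_hol_dquot.
  by move=> z /hk ->; rewrite {1}(dquotE k z0 z) k0 add0r mulrA exprSr.
set s := r / 3.
have s0 : 0 < s by rewrite divr_gt0.
have s3 : 3 * s = r by rewrite /s; field.
pose t := Num.min r' s / 2.
have t0 : 0 < t by rewrite divr_gt0// lt_min r'0.
(* z1 is at distance at most s / 2 from the centre and the boundary of the
   square at distance at least s, so that the ratio of the n-th powers decays
   like 2^-n *)
pose z1 := z0 + cpair t 0.
have z1t : cmod (z1 - z0) = t by rewrite /z1 addrAC subrr add0r cmod_pair0 gtr0_norm.
have ts : t <= s / 2 by rewrite ler_pM2r ?invr_gt0// ge_min lexx orbT.
have z1r : cmod (z1 - z0) < r by rewrite z1t -s3; lra.
have z1n : z1 != z0 by rewrite -subr_eq0 -cmod_gt0 z1t.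
have hz1 : h z1 != 0.
  apply: hn0 => //; rewrite z1t.
  have : t <= r' / 2 by rewrite ler_pM2r ?invr_gt0// ge_min lexx.
  by lra.
clearbody t s.
have z1i : sq_irect z0 s z1 by apply: disc_sq_irect; rewrite z1t; lra.
have x01 : re z0 - s < re z0 + s by lra.
have y01 : im z0 - s < im z0 + s by lra.
have Hd k w : disc_hol k z0 r -> sq_rect z0 s w -> exists l, cder k w l.
  by move=> kh /(sq_rect_disc s0); rewrite s3 => /kh.
have [d d0 dz] := frame_dist z1i.
have hc w : frame (re z0 - s) (re z0 + s) (im z0 - s) (im z0 + s) w -> {for w, continuous h}.
  by move=> [wr _]; have [l] := Hd h w H wr; exact: cder_cont.
have [M M0 hM] := frame_bounded x01 y01 hc.
set C := rbd (fun v => 1 * ((v - z1) ^+ 1)^-1) (re z0 - s) (re z0 + s) (im z0 - s) (im z0 + s).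
have C0 : C != 0.
  have E : (fun v : Cx R => 1 * ((v - z1) ^+ 1)^-1) = (fun v => (v - z1)^-1).
    by apply/funext => v; rewrite mul1r expr1.
  by rewrite /C E; exact: rbd_inv_neq0.
pose A := 4 * (M / d) * (((re z0 + s) - (re z0 - s)) + ((im z0 + s) - (im z0 - s))).
have bound n : cmod (h z1) * cmod C <= A / 2 ^+ n.
  have [k kh hk] := S n.
  have E := @cauchy_formula R k _ _ _ _ z1 z1i (fun w => Hd k w kh).
  rewrite (hk _ z1r) cmodM cmodX z1t -mulrA -cmodM -/C -E.
  have B : cmod (rbd (fun v => k v * ((v - z1) ^+ 1)^-1) (re z0 - s) (re z0 + s) (im z0 - s) (im z0 + s))
     <= 4 * (M / d / s ^+ n) * (((re z0 + s) - (re z0 - s)) + ((im z0 + s) - (im z0 - s))).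
    apply: rbd_bound => // w wf; split.
      apply: contM_cx; last by apply: cont_invX; exact: frame_neq wf.
      by have [l] := Hd k w kh wf.1; exact: cder_cont.
    have wr : cmod (w - z0) < r by rewrite -s3; exact: sq_rect_disc wf.1.
    have sw : s <= cmod (w - z0).
      have h1 := cmod_re (w - z0); have h2 := cmod_im (w - z0); rewrite !cxE in h1 h2.
      case: wf => _ [E'|[E'|[E'|E']]]; rewrite E' in h1 h2.
      - by move: h1; rewrite addrAC subrr add0r normrN gtr0_norm.
      - by move: h1; rewrite addrAC subrr add0r gtr0_norm.
      - by move: h2; rewrite addrAC subrr add0r normrN gtr0_norm.
      - by move: h2; rewrite addrAC subrr add0r gtr0_norm.
    have wp : 0 < cmod (w - z0) by exact: lt_le_trans sw.
    have -> : k w = h w / (w - z0) ^+ n.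
      by rewrite hk// mulrC mulKf// expf_neq0// -cmod_gt0.
    rewrite expr1 !cmodM !cmodV cmodX [leRHS]mulrAC.
    rewrite -[leRHS]mulrA -[leLHS]mulrA; apply: ler_pM; rewrite ?cmod_ge0 ?hM//.
      by rewrite mulr_ge0// invr_ge0 ?exprn_ge0 ?cmod_ge0.
    apply: ler_pM; rewrite ?invr_ge0 ?exprn_ge0 ?cmod_ge0//.
      by rewrite lef_pV2 ?posrE ?exprn_gt0// lerXn2r ?nnegrE ?(ltW s0) ?cmod_ge0.
    by rewrite lef_pV2 ?posrE ?dz// (lt_le_trans d0)// dz.
  apply: le_trans (ler_wpM2l (exprn_ge0 _ (ltW t0)) B) _.
  have -> : t ^+ n * (4 * (M / d / s ^+ n) * (re z0 + s - (re z0 - s) + (im z0 + s - (im z0 - s)))) = A * (t / s) ^+ n.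
    rewrite [(t / s) ^+ n]expr_div_n /A.
    by move: (t ^+ n) (s ^+ n) (_ + _ : R) (M / d) => p q L m; ring.
  apply: ler_wpM2l; first by rewrite !mulr_ge0 ?invr_ge0 ?(ltW M0) ?(ltW d0)//; lra.
  rewrite -exprVn lerXn2r ?nnegrE ?invr_ge0 ?divr_ge0 ?(ltW t0) ?(ltW s0)//.
  by rewrite ler_pdivrMr// mulrC.
have p0 : 0 < cmod (h z1) * cmod C by rewrite mulr_gt0 ?cmod_gt0.
pose n := (Num.trunc (A / (cmod (h z1) * cmod C))).+1.
have := bound n; apply/negP; rewrite -ltNge ltr_pdivrMr ?exprn_gt0// mulrC -ltr_pdivrMr//.
apply: (@lt_trans _ _ n%:R); first exact: truncnS_gt.
by rewrite -natrX ltr_nat ltn_expl.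
Qed.

End HolomorphicDisc.

(** * Germs of holomorphic and meromorphic functions *)

Section LocalForms.
Context {R : realType}.
Implicit Types (h k G : Cx R -> Cx R) (z w : Cx R) (F : Cx R -> sphere R).

Lemma near_cder h z0 : holomorphic_at h z0 -> \forall z \near z0, cder h z (derive1 h z).
Proof. by apply: filterS => z; exact: derivable_cder. Qed.

Lemma hol_at h z0 : holomorphic_at h z0 -> cder h z0 (derive1 h z0).
Proof. by move=> /near_cder /nbhs_cxP[e e0]; apply; rewrite subrr cmod0. Qed.

Lemma hol_near h z0 : holomorphic_at h z0 -> \forall z \near z0, holomorphic_at h z.
Proof. by move=> hh; exact: (nbhs_interior hh). Qed.

Lemma hol_cder (h h' : Cx R -> Cx R) z0 : (\forall z \near z0, cder h z (h' z)) -> holomorphic_at h z0.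
Proof. by apply: filterS => z; exact: cder_derivable. Qed.

Lemma hol_cont h z0 : holomorphic_at h z0 -> {for z0, continuous h}.
Proof. by move=> /hol_at; exact: cder_cont. Qed.

Lemma hol_cst (c z0 : Cx R) : holomorphic_at (fun=> c) z0.
Proof. by apply: (@hol_cder _ (fun=> 0)); apply/nbhs_cxP; exists 1 => // z _; exact: cder_cst. Qed.

Lemma hol_subX n z1 z0 : holomorphic_at (fun z : Cx R => (z - z1) ^+ n) z0.
Proof.
case: n => [|n]; first by under eq_fun do rewrite expr0; exact: hol_cst.
apply: (@hol_cder _ (fun z => n.+1%:R * (z - z1) ^+ n * (1 - 0))).
by apply/nbhs_cxP; exists 1 => // z _; apply: cderX; exact: cderB (cder_id _) (cder_cst _ _).
Qed.

Lemma holM h k z0 : holomorphic_at h z0 -> holomorphic_at k z0 ->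
  holomorphic_at (fun z => h z * k z) z0.
Proof.
move=> /near_cder hh /near_cder kk.
apply: (@hol_cder _ (fun z => derive1 h z * k z + h z * derive1 k z)).
by apply: filterS2 hh kk => z hz kz; exact: (cderM hz kz).
Qed.

Lemma holD h k z0 : holomorphic_at h z0 -> holomorphic_at k z0 ->
  holomorphic_at (fun z => h z + k z) z0.
Proof.
move=> /near_cder hh /near_cder kk.
apply: (@hol_cder _ (fun z => derive1 h z + derive1 k z)).
by apply: filterS2 hh kk => z hz kz; exact: (cderD hz kz).
Qed.

Lemma cont_neq0 h z0 : {for z0, continuous h} -> h z0 != 0 -> \forall z \near z0, h z != 0.
Proof.
move=> hc h0; have c0 : 0 < cmod (h z0) by rewrite cmod_gt0.
have [d d0 Hd] := (cont_cxP _ _).1 hc _ c0.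
apply/nbhs_cxP; exists d => // z /Hd; apply: contraTneq => ->.
by rewrite sub0r cmodN ltxx.
Qed.

Lemma holV h z0 : holomorphic_at h z0 -> h z0 != 0 -> holomorphic_at (fun z => (h z)^-1) z0.
Proof.
move=> hh h0; have hn := cont_neq0 (hol_cont hh) h0; have hd := near_cder hh.
apply: (@hol_cder _ (fun z => - derive1 h z / h z ^+ 2)).
by apply: filterS2 hn hd => z hz kz; exact: (cderV hz kz).
Qed.

Lemma hol_derive1 h z0 : holomorphic_at h z0 -> holomorphic_at (derive1 h) z0.
Proof.
by move=> /holomorphic_atP[r r0 H]; apply/holomorphic_atP; exists r => //; exact: disc_hol_derive1.
Qed.

Lemma hol_primitive h z0 : holomorphic_at h z0 -> exists K, \forall z \near z0, cder K z (h z).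
Proof.
move=> /holomorphic_atP[r r0 /(disc_primitive r0)[K HK]]; exists K.
by apply/nbhs_cxP; exists (r / 3) => //; rewrite divr_gt0.
Qed.

Lemma hol_dquot h z0 : holomorphic_at h z0 -> holomorphic_at (dquot h z0) z0.
Proof.
by move=> /holomorphic_atP[r r0 H]; apply/holomorphic_atP; exists r => //; exact: disc_hol_dquot.
Qed.

Lemma punctured_eq h k z0 : {for z0, continuous h} -> {for z0, continuous k} ->
  (\forall z \near z0^', h z = k z) -> h z0 = k z0.
Proof.
move=> hc kc /dnbhs_cxP[r r0 E]; apply/eqP; rewrite -subr_eq0 -cmod_eq0 eq_le cmod_ge0 andbT.
apply/ler_addgt0Pl => e e0; rewrite addr0.
have e2 : 0 < e / 2 by rewrite divr_gt0.
have [d d0 Hd] := (cont_cxP _ _).1 hc _ e2; have [d' d'0 Hd'] := (cont_cxP _ _).1 kc _ e2.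
pose t := Num.min r (Num.min d d') / 2.
have t0 : 0 < t by rewrite divr_gt0// !lt_min r0 d0.
pose z := z0 + cpair t 0.
have zt : cmod (z - z0) = t by rewrite /z addrAC subrr add0r cmod_pair0 gtr0_norm.
have m0 : t < Num.min r (Num.min d d') by rewrite /t ltr_pdivrMr// ltr_pMr ?ltr1n// !lt_min r0 d0.
move: m0; rewrite !lt_min => /and3P[tr td td'].
have h1 := Hd z; have h2 := Hd' z; rewrite zt in h1 h2.
have zz : z != z0 by rewrite -subr_eq0 -cmod_gt0 zt.
have E' := E z zz; rewrite zt in E'.
rewrite (_ : h z0 - k z0 = (k z - k z0) - (h z - h z0)); last by rewrite E'//; ring.
by apply: le_trans (cmodB _ _) _; rewrite ltW// [e]splitr ltrD ?h1 ?h2.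
Qed.

Lemma punctured_zero h g z0 n : {for z0, continuous h} -> {for z0, continuous g} ->
  (\forall z \near z0^', h z = (z - z0) ^+ n.+1 * g z) -> h z0 = 0.
Proof.
move=> hc gc E; pose p z : Cx R := (z - z0) ^+ n.+1.
have pc : {for z0, continuous p} by exact: hol_cont (hol_subX _ _ _).
have := @punctured_eq h (fun z => p z * g z) z0 hc (@contM_cx R p g z0 pc gc) E.
by move=> ->; rewrite /p subrr expr0n mul0r.
Qed.

(** A meromorphic germ that is not identically zero has a finite order, by
   hol_factor applied to the germ or to its inverse. *)
Lemma meromorphic_order F z0 : meromorphic_at F z0 -> (\forall z \near z0^', F z <> Some 0) ->
  exists m : int, order_at F z0 m.
Proof.
move=> [h [hh [FE|[FE hn]]]] Fn.
  have hn : \forall z \near z0^', h z != 0.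
    near=> z; apply/eqP => hz.
    have : F z <> Some 0 by near: z.
    have -> : F z = Some (h z) by near: z; exact: near_dnbhs_cx.
    by rewrite hz.
  have [m [k [kh k0 kE]]] := hol_factor hh hn.
  exists (m : int), k; split=> //; near=> z.
  have -> : F z = Some (h z) by near: z; exact: near_dnbhs_cx.
  by congr Some; near: z; exact: near_dnbhs_cx.
have [m [k [kh k0 kE]]] := hol_factor hh hn.
exists (- (m : int)), (fun z => (k z)^-1); split; first exact: holV.
  by rewrite invr_eq0.
near=> z.
have -> : F z = sphere_inv (Some (h z)) by near: z; exact: near_dnbhs_cx.
have h0 : h z != 0 by near: z.
rewrite /= (negbTE h0); congr Some.
have -> : h z = (z - z0) ^+ m * k z by near: z; exact: near_dnbhs_cx.
by rewrite invfM -exprnN.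
Unshelve. all: by end_near. Qed.

Lemma meromorphic_value F z0 m : meromorphic_at F z0 -> order_at F z0 m ->
  [/\ (0 < m -> F z0 = Some 0), (m < 0 -> F z0 = None)
    & (m = 0 -> exists2 c, c != 0 & F z0 = Some c)].
Proof.
move=> [h [hh FE]] [k [kh k0 kE]].
have sx n : {for z0, continuous (fun z : Cx R => (z - z0) ^+ n.+1)}.
  exact: hol_cont (hol_subX _ _ _).
have hc := hol_cont hh; have kc := hol_cont kh.
have kVc := hol_cont (holV kh k0).
have zne : \forall z \near z0^', z - z0 != 0.
  by apply/dnbhs_cxP; exists 1 => // z zz _; rewrite subr_eq0.
case: FE => [FE|[FE hn]].
  have F0 : F z0 = Some (h z0) by exact: nbhs_singleton FE.
  have hk : \forall z \near z0^', h z = (z - z0) ^ m * k z.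
    near=> z.
    have E1 : F z = Some (h z) by near: z; exact: near_dnbhs_cx.
    have E2 : F z = Some ((z - z0) ^ m * k z) by near: z.
    by move: E1; rewrite E2 => -[].
  case: m kE hk => [[|m]|m] kE hk; split=> //.
  - move=> _; exists (h z0) => //.
    rewrite (@punctured_eq h k z0 hc kc)//.
    by apply: filterS hk => z ->; rewrite expr0z mul1r.
  - by move=> _; rewrite F0 (punctured_zero hc kc hk).
  - move=> _; exfalso; move/eqP: k0; apply.
    apply: (@punctured_zero k h z0 m kc hc); near=> z.
    have -> : h z = (z - z0) ^ (Negz m) * k z by near: z.
    have zz0 : z - z0 != 0 by near: z.
    by rewrite NegzE -exprnN mulrA divff ?mul1r// expf_neq0.
have F0 : F z0 = sphere_inv (Some (h z0)) by exact: nbhs_singleton FE.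
have hk : \forall z \near z0^', (h z)^-1 = (z - z0) ^ m * k z.
  near=> z.
  have E1 : F z = sphere_inv (Some (h z)) by near: z; exact: near_dnbhs_cx.
  have E2 : F z = Some ((z - z0) ^ m * k z) by near: z.
  have h0 : h z != 0 by near: z.
  by move: E1; rewrite E2 /= (negbTE h0) => -[].
case: m kE hk => [[|m]|m] kE hk; split=> //.
- move=> _.
  have h0 : h z0 = (k z0)^-1.
    apply: (@punctured_eq h (fun z => (k z)^-1) z0 hc kVc).
    by apply: filterS hk => z; rewrite expr0z mul1r => <-; rewrite invrK.
  exists (k z0) => //; rewrite F0 h0 /= invr_eq0 (negbTE k0) invrK//.
- move=> _; exfalso; move: (invr_neq0 k0) => /eqP; apply.
  apply: (@punctured_zero (fun z => (k z)^-1) h z0 m kVc hc); near=> z.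
  have E : (h z)^-1 = (z - z0) ^ m.+1 * k z by near: z.
  have zz0 : z - z0 != 0 by near: z.
  by rewrite -[h z]invrK E invfM mulrA divff ?mul1r// expf_neq0.
- move=> _; rewrite F0 (_ : h z0 = 0) /= ?eqxx//.
  apply: (@punctured_zero h (fun z => (k z)^-1) z0 m hc kVc); near=> z.
  have E : (h z)^-1 = (z - z0) ^ (Negz m) * k z by near: z.
  by rewrite -[h z]invrK E invfM NegzE -exprnN invrK.
Unshelve. all: by end_near. Qed.

(** The mean value inequality for h - h' (z0) id, whose derivative is small
   near z0. *)
Lemma hol_inj h z0 : holomorphic_at h z0 -> derive1 h z0 != 0 ->
  exists2 r : R, 0 < r & forall x y, cmod (x - z0) < r -> cmod (y - z0) < r -> h x = h y -> x = y.
Proof.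
move=> hh h0; set a := derive1 h z0 in h0.
have a2 : 0 < cmod a / 2 by rewrite divr_gt0// cmod_gt0.
have [d d0 Hd] := (cont_cxP _ _).1 (hol_cont (hol_derive1 hh)) _ a2.
have /nbhs_cxP[r r0 Hr] := near_cder hh.
exists (Num.min d r) => [|x y]; first by rewrite lt_min d0.
rewrite !lt_min => /andP[xd xr] /andP[yd yr] E.
have m0 : 0 < Num.min d r by rewrite lt_min d0.
have H : cmod ((h x - a * x) - (h y - a * y)) <= cmod a / 2 * cmod (x - y).
  apply: (@mvi_ball R (fun w => h w - a * w) (fun w => derive1 h w - a * 1) z0 (Num.min d r)).
  - move=> z; rewrite lt_min => /andP[zd zr]; split.
      by apply: cderB (Hr _ zr) _; apply: cderZ; exact: cder_id.
    by rewrite mulr1 ltW// Hd.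
  - by rewrite lt_min xd.
  - by rewrite lt_min yd.
apply/eqP; rewrite -subr_eq0 -cmod_eq0 eq_le cmod_ge0 andbT.
have E2 : (h x - a * x) - (h y - a * y) = - (a * (x - y)) by rewrite E; ring.
move: H; rewrite E2 cmodN cmodM -subr_ge0 -mulrBl => H.
have : cmod a / 2 - cmod a < 0 by lra.
by move=> /nmulr_rge0 <-.
Qed.

End LocalForms.

(** * Primitives of meromorphic forms *)

Section Primitives.
Context {R : realType}.
Implicit Types (h k G : Cx R -> Cx R) (z w : Cx R) (F : Cx R -> sphere R).

Lemma cder_subX (z0 z : Cx R) n :
  cder (fun w : Cx R => (w - z0) ^+ n.+1) z (n.+1%:R * (z - z0) ^+ n).
Proof.
have := cderX n (cderB (cder_id z) (cder_cst z0 z)).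
by move/cder_val; apply; rewrite subr0 mulr1.
Qed.

Lemma punctured_neq (z0 : Cx R) : \forall z \near z0^', z - z0 != 0.
Proof. by apply/dnbhs_cxP; exists 1 => // z zz _; rewrite subr_eq0. Qed.

(** The primitive that vanishes at z0 is divided by z - z0 as long as it vanishes
   there; comparison of derivatives shows that this happens m + 1 times. *)
Lemma primitive_pow h z0 m : holomorphic_at h z0 ->
  exists K, [/\ holomorphic_at K z0, m.+1%:R * K z0 = h z0 &
    \forall z \near z0, cder (fun w => (w - z0) ^+ m.+1 * K w) z ((z - z0) ^+ m * h z)].
Proof.
move=> hh.
have [P HP] := hol_primitive (holM (hol_subX m z0 z0) hh).
pose P0 z := P z - P z0.
have P0d : \forall z \near z0, cder P0 z ((z - z0) ^+ m * h z).
  apply: filterS HP => z zP.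
  by have := cderB zP (cder_cst (P z0) z); rewrite subr0.
have P0h : holomorphic_at P0 z0 by exact: hol_cder P0d.
(* comparing the derivative of (z - z0)^(l+1) K with that of P0 *)
have Kd K l : (l <= m)%N -> holomorphic_at K z0 ->
    (\forall z \near z0, P0 z = (z - z0) ^+ l.+1 * K z) ->
    \forall z \near z0^', (z - z0) ^+ (m - l) * h z - l.+1%:R * K z = (z - z0) * derive1 K z.
  move=> lm Kh PK; near=> z.
  have zz0 : z - z0 != 0 by near: z; exact: punctured_neq.
  have d1 : cder P0 z ((z - z0) ^+ m * h z) by near: z; exact: near_dnbhs_cx.
  have dK : cder K z (derive1 K z) by near: z; apply: near_dnbhs_cx; exact: near_cder.
  have d2 := cderM (cder_subX z0 z l) dK.
  have PKz : \forall w \near z, P0 w = (w - z0) ^+ l.+1 * K w.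
    by near: z; apply: near_dnbhs_cx; exact: nbhs_interior PK.
  have E := cder_uniq (cder_eq d1 PKz erefl) d2.
  apply: (@mulfI _ ((z - z0) ^+ l)); first by rewrite expf_neq0.
  rewrite mulrBr mulrA -exprD subnKC// E exprSr.
  by ring.
have step l : (l <= m.+1)%N -> exists2 K, holomorphic_at K z0 &
    \forall z \near z0, P0 z = (z - z0) ^+ l * K z.
  elim: l => [_|l IH lm].
    by exists P0 => //; apply/nbhs_cxP; exists 1 => // z _; rewrite expr0 mul1r.
  have [K Kh PK] := IH (ltnW lm).
  have K0 : K z0 = 0.
    case: l lm {IH} PK => [|l] lm PK.
      by have := nbhs_singleton PK; rewrite expr0 mul1r /P0 subrr.
    have H := Kd _ _ (ltnW lm) Kh PK.
    have E : \forall z \near z0^', l.+1%:R * K z = (z - z0) ^+ 1 * ((z - z0) ^+ (m - l.+1) * h z - derive1 K z).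
      near=> z.
      have : (z - z0) ^+ (m - l) * h z - l.+1%:R * K z = (z - z0) * derive1 K z by near: z.
      have -> : (m - l = (m - l.+1).+1)%N by rewrite subnSK.
      rewrite exprS => e; rewrite expr1 mulrBr -e; ring.
    have := punctured_zero (hol_cont (holM (hol_cst l.+1%:R z0) Kh))
      (hol_cont (holD (holM (hol_subX (m - l.+1) z0 z0) hh) (holM (hol_cst (-1) z0) (hol_derive1 Kh)))).
    move=> /(_ 0%N) Z; have {Z} : l.+1%:R * K z0 = 0.
      by apply: Z; apply: filterS E => z ->; rewrite mulN1r.
    by move=> /eqP; rewrite mulf_eq0 pnatr_eq0 /= => /eqP.
  exists (dquot K z0); first exact: hol_dquot.
  by apply: filterS PK => z ->; rewrite {1}(dquotE K z0 z) K0 add0r mulrA exprSr.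
have [K Kh PK] := step m.+1 (leqnn _).
exists K; split=> //.
  have H := Kd K m (leqnn _) Kh PK; rewrite subnn in H.
  have := punctured_zero (h := fun z => h z + - (m.+1%:R) * K z) (n := 0)
    (hol_cont (holD hh (holM (hol_cst (- m.+1%:R) z0) Kh))) (hol_cont (hol_derive1 Kh)).
  move=> Z; apply/eqP; rewrite eq_sym -subr_eq0; apply/eqP.
  rewrite -mulNr; apply: Z; apply: filterS H => z; rewrite expr0 mul1r => e.
  by rewrite expr1 -e mulNr.
apply: filterS2 P0d (nbhs_interior PK) => z d1 E; exact: (cder_eq d1 E erefl).
Unshelve. all: by end_near. Qed.

(** Induction on n: the leading coefficient h (z0) is integrated explicitly and
   the remainder has a pole of smaller order; the residue c survives to the end. *)
Lemma primitive_neg h z0 n : holomorphic_at h z0 ->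
  exists c K, [/\ holomorphic_at K z0, (0 < n)%N -> n%:R * K z0 = - h z0, n = 0%N -> c = h z0 &
    \forall z \near z0^', cder (fun w => ((w - z0) ^+ n)^-1 * K w) z
       (((z - z0) ^+ n.+1)^-1 * h z - c / (z - z0))].
Proof.
elim: n h => [|n IH] h hh.
  have [K HK] := hol_primitive (hol_dquot hh).
  exists (h z0), K; split; [exact: hol_cder HK|by []|by []|].
  near=> z.
  have dK : cder K z (dquot h z0 z) by near: z; exact: near_dnbhs_cx.
  have zz0 : z - z0 != 0 by near: z; exact: punctured_neq.
  apply: (cder_eq dK).
    by apply/nbhs_cxP; exists 1 => // w _; rewrite expr0 invr1 mul1r.
  by rewrite (dquotE h z0 z) expr1; field.
have [c [K1 [Kh _ _ Kd]]] := IH _ (hol_dquot hh).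
exists c, (fun z => - h z0 / n.+1%:R + (z - z0) ^+ 1 * K1 z); split.
- exact: holD (hol_cst _ _) (holM (hol_subX 1 z0 z0) Kh).
- by move=> _; rewrite subrr expr0n mul0r addr0 mulrC divfK// pnatr_eq0.
- by [].
near=> z.
have dK : cder (fun w => ((w - z0) ^+ n)^-1 * K1 w) z
       (((z - z0) ^+ n.+1)^-1 * dquot h z0 z - c / (z - z0)) by near: z.
have zz0 : z - z0 != 0 by near: z; exact: punctured_neq.
have zw : \forall w \near z, w - z0 != 0.
  exact: (cont_neq0 (h := fun w => w - z0) (cder_cont (cderB (cder_id z) (cder_cst z0 z))) zz0).
have d1 := cderV (F := fun w => (w - z0) ^+ n.+1) (expf_neq0 n.+1 zz0) (cder_subX z0 z n).
have d2 := cderD (cderZ (- h z0 / n.+1%:R) d1) dK.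
have n0 : n.+1%:R != 0 :> Cx R by rewrite pnatr_eq0.
apply: (cder_eq d2).
  apply: filterS zw => w w0; rewrite mulrDr (mulrC (- h z0 / _)); congr (_ + _).
  by rewrite exprS expr1 invfM; field; rewrite expf_neq0.
rewrite (dquotE h z0 z) [(z - z0) ^+ n.+2]exprS [(z - z0) ^+ n.+1]exprS.
field; rewrite zz0 expf_neq0//= addrC.
Unshelve. all: by end_near. Qed.

(** The function f is a multivalued function with logarithmic derivative
   dW + c dz / (z - z0).  In the coordinate l = log (z - z0) its quotient by
   exp (W + c l) has derivative zero. *)
Lemma log_form (f W W' : Cx R -> Cx R) (z0 c l1 : Cx R) :
  (\forall z \near z0 + cexp l1, f z != 0 /\ cder W z (W' z) /\
     cder f z (f z * (W' z + c / (z - z0)))) ->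
  exists2 C, C != 0 & \forall l \near l1, f (z0 + cexp l) = C * cexp (W (z0 + cexp l) + c * l).
Proof.
move=> /nbhs_cxP[r r0 H].
have ed l : cder (fun l => z0 + cexp l) l (0 + cexp l).
  exact: cderD (cder_cst z0 l) (cder_cexp l).
have [d d0 Hd] := (cont_cxP _ _).1 (cder_cont (ed l1)) _ r0.
pose P l := f (z0 + cexp l) * cexp (- (W (z0 + cexp l) + c * l)).
have Pd l : cmod (l - l1) < d -> cder P l 0.
  move=> /Hd /H[f0 [Wd fd]].
  have d1 := cder_comp (ed l) fd.
  have d2 := cder_cexp_comp (cderN (cderD (cder_comp (ed l) Wd) (cderZ c (cder_id l)))).
  apply: (cder_val (cderM d1 d2)).
  have -> : z0 + cexp l - z0 = cexp l by ring.
  have e0 := cexp_neq0 l.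
  move: (cexp (- (W (z0 + cexp l) + c * l))) (f (z0 + cexp l)) (W' (z0 + cexp l)) => p a b.
  move: (cexp l) e0 => e e0.
  by field.
have l1d : cmod (l1 - l1) < d by rewrite subrr cmod0.
exists (P l1).
  by rewrite mulf_neq0 ?cexp_neq0//; case: (H (z0 + cexp l1)) => //; rewrite subrr cmod0.
apply/nbhs_cxP; exists d => // l ld.
rewrite -(cder0_cst Pd ld l1d) /P -mulrA -cexpD addNr cexp0 mulr1//.
Qed.

Lemma cx_root (n : nat) (c : Cx R) : (0 < n)%N -> exists z : Cx R, z ^+ n = c.
Proof. by move=> n0; exists (n.-root c)%C; exact: rootCK. Qed.

Lemma cx_rootz (m : int) (c : Cx R) : m != 0 -> c != 0 -> exists2 z : Cx R, z != 0 & z ^ m = c.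
Proof.
move=> m0 c0; case: m m0 => n n0.
  have n1 : (0 < n)%N by move: n0; case: (n).
  have [z zn] := cx_root c n1; exists z => //.
  by apply: contraNneq c0 => z0; rewrite -zn z0 expr0n gtn_eqF.
have [z zn] := cx_root c^-1 (ltn0Sn n); exists z.
  by apply: contraNneq c0 => z0; rewrite -invr_eq0 -zn z0 expr0n.
by rewrite NegzE -exprnN zn invrK.
Qed.

Lemma cpairXz (t : R) (m : int) : cpair t 0 ^ m = cpair (t ^ m) 0 :> Cx R.
Proof.
have X n : cpair t 0 ^+ n = cpair (t ^+ n) 0 :> Cx R.
  elim: n => [//|n IH]; rewrite !exprS IH; apply: cx_eqP; rewrite !cxE; ring.
have V (a : R) : (cpair a 0)^-1 = cpair a^-1 0 :> Cx R.
  have [->|a0] := eqVneq a 0; first by rewrite -[cpair 0 0]/(0 : Cx R) !invr0.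
  apply: (@mulfI _ (cpair a 0)); first by rewrite -cmod_eq0 cmod_pair0 normr_eq0.
  rewrite divff; last by rewrite -cmod_eq0 cmod_pair0 normr_eq0.
  by apply: cx_eqP; rewrite !cxE ?divff ?mul0r ?mulr0 ?subr0 ?addr0.
by case: m => n; rewrite ?NegzE -?exprnP ?X// -!exprnN X V.
Qed.

(** The ray is chosen such that v^m K (z0) = 1; the continuity of K leaves a
   factor 1 / 2. *)
Lemma ray_re (K : Cx R -> Cx R) z0 (m : int) : {for z0, continuous K} -> K z0 != 0 -> m != 0 ->
  exists2 v : Cx R, v != 0 & exists2 d : R, 0 < d & forall t : R, 0 < t < d ->
    t ^ m / 2 <= re ((cpair t 0 * v) ^ m * K (z0 + cpair t 0 * v)).
Proof.
move=> Kc K0 m0.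
have KV0 : (K z0)^-1 != 0 by rewrite invr_eq0.
have [v v0 vm] := cx_rootz m0 KV0.
exists v => //.
have e0 : 0 < cmod (K z0) / 2 by rewrite divr_gt0// cmod_gt0.
have [d d0 Hd] := (cont_cxP _ _).1 Kc _ e0.
exists (d / cmod v); first by rewrite divr_gt0// cmod_gt0.
move=> t /andP[t0]; rewrite ltr_pdivlMr ?cmod_gt0// => td.
have -> : (cpair t 0 * v) ^ m * K (z0 + cpair t 0 * v) = cpair (t ^ m) 0 * (K (z0 + cpair t 0 * v) / K z0).
  by rewrite exprzMl ?unitfE// ?cpairXz ?vm; [ring|rewrite -cmod_gt0 cmod_pair0 gtr0_norm].
rewrite reM im_cpair mul0r subr0 re_cpair ler_pM2l ?exprz_gt0//.
have := Hd (z0 + cpair t 0 * v).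
rewrite addrAC subrr add0r cmodM cmod_pair0 gtr0_norm// => /(_ td) h.
have {h} : cmod (K (z0 + cpair t 0 * v) / K z0 - 1) < 1 / 2.
  have -> : K (z0 + cpair t 0 * v) / K z0 - 1 = (K (z0 + cpair t 0 * v) - K z0) / K z0 by field.
  rewrite cmodM cmodV ltr_pdivrMr ?cmod_gt0//; apply: lt_le_trans h _.
  by rewrite mul1r [leRHS]mulrC.
move=> /(le_lt_trans (cmod_re _)); rewrite reB (_ : re 1 = 1)// ltr_norml => /andP[].
move: (re _) => x; lra.
Qed.

(** The logarithm is unbounded near 0. *)
Lemma log_bounded_eq0 (x C r : R) : 0 < r ->
  (forall t, 0 < t < r -> `|x * ln t| <= C) -> x = 0.
Proof.
move=> r0 H; apply/eqP; apply/negPn/negP => x0.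
have ax : 0 < `|x| by rewrite normr_gt0.
pose M := Num.max (- ln r + 1) (`|C| / `|x| + 1).
have M1 : - ln r + 1 <= M by rewrite le_max lexx.
have M2 : `|C| / `|x| + 1 <= M by rewrite le_max lexx orbT.
have M0 : 0 < M by rewrite (lt_le_trans _ M2)// ltr_wpDl// divr_ge0// ltW.
have := H (expR (- M)); rewrite expR_gt0 -[r in _ < r]lnK ?posrE// ltr_expR expRK.
have -> : - M < ln r by lra.
move=> /(_ isT); apply/negP; rewrite -ltNge normrM normrN (gtr0_norm M0).
apply: le_lt_trans (ler_norm C) _; rewrite mulrC -ltr_pdivrMr//.
by apply: lt_le_trans M2; rewrite ltrDl.
Qed.

End Primitives.

Lemma near_punctured (T : topologicalType) (p : T) (P : T -> Prop) :
  (\forall q \near p^', P q) <-> (\forall q \near p, q != p -> P q).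
Proof. by []. Qed.

Lemma cont_near (R : realType) (F : Cx R -> Cx R) z (P : Cx R -> Prop) :
  {for z, continuous F} -> (\forall w \near F z, P w) -> \forall w \near z, P (F w).
Proof. by move=> c H; exact: (c _ H). Qed.

Lemma seg_continuous (R : realType) (x y : Cx R) : continuous (seg x y : R -> Cx R).
Proof.
move=> t; have -> : seg x y = fun s => cpair (re x + s * re (y - x)) (im x + s * im (y - x)).
  by apply/funext => s; apply: cx_eqP; rewrite /seg !cxE; ring.
by apply: cpair_cvg; apply: cvgD; [exact: cvg_cst|apply: cvgMl; exact: cvg_id
  |exact: cvg_cst|apply: cvgMl; exact: cvg_id].
Qed.

Lemma shift_cvg (R : realType) (c : R -> Cx R) (a l : Cx R) (t : R) :
  c s @[s --> t] --> l -> a + c s @[s --> t] --> a + l.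
Proof.
move=> /cvg_cxP H; apply/cvg_cxP => e /H; apply: filterS => s.
by rewrite opprD addrACA subrr add0r.
Qed.

Lemma near_ltR (R : realType) (t a : R) : t < a -> \forall s \near t, s < a.
Proof.
move=> ta; have : t \in `]-oo, a[%R by rewrite in_itv.
by move=> /near_in_itvNyo; apply: filterS => s; rewrite in_itv.
Qed.

Lemma near_gtR (R : realType) (t a : R) : a < t -> \forall s \near t, a < s.
Proof.
move=> ta; have : t \in `]a, +oo[%R by rewrite in_itv /= ta.
by move=> /near_in_itvoy; apply: filterS => s; rewrite in_itv /= andbT.
Qed.

(** * Charts of a Riemann surface *)

Section Charts.
Context {R : realType} {S : topologicalType} (X : riemann_surface R S).
Implicit Types (i j : chart X) (p q : S) (z : Cx R).

(** Neighbourhood statements are transported to the coordinate plane, where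
   they become statements about discs. *)
Lemma near_chart i p (P : S -> Prop) : dom i p ->
  (\forall q \near p, P q) <-> (\forall z \near zcoord i p, P (param i z)).
Proof.
move=> ip; split=> H.
  by apply: (param_continuous ip); rewrite zcoordK.
have c := zcoord_continuous ip.
have d : \forall q \near p, dom i q by apply: open_nbhs_nbhs; split=> //; exact: dom_open.
have H2 : \forall q \near p, P (param i (zcoord i q)) by exact: (c _ H).
by apply: filterS2 d H2 => q iq; rewrite zcoordK.
Qed.

Definition chart_radius i p (r : R) : Prop := 0 < r /\
  forall z, cmod (z - zcoord i p) < r -> dom i (param i z) /\ zcoord i (param i z) = z.

Definition disc i p (r : R) : set S :=
  [set q | dom i q /\ cmod (zcoord i q - zcoord i p) < r].

Lemma near_chart_radius i p : dom i p ->
  \forall z \near zcoord i p, dom i (param i z) /\ zcoord i (param i z) = z.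
Proof.
move=> ip.
have : nbhs (zcoord i p) (zcoord i @` dom i).
  by apply: open_nbhs_nbhs; split; [exact: zcoord_open|exists p].
by apply: filterS => _ [q iq <-]; rewrite zcoordK.
Qed.

Lemma chart_nbhd i p (P : S -> Prop) : dom i p -> (\forall q \near p, P q) ->
  exists2 r, chart_radius i p r & forall q, disc i p r q -> P q.
Proof.
move=> ip /(near_chart _ ip) H.
have /nbhs_cxP[r r0 Hr] : \forall z \near zcoord i p,
    (dom i (param i z) /\ zcoord i (param i z) = z) /\ P (param i z).
  by apply: filterS2 (near_chart_radius ip) H => z.
exists r; first by split=> // z /Hr[].
by move=> q [iq /Hr[_]]; rewrite zcoordK.
Qed.

Lemma disc_center i p r : dom i p -> 0 < r -> disc i p r p.
Proof. by move=> ip r0; split=> //; rewrite subrr cmod0. Qed.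

Lemma disc_near i p r q : disc i p r q -> \forall x \near q, disc i p r x.
Proof.
move=> [iq qr].
have d : \forall x \near q, dom i x by apply: open_nbhs_nbhs; split=> //; exact: dom_open.
have e0 : 0 < r - cmod (zcoord i q - zcoord i p) by rewrite subr_gt0.
have c : \forall x \near q, cmod (zcoord i x - zcoord i q) < r - cmod (zcoord i q - zcoord i p).
  apply: (zcoord_continuous iq (t := fun w => cmod (w - zcoord i q) < _)).
  by apply/nbhs_cxP; exists (r - cmod (zcoord i q - zcoord i p)).
apply: filterS2 d c => x ix xc; split=> //.
rewrite (_ : zcoord i x - zcoord i p = (zcoord i x - zcoord i q) + (zcoord i q - zcoord i p)); last by ring.
by apply: le_lt_trans (cmodD _ _) _; rewrite -ltrBrDr.
Qed.

Lemma disc_open i p r : open (disc i p r).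
Proof. by rewrite openE => q /disc_near. Qed.

Lemma disc_param i p r z : chart_radius i p r -> cmod (z - zcoord i p) < r -> disc i p r (param i z).
Proof. by move=> [r0 H] zr; have [d e] := H z zr; split=> //; rewrite e. Qed.

Lemma zcoord_inj i p q : dom i p -> dom i q -> zcoord i p = zcoord i q -> p = q.
Proof. by move=> ip iq E; rewrite -(zcoordK ip) E zcoordK. Qed.

Lemma near_chart_d i p (P : S -> Prop) : dom i p ->
  (\forall q \near p^', P q) <-> (\forall z \near (zcoord i p)^', P (param i z)).
Proof.
move=> ip; rewrite /dnbhs /within /=; split=> [/(near_chart _ ip) H|H].
  apply: filterS2 (near_chart_radius ip) H => z [iz ez] H zz; apply: H.
  by apply: contra_neq zz => e; rewrite -ez e.
apply/(near_chart _ ip); apply: filterS2 (near_chart_radius ip) H => z [iz ez] H zz; apply: H.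
by apply: contra_neq zz => ->; rewrite zcoordK.
Qed.

Lemma dnbhs_near p (P : S -> Prop) : (\forall q \near p, P q) -> \forall q \near p^', P q.
Proof. by move=> H; apply/near_punctured; apply: filterS H. Qed.

Lemma dnbhs_ex p (P : S -> Prop) : (\forall q \near p^', P q) -> exists2 q, q != p & P q.
Proof.
have [i ip] := dom_cover X p.
move=> H; have : \forall q \near p^', q != p /\ P q.
  by apply/near_punctured; move/near_punctured: H; apply: filterS => q H qp; split=> //; exact: H.
move=> /(near_chart_d _ ip)/dnbhs_cxP[r r0 Hr].
have [] := Hr (zcoord i p + cpair (r / 2) 0).
- by rewrite -subr_eq0 addrAC subrr add0r -cmod_gt0 cmod_pair0 gtr0_norm ?divr_gt0.
- by rewrite addrAC subrr add0r cmod_pair0 gtr0_norm ?divr_gt0// ltr_pdivrMr// ltr_pMr ?ltr1n.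
by move=> h1 h2; exists (param i (zcoord i p + cpair (r / 2) 0)).
Qed.

Lemma chart_nbhd_d i p (P : S -> Prop) : dom i p -> (\forall q \near p^', P q) ->
  exists2 r, chart_radius i p r & forall q, disc i p r q -> q <> p -> P q.
Proof.
move=> ip H; have : \forall q \near p, q <> p -> P q.
  by move/near_punctured: H; apply: filterS => q H /eqP; exact: H.
by move=> /(chart_nbhd ip).
Qed.

Lemma trans_hol i j p : dom i p -> dom j p ->
  holomorphic_at (zcoord j \o param i) (zcoord i p).
Proof. exact: transition_holomorphic. Qed.

Lemma near_trans i j p (h : S -> Cx R) : dom i p -> dom j p ->
  \forall z \near zcoord i p, h (param i z) = (h \o param j) ((zcoord j \o param i) z).
Proof.
move=> ip jp.
have d : \forall q \near p, dom j q by apply: open_nbhs_nbhs; split=> //; exact: dom_open.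
by move/(near_chart _ ip): d; apply: filterS => z jz /=; rewrite zcoordK.
Qed.

(** Chain rule for a change of charts. *)
Lemma dcoord_chain i j p (h : S -> Cx R) : dom i p -> dom j p ->
  holomorphic_at (h \o param j) (zcoord j p) ->
  holomorphic_at (h \o param i) (zcoord i p) /\
  dcoord i h p = dcoord i (zcoord j) p * dcoord j h p.
Proof.
move=> ip jp hh.
have th := trans_hol ip jp.
have E0 : (zcoord j \o param i) (zcoord i p) = zcoord j p by rewrite /= zcoordK.
have E := near_trans h ip jp.
have D : \forall z \near zcoord i p, cder (h \o param i) z
    (derive1 (h \o param j) ((zcoord j \o param i) z) * derive1 (zcoord j \o param i) z).
  have hc : \forall z \near zcoord i p, cder (h \o param j) ((zcoord j \o param i) z)
      (derive1 (h \o param j) ((zcoord j \o param i) z)).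
    apply: (cont_near (P := fun w => cder (h \o param j) w (derive1 (h \o param j) w)) (hol_cont th)).
    by rewrite E0; exact: near_cder.
  apply: filterS3 (near_cder th) hc (nbhs_interior E) => z d1 d2 e.
  apply: (cder_eq (cder_comp d1 d2) _ erefl).
  by apply: filterS e => w /esym.
split; first exact: hol_cder D.
have E1 := cder_derive1 (nbhs_singleton D); rewrite E0 in E1.
rewrite [RHS]mulrC; exact: E1.
Qed.

Lemma dcoord_self i p : dom i p -> dcoord i (zcoord i) p = 1.
Proof.
move=> ip; rewrite /dcoord; apply: cder_derive1; apply: (cder_eq (cder_id _) _ erefl).
by apply: filterS (near_chart_radius ip) => z [_ /= ->].
Qed.

Lemma dcoord_inv i j p : dom i p -> dom j p ->
  dcoord i (zcoord j) p * dcoord j (zcoord i) p = 1.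
Proof.
move=> ip jp; have [_ <-] := dcoord_chain (h := zcoord i) ip jp (trans_hol jp ip).
exact: dcoord_self.
Qed.

Lemma dcoord_neq0 i j p : dom i p -> dom j p -> dcoord i (zcoord j) p != 0.
Proof.
move=> ip jp; apply/eqP => E; have := dcoord_inv ip jp; rewrite E mul0r => /esym/eqP.
by rewrite oner_eq0.
Qed.

(** * Paths in discs *)

Lemma within_nearP (T : topologicalType) (g : R -> T) :
  {within `[0, 1], continuous g} <->
  forall t, t \in `[0, 1]%R -> forall A, nbhs (g t) A -> \forall s \near t, s \in `[0, 1]%R -> A (g s).
Proof.
rewrite subspace_continuousP; split=> H t t01 A gA; first exact: (H t t01 A gA).
exact: (H t t01 A gA).
Qed.

Lemma param_path i p r (c : R -> Cx R) (W : set S) : chart_radius i p r ->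
  continuous c -> (forall t, 0 <= t <= 1 -> cmod (c t - zcoord i p) < r) ->
  (forall t, 0 <= t <= 1 -> W (param i (c t))) ->
  path_in W (fun t => param i (c t)) (param i (c 0)) (param i (c 1)).
Proof.
move=> [r0 H] cc cr cW; split; [|by []|by []|by move=> t; rewrite in_itv; exact: cW].
apply/within_nearP => t; rewrite in_itv => t01 A HA.
have [d e] := H _ (cr t t01).
have pc := param_continuous d; rewrite e in pc.
have : \forall s \near t, A (param i (c s)) by exact: (cc t _ (pc _ HA)).
by apply: filterS => s.
Qed.

(** Joining logarithms of the coordinates by a segment gives a path that avoids
   the centre. *)
Lemma punctured_path i p r q q' : dom i p -> chart_radius i p r -> disc i p r q -> disc i p r q' ->
  q <> p -> q' <> p -> exists g : R -> S, path_in (disc i p r `\ p) g q q'.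
Proof.
move=> ip rr [iq qr] [iq' qr'] qp qp'.
have n x : dom i x -> x <> p -> zcoord i x - zcoord i p != 0.
  by move=> ix xp; rewrite subr_eq0; apply/eqP => /(zcoord_inj ix ip).
have [l le lr] := cexp_surj (n q iq qp).
have [l' le' lr'] := cexp_surj (n q' iq' qp').
pose c (t : R) := zcoord i p + cexp (seg l l' t).
have c0 : param i (c 0) = q by rewrite /c seg0 le addrC subrK zcoordK.
have c1 : param i (c 1) = q' by rewrite /c seg1 le' addrC subrK zcoordK.
exists (fun t => param i (c t)); 
rewrite -[X in path_in _ _ X _]c0 -[X in path_in _ _ _ X]c1.
have r0 := rr.1.
have cr t : 0 <= t <= 1 -> cmod (c t - zcoord i p) < r.
  move=> t01; rewrite /c addrAC subrr add0r cmod_cexp -[ltRHS]lnK ?posrE// ltr_expR.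
  have lrr x y : dom i x -> x <> p -> re y = ln (cmod (zcoord i x - zcoord i p)) -> cmod (zcoord i x - zcoord i p) < r -> re y < ln r.
    by move=> ix xp -> h; rewrite ltr_ln ?posrE// cmod_gt0 n.
  have a := lrr _ _ iq qp lr qr; have b := lrr _ _ iq' qp' lr' qr'.
  rewrite /seg cxE reM re_cpair im_cpair mul0r subr0 reB.
  have -> : re l + t * (re l' - re l) = (1 - t) * re l + t * re l' by ring.
  case/andP: t01 => t0 t1.
  have [->|tn0] := eqVneq t 0; first by rewrite mul0r addr0 subr0 mul1r.
  have tp : 0 < t by rewrite lt_def tn0.
  rewrite (_ : ln r = (1 - t) * ln r + t * ln r); last by ring.
  by rewrite ler_ltD ?ltr_pM2l// ler_wpM2l ?subr_ge0// ltW.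
apply: (param_path rr) => //.
  move=> t; apply: shift_cvg.
  exact: (cvg_comp _ _ (@seg_continuous R l l' t) (@cexp_continuous R _)).
move=> t t01; split; first by apply: disc_param => //; exact: cr.
move=> /= E; have := cexp_neq0 (seg l l' t); apply/negP; rewrite negbK.
have [_ e] := rr.2 _ (cr t t01); rewrite E in e.
by apply/eqP; apply: (@addrI _ (zcoord i p)); rewrite addr0 -/(c t).
Qed.

Lemma disc_path i p r q q' : chart_radius i p r -> disc i p r q -> disc i p r q' ->
  exists g : R -> S, path_in (disc i p r) g q q'.
Proof.
move=> rr [iq qr] [iq' qr'].
pose c (t : R) := seg (zcoord i q) (zcoord i q') t.
have c0 : param i (c 0) = q by rewrite /c seg0 zcoordK.
have c1 : param i (c 1) = q' by rewrite /c seg1 zcoordK.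
exists (fun t => param i (c t)); 
rewrite -[X in path_in _ _ X _]c0 -[X in path_in _ _ _ X]c1.
have cr t : 0 <= t <= 1 -> cmod (c t - zcoord i p) < r by move=> t01; exact: seg_ball.
apply: (param_path rr) => //; last by move=> t /cr; exact: disc_param.
exact: seg_continuous.
Qed.

End Charts.

(** * Analytic continuation as paths of germs *)

Section Continuation.
Context {R : realType} {S : topologicalType} {T : Type}.
Implicit Types (W : set S) (el : S -> (S -> T) -> Prop) (d : R -> S * (S -> T)).

(** A path of germs that is continuous for the etale topology on germs: this
   packages a path together with a continuation along it. *)
Definition path_lift W el d (p q : S) (F G : S -> T) : Prop :=
  [/\ d 0 = (p, F), d 1 = (q, G),
    forall t, 0 <= t <= 1 -> forall U : set S, nbhs (d t).1 U ->
      \forall s \near t, 0 <= s <= 1 -> U (d s).1 /\ \forall x \near (d s).1, (d s).2 x = (d t).2 x &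
    forall t, 0 <= t <= 1 -> W (d t).1 /\ el (d t).1 (d t).2].

Lemma itv01 (t : R) : (t \in `[0, 1]%R) = (0 <= t <= 1).
Proof. by rewrite in_itv. Qed.

Lemma lift_continuation W el (g : R -> S) p q F G : path_in W g p q -> continuation el g F G ->
  exists d, path_lift W el d p q F G.
Proof.
move=> [gc g0 g1 gW] [Ft [F0 F1 FH]]; exists (fun t => (g t, Ft t)).
split; rewrite ?g0 ?g1 ?F0 ?F1// => t; rewrite -itv01 => t01; last first.
  by split; [exact: gW|have [] := FH t t01].
move=> U HU; have [_ H] := FH t t01; have H2 := (within_nearP g).1 gc t t01 U HU.
by apply: filterS2 H H2 => s h1 h2; rewrite -itv01 => s01; split; [exact: h2|exact: h1].
Qed.

Lemma continuation_lift W el d p q F G : path_lift W el d p q F G ->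
  path_in W (fun t => (d t).1) p q /\ continuation el (fun t => (d t).1) F G.
Proof.
move=> [d0 d1 dc dW]; split.
  split; rewrite ?d0 ?d1//; last by move=> t; rewrite itv01 => /dW[].
  apply/within_nearP => t; rewrite itv01 => t01 A HA.
  by apply: filterS (dc t t01 A HA) => s h; rewrite itv01 => /h[].
exists (fun t => (d t).2); rewrite d0 d1; split=> // t; rewrite itv01 => t01.
split; first by have [] := dW t t01.
by apply: filterS (dc t t01 setT filterT) => s h; rewrite itv01 => /h[].
Qed.

Lemma lift_cat W el d1 d2 p q r F G H : path_lift W el d1 p q F G -> path_lift W el d2 q r G H ->
  exists d, path_lift W el d p r F H.
Proof.
move=> [a0 a1 ac aW] [b0 b1 bc bW].
exists (fun t => if t <= 1 / 2 then d1 (2 * t) else d2 (2 * t - 1)); split.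
- by rewrite ifT ?mulr0//; lra.
- by rewrite ifF; [rewrite (_ : 2 * 1 - 1 = 1)//; lra|apply/negbTE; rewrite -ltNge; lra].
- move=> t t01 U.
  have cont2 (a : R) : 2 * s + a @[s --> t] --> 2 * t + a.
    by apply: cvgD; [apply: cvgMr; exact: cvg_id|exact: cvg_cst].
  have c1 (P : R -> Prop) : (\forall s \near 2 * t, P s) -> \forall s \near t, P (2 * s).
    have cont1 : 2 * s @[s --> t] --> 2 * t by apply: cvgMr; exact: cvg_id.
    by move=> HP; exact: (cont1 P HP).
  have c2 (P : R -> Prop) : (\forall s \near 2 * t - 1, P s) -> \forall s \near t, P (2 * s - 1).
    by move=> HP; exact: (cont2 (-1) P HP).
  have [t2|t2|t2] := ltgtP t (1 / 2).
  + move=> HU; have t01' : 0 <= 2 * t <= 1 by lra.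
    have lt2 : \forall s \near t, s < 1 / 2 by exact: near_ltR.
    apply: filterS2 lt2 (c1 _ (ac _ t01' U HU)) => s s2 h s01.
    by rewrite (ltW s2); apply: h; lra.
  + move=> HU; have t01' : 0 <= 2 * t - 1 <= 1 by lra.
    have lt2 : \forall s \near t, 1 / 2 < s by exact: near_gtR.
    apply: filterS2 lt2 (c2 _ (bc _ t01' U HU)) => s s2 h s01.
    by rewrite leNgt s2 /=; apply: h; lra.
  + subst t; rewrite (_ : 2 * (1 / 2) = 1); last by field.
    rewrite a1 /= => HU.
    have e1 : 2 * (1 / 2) = 1 :> R by field.
    have e2 : 2 * (1 / 2) - 1 = 0 :> R by field.
    have l1 : 0 <= (1 : R) <= 1 by rewrite ler01 lexx.
    have l0 : 0 <= (0 : R) <= 1 by rewrite ler01 lexx.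
    have h1 := ac 1 l1 U; rewrite a1 /= in h1.
    have h2 := bc 0 l0 U; rewrite b0 /= in h2.
    have {}h1 : \forall s \near (2 * (1 / 2) : R), 0 <= s <= 1 ->
       U (d1 s).1 /\ \forall x \near (d1 s).1, (d1 s).2 x = G x by rewrite e1; exact: h1.
    have {}h2 : \forall s \near (2 * (1 / 2) - 1 : R), 0 <= s <= 1 ->
       U (d2 s).1 /\ \forall x \near (d2 s).1, (d2 s).2 x = G x by rewrite e2; exact: h2.
    apply: filterS2 (c1 _ h1) (c2 _ h2) => s k1 k2 s01.
    by case: ifP => [s2|/negbT]; [apply: k1; lra|rewrite -ltNge => s2; apply: k2; lra].
- by move=> t t01; case: ifP => [s2|/negbT]; [apply: aW; lra|rewrite -ltNge => s2; apply: bW; lra].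
Qed.

Lemma lift_path W el (g : R -> S) p q F : path_in W g p q ->
  (forall t, 0 <= t <= 1 -> el (g t) F) -> exists d, path_lift W el d p q F F.
Proof.
move=> [gc g0 g1 gW] H; exists (fun t => (g t, F)).
split; rewrite ?g0 ?g1// => t t01; last by split; [apply: gW; rewrite itv01|exact: H].
rewrite -itv01 in t01; move=> U HU; have := (within_nearP g).1 gc t t01 U HU.
by apply: filterS => s h; rewrite -itv01 => /h ?; split=> //; apply: filterE.
Qed.

(** Function elements with the same germ are distinct functions; this path of
   constant position exchanges one for the other. *)
Lemma lift_germ W el p F G : W p -> el p F -> el p G -> (\forall x \near p, F x = G x) ->
  exists d, path_lift W el d p p F G.
Proof.
move=> Wp Fp Gp FG; exists (fun t => (p, if t == 1 then G else F)); split.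
- by rewrite eq_sym oner_eq0.
- by rewrite eqxx.
- move=> t _ U HU; apply: filterE => s _; split; first exact: nbhs_singleton HU.
  case: ifP => _; case: ifP => _ /=; [exact: filterE| |exact: FG|exact: filterE].
  by apply: filterS FG.
- by move=> t _; split=> //=; case: ifP.
Qed.

(** Connectedness of the unit interval: the truth value of P is a locally
   constant function. *)
Lemma itv_locally_constant (P : R -> Prop) : P 0 ->
  (forall t : R, 0 <= t <= 1 -> \forall s \near t, 0 <= s <= 1 -> (P s <-> P t)) -> P 1.
Proof.
move=> P0 H.
pose c (t : R) : R := Num.max 0 (Num.min t 1).
have c01 t : 0 <= c t <= 1 by rewrite /c le_max lexx /= ge_max ler01 ge_min lexx orbT.
have cE t : 0 <= t <= 1 -> c t = t.
  by move=> /andP[t0 t1]; rewrite /c min_l// max_r.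
have cc : continuous c.
  move=> t A /nbhs_ballP[e /= e0 HA]; apply/nbhs_ballP; exists e => // s; rewrite /ball /=.
  move=> st; apply: HA; rewrite /ball /=; apply: le_lt_trans st; rewrite /c.
  have := ler_norm (t - s); have := ler_norm (s - t); rewrite (distrC s) => h1 h2.
  rewrite ler_norml !maxEle !minEle; apply/andP.
  by case: (leP t 1) => ?; case: (leP s 1) => ?; rewrite ?ler01;
    case: (leP 0 t) => ?; case: (leP 0 s) => ?; split; lra.
pose f (t : R) : R := if `[< P (c t) >] then 1 else 0.
have fd t : is_derive t (1 : R) f 0.
  have near_eq : \forall s \near t, f s = f t.
    have Hs : \forall s \near t, 0 <= c s <= 1 -> (P (c s) <-> P (c t)).
      exact: (cc t _ (H (c t) (c01 t))).
    apply: filterS Hs => s /(_ (c01 s)) e.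
    by rewrite /f (_ : `[< P (c s) >] = `[< P (c t) >])//; apply/asboolP/asboolP => /e.
  have /nbhs_ballP[r /= r0 Hr] := near_eq.
  apply: is_derive_eps => e e0; exists r => // s sr.
  have -> : f s = f t by apply: Hr; rewrite /ball /= distrC.
  by rewrite subrr mul0r subrr normr0 mulr_ge0// ltW.
have := is_derive_0_is_cst 0 1 fd.
rewrite /f !cE ?lexx ?ler01// asboolT//; case: asboolP => // _ /eqP.
by rewrite oner_eq0.
Qed.

(** Induction along a continuation, for properties of germs that are locally
   constant on the etale space. *)
Lemma lift_ind W el d p q F G (Q : S -> (S -> T) -> Prop) : path_lift W el d p q F G ->
  (forall x H, W x -> el x H -> exists2 U : set S, nbhs x U &
     forall y H', U y -> W y -> el y H' -> (\forall v \near y, H' v = H v) -> (Q y H' <-> Q x H)) ->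
  Q p F -> Q q G.
Proof.
move=> [d0 d1 dc dW] H QF.
have := @itv_locally_constant (fun t => Q (d t).1 (d t).2).
rewrite d0 d1 /=; apply=> // t t01.
have [Wt et] := dW t t01; have [U HU HQ] := H _ _ Wt et.
apply: filterS (dc t t01 U HU) => s h s01; have [h1 h2] := h s01.
have [Ws es] := dW s s01; exact: HQ.
Qed.

Lemma elementsP W el (f : multivalued R W el) q F :
  elements f q F <-> exists d, path_lift W el d (mv_base f) q (mv_germ f) F.
Proof.
split=> [[g [gp gc]]|[d /continuation_lift[? ?]]]; first exact: lift_continuation gp gc.
by exists (fun t => (d t).1).
Qed.

Lemma elements_lift W el (f : multivalued R W el) d q q' F F' :
  elements f q F -> path_lift W el d q q' F F' -> elements f q' F'.
Proof.
move=> /elementsP[d1 h1] h2; apply/elementsP; exact: lift_cat h1 h2.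
Qed.

Lemma elements_in W el (f : multivalued R W el) q F : elements f q F -> W q /\ el q F.
Proof.
move=> /elementsP[d [_ d1 _ dW]]; have := dW 1; rewrite d1 ler01 lexx; exact.
Qed.

Lemma elements_base W el (f : multivalued R W el) : elements f (mv_base f) (mv_germ f).
Proof.
have pc : path_in W (fun _ : R => mv_base f) (mv_base f) (mv_base f).
  split=> // [|t _]; last exact: mv_base_in.
  by apply/within_nearP => t _ A HA; apply: filterE => s _; exact: nbhs_singleton HA.
have [G [Ft [F0 _ FH]]] := mv_continuable pc.
have e0 : el (mv_base f) (mv_germ f).
  by have [] := FH 0 _; rewrite ?itv01 ?lexx ?ler01// F0.
have [d hd] := lift_path pc (fun t _ => e0).
by apply/elementsP; exists d.
Qed.

Lemma elements_path W el (f : multivalued R W el) (g : R -> S) q q' F :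
  elements f q F -> path_in W g q q' -> (forall t, 0 <= t <= 1 -> el (g t) F) -> elements f q' F.
Proof.
move=> fF gp H; have [d hd] := lift_path gp H; exact: elements_lift fF hd.
Qed.

Lemma elements_germ W el (f : multivalued R W el) q F F' :
  elements f q F -> el q F' -> (\forall x \near q, F x = F' x) -> elements f q F'.
Proof.
move=> fF h e; have [Wq eF] := elements_in fF.
have [d hd] := lift_germ Wq eF h e; exact: elements_lift fF hd.
Qed.

End Continuation.

(** * Complements of discrete sets are path connected *)

Section PathConnected.
Context {R : realType} {S : topologicalType} (X : riemann_surface R S).

Lemma path_cat (W : set S) (g1 g2 : R -> S) x y z : path_in W g1 x y -> path_in W g2 y z ->
  exists g : R -> S, path_in W g x z.
Proof.
pose el (_ : S) (_ : S -> unit) := True.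
move=> p1 p2.
have [d1 h1] := @lift_path R S unit W el g1 x y (fun=> tt) p1 (fun _ _ => I).
have [d2 h2] := @lift_path R S unit W el g2 y z (fun=> tt) p2 (fun _ _ => I).
have [d /continuation_lift[h _]] := lift_cat h1 h2.
by exists (fun t => (d t).1).
Qed.

Lemma path_sub (W W' : set S) (g : R -> S) x y : (forall q, W q -> W' q) ->
  path_in W g x y -> path_in W' g x y.
Proof. by move=> WW [a b c d]; split=> // t /d /WW. Qed.

(** Removing a closed discrete set does not disconnect a surface: the points
   near which everything is reachable form a clopen set, because punctured
   discs are path connected. *)
Lemma sparse_path_connected (W : set S) (x y : S) : connected [set: S] ->
  (forall p, \forall q \near p^', W q) -> W x -> W y -> exists g : R -> S, path_in W g x y.
Proof.
move=> Sc Wd Wx Wy.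
pose P q := W q -> exists g : R -> S, path_in W g x q.
have spread (p : S) : exists2 B : set S, \forall q \near p, B q &
    (forall q, B q -> nbhs q B) /\ forall q0, B q0 -> W q0 -> P q0 -> forall q, B q -> P q.
  have [i ip] := dom_cover X p.
  have [r rr H] := chart_nbhd_d ip (Wd p).
  exists (disc i p r); first exact: disc_near (disc_center ip rr.1).
  split; first by move=> q; exact: disc_near.
  move=> q0 B0 W0 P0 q Bq Wq.
  have [g0 h0] := P0 W0.
  have [Wp|nWp] := pselect (W p).
    have BW q' : disc i p r q' -> W q'.
      by move=> Bq'; have [->|/H] := pselect (q' = p); [|exact].
    by have [g /(path_sub BW) h] := disc_path rr B0 Bq; exact: path_cat h0 h.
  have qp : q <> p by move=> E; rewrite E in Wq.
  have q0p : q0 <> p by move=> E; rewrite E in W0.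
  have BW q' : (disc i p r `\ p) q' -> W q' by move=> [/H h /h].
  by have [g /(path_sub BW) h] := punctured_path ip rr B0 Bq q0p qp; exact: path_cat h0 h.
pose A : set S := [set p : S | \forall q \near p, P q].
have Ax : A x.
  have [B Bx [_ BP]] := spread x.
  have Px : P x.
    move=> _; exists (fun=> x); split=> //.
    by apply/within_nearP => t _ U HU; apply: filterE => s _; exact: nbhs_singleton HU.
  have Bxx := nbhs_singleton Bx.
  by apply: filterS Bx => q Bq; exact: (BP x Bxx Wx Px q Bq).
have Ao : open A by rewrite openE => p Ap; exact: (nbhs_interior Ap).
have Ac : closed A.
  move=> p /(_ _) Hp; have [B Bp [Bn BP]] := spread p.
  have [q [Aq Bq]] := Hp B Bp.
  have near_q : \forall v \near q^', (P v /\ B v) /\ W v.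
    have PB : \forall v \near q, P v /\ B v by apply: filterI => //; exact: Bn.
    by apply: filterI; [exact: dnbhs_near PB|exact: Wd].
  have [v _ [[Pv Bv] Wv]] := dnbhs_ex X near_q.
  by apply: filterS Bp => w Bw; exact: (BP v).
have AT : A = [set: S].
  by apply: Sc; [exists x|exists A; rewrite ?setTI|exists A; rewrite ?setTI].
have : A y by rewrite AT.
by move=> /nbhs_singleton; exact.
Qed.

End PathConnected.

Lemma scale_near (R : realType) (t s : R) (P : R -> Prop) :
  (\forall u \near t * s, P u) -> \forall s' \near s, P (t * s').
Proof.
move=> H; have tc : t * s' @[s' --> s] --> t * s by apply: cvgM; [exact: cvg_cst|exact: cvg_id].
exact: (tc _ H).
Qed.

(** Continuation along an initial part of the path, which shows that all
   intermediate function elements are elements in their own right. *)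
Lemma continuation_prefix (R : realType) (S : topologicalType) (T : Type) (W : set S)
    (el : S -> (S -> T) -> Prop) (g : R -> S) p q F G :
  path_in W g p q -> continuation el g F G -> exists Ft : R -> S -> T,
  [/\ Ft 0 = F, Ft 1 = G,
     forall t : R, 0 <= t <= 1 -> exists d : R -> S * (S -> T), path_lift W el d p (g t) F (Ft t) &
     forall t : R, 0 <= t <= 1 -> \forall s \near t, 0 <= s <= 1 -> \forall x \near g s, Ft s x = Ft t x].
Proof.
move=> [gc g0 g1 gW] [Ft [F0 F1 FH]]; exists Ft; split=> // t t01; last first.
  rewrite -itv01 in t01; have [_ H] := FH t t01.
  by apply: filterS H => s + s01; apply; rewrite itv01.
have ts s : 0 <= s <= 1 -> 0 <= t * s <= 1.
  case/andP: t01 => t0 t1 /andP[s0 s1]; rewrite mulr_ge0//=; exact: mulr_ile1.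
exists (fun s => (g (t * s), Ft (t * s))).
split; rewrite ?mulr0 ?mulr1 ?g0 ?F0// => s /ts; rewrite -itv01 => s01; last first.
  by split; [exact: gW|have [] := FH _ s01].
move=> U HU; have [_ H] := FH _ s01; have H2 := (within_nearP g).1 gc _ s01 U HU.
apply: filterS2 (scale_near H) (scale_near H2) => s' h1 h2 /ts; rewrite -itv01 => s'01; split; [exact: h2|exact: h1].
Qed.

(** The times up to which the continuation exists form a clopen set, because
   every element near a point of the path extends to a fixed neighbourhood of it. *)
Lemma continuable (R : realType) (S : topologicalType) (T : Type) (W : set S)
    (el : S -> (S -> T) -> Prop) (g : R -> S) p q F :
  (forall x, W x -> exists2 U : set S, nbhs x U & forall y H, U y -> el y H ->
     exists G, (forall y', U y' -> el y' G) /\ \forall v \near y, H v = G v) ->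
  path_in W g p q -> el p F -> exists G, continuation el g F G.
Proof.
move=> loc [gc g0 g1 gW] elF.
pose P (t : R) := exists Ft : R -> S -> T, Ft 0 = F /\ forall s, 0 <= s <= t -> el (g s) (Ft s) /\
  \forall s' \near s, 0 <= s' <= t -> \forall x \near g s', Ft s' x = Ft s x.
have P01 : P 1.
  apply: itv_locally_constant.
    exists (fun=> F); split=> // s; rewrite -eq_le => /eqP <-; rewrite g0; split=> //.
    by apply: filterE => s' _; exact: filterE.
  move=> t t01; have t01' := t01; rewrite -itv01 in t01'.
  have [U HU Uel] := loc _ (gW t t01').
  have gU := (within_nearP g).1 gc t t01' U HU.
  have /nbhs_ballP[e /= e0 He] := gU.
  have mono (s s' : R) : s <= s' -> P s' -> P s.
    move=> ss [Ft [F0 H]]; exists Ft; split=> // u /andP[u0 us].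
    have [|h1 h2] := H u; first by rewrite u0 (le_trans us).
    split=> //; apply: filterS h2 => u' h /andP[a b]; apply: h.
    by rewrite a (le_trans b).
  have step (s s' : R) : 0 <= s -> s <= s' -> s' <= 1 -> `|t - s| < e -> `|t - s'| < e -> P s -> P s'.
    move=> s0 ss' s'1 ts ts' [Ft [F0 H]].
    have gU' (u : R) : s <= u <= s' -> U (g u).
      move=> /andP[u1 u2]; apply: He; last by rewrite itv01 (le_trans s0)//= (le_trans u2).
      by rewrite /ball /=; move: ts ts'; rewrite !ltr_norml => /andP[? ?] /andP[? ?]; apply/andP; split; lra.
    have s1 : 0 <= s <= s by rewrite s0 lexx.
    have s2 : s <= s <= s' by rewrite lexx.
    have [es Hs] := H s s1; have [G [GU GE]] := Uel _ _ (gU' s s2) es.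
    have gs : s \in `[0, 1]%R by rewrite itv01 s0 (le_trans ss').
    have GE' := (within_nearP g).1 gc s gs _ (nbhs_interior GE).
    (* the two pieces agree near g s, which is what continuity at time s requires *)
    exists (fun u => if u <= s then Ft u else G); split; first by rewrite s0.
    move=> u /andP[u0 us']; have [us|us] := leP u s.
      have [|eu Hu] := H u; first by rewrite u0.
      split=> //; case: (ltP u s) => us2.
        apply: filterS2 Hu (near_ltR us2) => v h vs /andP[v0 _].
        by rewrite (ltW vs); apply: h; rewrite v0 ltW.
      have uE : u = s by apply/eqP; rewrite eq_le us us2.
      rewrite uE in Hu *; apply: filterS2 Hu GE' => v h1 h2 /andP[v0 vs'].
      case: (leP v s) => vs; first by apply: h1; rewrite v0.
      have v01 : v \in `[0, 1]%R by rewrite itv01 v0 (le_trans vs').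
      by apply: filterS (h2 v01) => x ->.
    split; first by apply: GU; apply: gU'; rewrite (ltW us).
    apply: filterS (near_gtR us) => v sv _; rewrite leNgt sv /=; exact: filterE.
  apply/nbhs_ballP; exists e => //= s; rewrite /ball /= => ts /andP[s0 s1].
  have /andP[t0 t1] := t01; have tt : `|t - t| < e by rewrite subrr normr0.
  have [st|st] := leP s t.
    by split; [exact: step|exact: mono].
  by split; [apply: mono; exact: ltW|apply: step => //; exact: ltW].
have [Ft [F0 H]] := P01; by exists (Ft 1), Ft; split.
Qed.

(** The factor C read off at time t is locally constant in t, whatever the
   exponent E; comparing E at the two ends then gives the monodromy. *)
Lemma path_constant (R : realType) (S : topologicalType) (W : set S)
    (el : S -> (S -> sphere R) -> Prop) (g : R -> S) p q F G (E : R -> Cx R) :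
  path_in W g p q -> continuation el g F G ->
  (forall (t : R) (H : S -> sphere R) (d : R -> S * (S -> sphere R)), 0 <= t <= 1 -> path_lift W el d p (g t) F H -> exists C : Cx R, \forall s \near t, 0 <= s <= 1 ->
     H (g s) = Some (C * cexp (E s))) ->
  exists C, F p = Some (C * cexp (E 0)) /\ G q = Some (C * cexp (E 1)).
Proof.
move=> gp gc HE; have [Ft [F0 F1 Fl Fn]] := continuation_prefix gp gc.
have [gcont g0 g1 gW] := gp.
have h01 : 0 <= (0 : R) <= 1 by rewrite lexx ler01.
have [d0 l0] := Fl 0 h01; have [C HC] := HE 0 _ _ h01 l0; exists C.
have C0 := nbhs_singleton HC h01; rewrite -F0 -F1 -g0 -g1; split; first exact: C0.
apply: (@itv_locally_constant R (fun t => Ft t (g t) = Some (C * cexp (E t)))); first exact: C0.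
move=> t t01; have [d l] := Fl t t01; have [Ct HCt] := HE t _ _ t01 l.
have Ct0 := nbhs_singleton HCt t01.
apply: filterS2 (Fn t t01) HCt => s h1 h2 s01.
rewrite (nbhs_singleton (h1 s01)) (h2 s01) Ct0.
by split=> -[] /(mulIf (cexp_neq0 _)) ->.
Qed.

(** * Divisors as sums *)

Section DivisorSums.
Context {R : realType} {S : eqType} {N : nat}.

Lemma sum_at (x : 'I_N -> S) (P : pred 'I_N) (F : 'I_N -> R) j : injective x ->
  \sum_(k < N | P k) F k * (x k == x j)%:R = (P j)%:R * F j.
Proof.
move=> xi; rewrite big_mkcond (bigD1 j)//= big1 => [|k kj]; last first.
  by rewrite (inj_eq xi) (negbTE kj) mulr0 if_same.
by rewrite eqxx mulr1 addr0; case: (P j); rewrite ?mul1r ?mul0r.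
Qed.

Lemma sum_out (x : 'I_N -> S) (P : pred 'I_N) (F : 'I_N -> R) p : (forall j, x j <> p) ->
  \sum_(k < N | P k) F k * (x k == p)%:R = 0.
Proof. by move=> H; apply: big1 => k _; have /eqP/negbTE -> := H k; rewrite mulr0. Qed.

Lemma sum_mul1 (x : 'I_N -> S) (P : pred 'I_N) p :
  \sum_(k < N | P k) (x k == p)%:R = \sum_(k < N | P k) 1 * (x k == p)%:R :> R.
Proof. by apply: eq_bigr => k _; rewrite mul1r. Qed.

End DivisorSums.

(** * Meromorphic functions and function elements *)

Section Meromorphic.
Context {R : realType}.
Implicit Types (F : Cx R -> sphere R) (z : Cx R).

Lemma meromorphic_fin F z0 c : meromorphic_at F z0 -> F z0 = Some c ->
  exists2 h, holomorphic_at h z0 & \forall z \near z0, F z = Some (h z).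
Proof.
move=> [h [hh [FE|[FE hn]]]] F0; first by exists h.
have := nbhs_singleton FE; rewrite F0 /=; case: eqVneq => // h0 _.
exists (fun z => (h z)^-1); first exact: holV.
have hne := cont_neq0 (hol_cont hh) h0.
by apply: filterS2 FE hne => z -> /= /negbTE ->.
Qed.

Lemma meromorphic_punctured F z0 : meromorphic_at F z0 -> \forall z \near z0^', F z <> None.
Proof.
move=> [h [hh [FE|[FE hn]]]].
  by apply: filterS (near_dnbhs_cx FE) => z ->.
by apply: filterS2 (near_dnbhs_cx FE) hn => z -> /= /negbTE ->.
Qed.

Lemma meromorphic_near F z0 : meromorphic_at F z0 -> \forall z \near z0, meromorphic_at F z.
Proof.
move=> [h [hh [FE|[FE hn]]]].
  by apply: filterS2 (nbhs_interior FE) (nbhs_interior hh) => z e hz; exists h; split; [exact: hz|left; exact: e].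
have /near_punctured/nbhs_interior hn2 := hn.
apply: filterS3 (nbhs_interior FE) (nbhs_interior hh) hn2 => z e hz hn'.
exists h; split; [exact: hz|right; split; [exact: e|]].
have [->|zz0] := eqVneq z z0; first exact: hn.
have zz : \forall w \near z, w != z0.
  apply/nbhs_cxP; exists (cmod (z - z0)); first by rewrite cmod_gt0 subr_eq0.
  by move=> w; apply: contraTneq => ->; rewrite cmodBC ltxx.
by apply: near_dnbhs_cx; apply: filterS2 zz hn' => w h1 h2; exact: h2.
Qed.

Lemma meromorphic_comp F (t : Cx R -> Cx R) z0 : holomorphic_at t z0 ->
  (\forall z \near z0^', t z != t z0) -> meromorphic_at F (t z0) ->
  meromorphic_at (fun z => F (t z)) z0.
Proof.
move=> th tn [h [hh HF]].
have tc := hol_cont th.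
have pull (P : Cx R -> Prop) : (\forall w \near t z0, P w) -> \forall z \near z0, P (t z).
  exact: cont_near.
exists (fun z => h (t z)); split.
  apply: (@hol_cder _ _ (fun z => derive1 h (t z) * derive1 t z)).
  by apply: filterS2 (near_cder th) (pull _ (near_cder hh)) => z d1 d2; exact: (cder_comp d1 d2).
case: HF => [FE|[FE hn]]; [left; exact: (pull _ FE)|right; split; first exact: (pull _ FE)].
have /near_punctured/pull hn2 := hn.
by apply: filterS2 tn (near_dnbhs_cx hn2) => z h1; exact.
Qed.

Lemma ln_bounded (h : Cx R -> Cx R) z0 : {for z0, continuous h} -> h z0 != 0 ->
  exists C : R, \forall z \near z0, `|ln (cmod (h z))| <= C.
Proof.
move=> hc h0; have c0 : 0 < cmod (h z0) by rewrite cmod_gt0.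
have c2 : 0 < cmod (h z0) / 2 by rewrite divr_gt0.
have [d d0 Hd] := (cont_cxP _ _).1 hc _ c2.
exists (Num.max `|ln (cmod (h z0) / 2)| `|ln (2 * cmod (h z0))|).
apply/nbhs_cxP; exists d => // z /Hd zd.
have a1 : cmod (h z0) / 2 <= cmod (h z).
  by have := cmod_le_add (h z0) (h z); rewrite (cmodBC (h z0)); lra.
have a2 : cmod (h z) <= 2 * cmod (h z0).
  by have := cmod_le_add (h z) (h z0); lra.
have hz0 : 0 < cmod (h z) by exact: lt_le_trans a1.
have l1 : ln (cmod (h z0) / 2) <= ln (cmod (h z)) by rewrite ler_ln ?posrE.
have l2 : ln (cmod (h z)) <= ln (2 * cmod (h z0)) by rewrite ler_ln ?posrE// mulr_gt0.
move: l1 l2; move: (ln _) (ln _) (ln _) => x y v xy yv.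
rewrite le_max; have [y0|y0] := leP 0 y.
  by rewrite (ger0_norm y0) (le_trans yv (ler_norm x)) orbT.
rewrite (ltr0_norm y0) -(normrN v) (le_trans _ (ler_norm (- v)))//.
by rewrite lerN2.
Qed.

End Meromorphic.

Section SurfaceMeromorphic.
Context {R : realType} {S : topologicalType} (X : riemann_surface R S).

Lemma trans_punctured (i j : chart X) p : dom i p -> dom j p ->
  \forall z \near (zcoord i p)^', (zcoord j \o param i) z != (zcoord j \o param i) (zcoord i p).
Proof.
move=> ip jp.
have dj : \forall q \near p, dom j q by apply: open_nbhs_nbhs; split=> //; exact: dom_open.
have : \forall q \near p^', zcoord j q != zcoord j p.
  apply/near_punctured; apply: filterS dj => q jq; apply: contra_neq.
  exact: zcoord_inj.
by move=> /(near_chart_d _ ip) H; rewrite /= zcoordK.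
Qed.

Lemma meromorphic_trans (i j : chart X) p (F : S -> sphere R) : dom i p -> dom j p ->
  meromorphic_at (F \o param j) (zcoord j p) -> meromorphic_at (F \o param i) (zcoord i p).
Proof.
move=> ip jp Fm.
have E0 : (zcoord j \o param i) (zcoord i p) = zcoord j p by rewrite /= zcoordK.
rewrite -E0 in Fm.
have [h [hh H]] := meromorphic_comp (trans_hol ip jp) (trans_punctured ip jp) Fm.
exists h; split; first exact: hh.
have dj : \forall q \near p, dom j q by apply: open_nbhs_nbhs; split=> //; exact: dom_open.
have e : \forall z \near zcoord i p, (F \o param i) z = (F \o param j) ((zcoord j \o param i) z).
  by move/(near_chart _ ip): dj; apply: filterS => z jz /=; rewrite zcoordK.
case: H => [H|[H hn]]; [left|right; split; last exact: hn]; by apply: filterS2 e H => z -> ->.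
Qed.

Lemma near_zcoord (i : chart X) p (P : Cx R -> Prop) : dom i p ->
  (\forall z \near zcoord i p, P z) -> \forall q \near p, P (zcoord i q).
Proof. by move=> ip H; exact: (zcoord_continuous ip H). Qed.

Lemma univalent_near p (F : S -> sphere R) : univalent_element X p F ->
  \forall q \near p, univalent_element X q F.
Proof.
move=> [Fm [U [Up UF]]]; have [i ip] := dom_cover X p.
have di : \forall q \near p, dom i q by apply: open_nbhs_nbhs; split=> //; exact: dom_open.
have m1 : \forall q \near p, meromorphic_at (F \o param i) (zcoord i q).
  exact: (near_zcoord (P := fun z => meromorphic_at (F \o param i) z) ip (meromorphic_near (Fm i ip))).
apply: filterS3 (nbhs_interior Up) di m1 => q Uq iq mq; split; last by exists U.
by move=> j jq; exact: meromorphic_trans mq.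
Qed.

Lemma elements_near (W : set S) (f : multivalued R W (univalent_element X)) q F :
  (\forall q' \near q, W q') -> elements f q F -> \forall q' \near q, elements f q' F.
Proof.
move=> Wq fF; have [_ Fq] := elements_in fF.
have [i iq] := dom_cover X q.
have H : \forall q' \near q, W q' /\ univalent_element X q' F.
  by apply: filterI => //; exact: univalent_near.
have [r rr HB] := chart_nbhd iq H.
apply: filterS (disc_near (disc_center iq rr.1)) => q' Bq'.
have [g hg] := disc_path rr (disc_center iq rr.1) Bq'.
have gW : path_in W g q q' by apply: path_sub hg => x /HB[].
apply: elements_path fF gW _ => t t01.
have [_ _ _ hB] := hg; have : disc i q r (g t) by apply: hB; rewrite itv01.
by move=> /HB[].
Qed.

End SurfaceMeromorphic.

(** * The height function of the sphere *)

Section Height.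
Context {R : realType}.
Implicit Types (w : sphere R) (c : Cx R).

Lemma height_Some c : height (Some c) = 4 * cmod c ^+ 2 / (1 + cmod c ^+ 2).
Proof. by []. Qed.

Lemma den_gt0 c : 0 < 1 + cmod c ^+ 2.
Proof. by rewrite ltr_wpDr// sqr_ge0. Qed.

Lemma heightC c : 4 - height (Some c) = 4 / (1 + cmod c ^+ 2).
Proof. by rewrite height_Some; field; rewrite gt_eqF// den_gt0. Qed.

Lemma height_ge0 w : 0 <= height w.
Proof.
case: w => [c|] //; rewrite height_Some divr_ge0 ?(ltW (den_gt0 c))//.
by rewrite mulr_ge0// sqr_ge0.
Qed.

Lemma height_le4 w : height w <= 4.
Proof.
case: w => [c|] //=; rewrite -subr_ge0 heightC divr_ge0 ?(ltW (den_gt0 c))//.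
Qed.

Lemma height_eq0 w : height w = 0 -> w = Some 0.
Proof.
case: w => [c|/eqP] /=; last by rewrite pnatr_eq0.
move=> /eqP; rewrite mulf_eq0 invr_eq0 (gt_eqF (den_gt0 c)) orbF mulf_eq0 pnatr_eq0 /=.
by rewrite sqrf_eq0 cmod_eq0 => /eqP ->.
Qed.

Lemma height0 : height (Some (0 : Cx R)) = 0.
Proof. by rewrite height_Some cmod0 expr0n mulr0 mul0r. Qed.

Lemma height_eq4 w : height w = 4 -> w = None.
Proof.
case: w => [c|] // H; have := heightC c; rewrite H subrr => /esym/eqP.
by rewrite mulf_eq0 invr_eq0 (gt_eqF (den_gt0 c)) pnatr_eq0.
Qed.

Lemma height_mid w : 0 < height w < 4 -> exists2 c, c != 0 & w = Some c.
Proof.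
case: w => [c|] /andP[h0 h4]; last by rewrite /= ltxx in h4.
exists c => //; apply: contraTneq h0 => ->; by rewrite height0 ltxx.
Qed.

Lemma height_ratio c : height (Some c) / (4 - height (Some c)) = cmod c ^+ 2.
Proof. by rewrite heightC height_Some; field; rewrite gt_eqF// den_gt0. Qed.

Lemma height_form c : height (Some c) * (4 - height (Some c)) / 4 = 4 * cmod c ^+ 2 / (1 + cmod c ^+ 2) ^+ 2.
Proof. by rewrite heightC height_Some; field; rewrite gt_eqF// den_gt0. Qed.

(** If x is the height of w, this is ln |w|^2. *)
Definition logit (x : R) : R := ln (x / (4 - x)).

Lemma expR_logit x : 0 < x < 4 -> expR (logit x) = x / (4 - x).
Proof. by move=> /andP[x0 x4]; rewrite lnK// posrE divr_gt0// subr_gt0. Qed.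

Lemma logitK x : 0 < x < 4 -> x = 4 * expR (logit x) / (1 + expR (logit x)).
Proof.
move=> x04; rewrite expR_logit//; case/andP: x04 => x0 x4; field.
by rewrite gt_eqF//=; lra.
Qed.

Lemma logit_logistic x : logit (4 * expR x / (1 + expR x)) = x.
Proof.
have e0 := expR_gt0 x; rewrite /logit -[RHS]expRK; congr ln.
field; rewrite mulrDr mulr1 addrK pnatr_eq0 /= gt_eqF//; lra.
Qed.

(** The right-hand side splits the conformal factor x (4 - x) / 4 into
   terms linear in the logit and a bounded correction; see log_softmax. *)
Lemma logit_form x : 0 < x < 4 -> ln (x * (4 - x) / 4) = ln 4 + logit x - 2 * ln (1 + expR (logit x)).
Proof.
move=> x04; rewrite {1 2}(logitK x04); set e := expR _.
have e0 : 0 < e by exact: expR_gt0.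
have -> : 4 * e / (1 + e) * (4 - 4 * e / (1 + e)) / 4 = 4 * e / (1 + e) ^+ 2.
  by field; rewrite gt_eqF//; lra.
have e1 : 0 < 1 + e by lra.
rewrite ln_div ?posrE ?mulr_gt0 ?exprn_gt0// lnM ?posrE// lnXn//.
rewrite /e expRK; ring.
Qed.

End Height.

(** The half plane of logarithms is convex; functions on a punctured disc that
   are only locally defined become constants there. *)
Lemma halfplane_cst (R : realType) (T : Type) (U : Cx R -> T) (a : R) (l1 l2 : Cx R) :
  (forall l, re l < a -> \forall l' \near l, U l' = U l) -> re l1 < a -> re l2 < a ->
  U l2 = U l1.
Proof.
move=> H h1 h2; rewrite -(seg1 l2 l1).
apply: (@itv_locally_constant R (fun t => U (seg l1 l2 t) = U l1)); first by rewrite seg0.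
move=> t /andP[t0 t1].
have ha : re (seg l1 l2 t) < a.
  rewrite /seg reD reM reB imB re_cpair im_cpair mul0r subr0.
  have -> : re l1 + t * (re l2 - re l1) = (1 - t) * re l1 + t * re l2 by ring.
  have [->|tn] := eqVneq t 0; first by rewrite subr0 mul1r mul0r addr0.
  have t' : 0 < t by rewrite lt_neqAle eq_sym tn.
  have k1 : (1 - t) * re l1 <= (1 - t) * a by rewrite ler_wpM2l ?subr_ge0// ltW.
  have k2 : t * re l2 < t * a by rewrite ltr_pM2l.
  by apply: lt_le_trans (ler_ltD k1 k2) _; rewrite -mulrDl subrK mul1r.
have E : \forall s \near t, U (seg l1 l2 s) = U (seg l1 l2 t) by exact: (seg_continuous (H _ ha)).
by apply: filterS E => s -> _.
Qed.

Section FormPrimitive.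
Context {R : realType}.

(** The two signs of m are primitive_pow and primitive_neg; c is the residue. *)
Lemma form_primitive (h : Cx R -> Cx R) z0 (m : int) : holomorphic_at h z0 -> h z0 != 0 ->
  exists c K, [/\ holomorphic_at K z0,
    \forall z \near z0^', cder (fun w => (w - z0) ^ (m + 1) * K w) z ((z - z0) ^ m * h z - c / (z - z0)),
    0 <= m -> [/\ c = 0, K z0 != 0 &
      \forall z \near z0, cder (fun w => (w - z0) ^ (m + 1) * K w) z ((z - z0) ^ m * h z)],
    m = -1 -> c = h z0 & m + 1 < 0 -> K z0 != 0].
Proof.
move=> hh h0; case: m => k.
  have [K [Kh K0 KE]] := primitive_pow k hh.
  have E : k%:Z + 1 = k.+1 by rewrite -PoszD addn1.
  exists 0, K; rewrite E; split=> // [|_].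
  - by apply: filterS (near_dnbhs_cx KE) => z H; rewrite mul0r subr0.
  - by split=> //; apply: contra_neq h0 => K00; rewrite -K0 K00 mulr0.
have [c [K [Kh K1 K2 KE]]] := primitive_neg k hh.
have E (z : Cx R) : z ^ (Negz k + 1) = (z ^+ k)^-1.
  by rewrite NegzE -(addn1 k) PoszD opprD addrK -invr_expz.
have E' (z : Cx R) : z ^ Negz k = (z ^+ k.+1)^-1 by [].
exists c, K; split=> //.
- apply: filterS KE => z H; rewrite E'.
  by apply: (cder_eq H _ erefl); apply: filterE => w; rewrite E.
- by rewrite NegzE => H; apply: K2; case: k H {K1 KE E E'} => // k.
- case: k K1 {K2 KE E E'} => [|k] K1; first by [].
  move=> _; apply: contra_neq h0 => K0; have := K1 isT.
  by rewrite K0 mulr0 => /esym/eqP; rewrite oppr_eq0 => /eqP.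
Qed.

End FormPrimitive.

Lemma bounded_near (R : realType) (u : Cx R -> R) z0 : {for z0, continuous u} ->
  exists C : R, \forall z \near z0, `|u z| <= C.
Proof.
move=> /contR_cxP/(_ 1 ltr01)[d d0 Hd]; exists (`|u z0| + 1); apply/nbhs_cxP; exists d => // z /Hd zd.
by rewrite -(subrKC (u z0) (u z)); apply: le_trans (ler_normD _ _) _; rewrite lerD2l ltW.
Qed.

(** * Growth estimates *)

Section Asymptotics.
Context {R : realType}.
Implicit Types (x y B C : R).

(** The function x - 2 ln (1 + e^x) is even and equals - |x| up to a bounded
   error: this is how the poles and the zeros of f enter symmetrically. *)
Lemma log_softmax x : `|x - 2 * ln (1 + expR x) + `|x| | <= 2 * ln 2.
Proof.
wlog x0 : x / 0 <= x => [H|].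
  have [/H//|x0] := leP 0 x; have := H (- x) _; rewrite oppr_ge0 => /(_ (ltW x0)).
  have -> : ln (1 + expR (- x)) = ln (1 + expR x) - x.
    have e0 := expR_gt0 x.
    rewrite -[X in _ = _ - X]expRK -ln_div ?posrE ?addr_gt0//; congr ln.
    by rewrite expRN; field; rewrite gt_eqF.
  by rewrite normrN; congr (`| _ | <= _); ring.
have e0 := expR_gt0 x.
have e1 : 1 <= expR x by rewrite -expR0 ler_expR.
have -> : ln (1 + expR x) = x + ln (1 + expR (- x)).
  rewrite -{2}(expRK x) -lnM ?posrE ?addr_gt0 ?expR_gt0//; congr ln.
  by rewrite expRN; field; rewrite gt_eqF.
have k1 : 0 <= ln (1 + expR (- x)) by rewrite ln_ge0// lerDl ltW// expR_gt0.
have k2 : ln (1 + expR (- x)) <= ln 2.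
  rewrite ler_ln ?posrE ?addr_gt0 ?expR_gt0// lerD2l -expR0 ler_expR; lra.
rewrite (ger0_norm x0) ler_norml; apply/andP; split; lra.
Qed.

(** With y = - ln t, this is e^y >= 1 + y^2 / 2 against a linear function of y. *)
Lemma inv_beats_log x B : exists2 d : R, 0 < d & forall t, 0 < t < d -> B <= t^-1 / 2 + x * ln t.
Proof.
pose Y := 4 * (`|x| + `|B|) + 1.
have Y1 : 1 <= Y by rewrite lerDr mulr_ge0// addr_ge0.
exists (expR (- Y)) => [|t /andP[t0 td]]; first exact: expR_gt0.
pose y := - ln t.
have yY : Y <= y by rewrite /y lerNr -(expRK (- Y)) ler_ln ?posrE ?expR_gt0// ltW.
have y0 : 0 <= y by apply: le_trans yY; lra.
have -> : t^-1 = expR y by rewrite expRN lnK.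
have := expR_ge1Dxn 1 y0; rewrite (_ : 2`!%:R = 2 :> R)// => e.
have -> : ln t = - y by rewrite /y opprK.
have x1 := ler_norm x; have B1 := ler_norm B.
have nx := normr_ge0 x; have nB := normr_ge0 B.
have xy : x * y <= `|x| * y by rewrite ler_wpM2r.
have yy : (4 * (`|x| + `|B|) + 1) * y <= y ^+ 2 by rewrite expr2 ler_wpM2r.
have By : `|B| <= `|B| * y by rewrite ler_peMr//; lra.
nra.
Qed.

Lemma ray_bound (T1 T2 x0 l l' s c c0 B : R) : T2 <= T1 ->
  (B - s * c0 - 2 * (s * c) * l') / 2 <= T2 / 2 + 2 * (s * c) / 2 * l -> T1 / 2 <= s * x0 ->
  B <= s * (2 * x0 + 2 * c * (l + l') + c0).
Proof.
move=> h1 h2 h3.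
rewrite (_ : s * _ = 2 * (s * x0) + 2 * (s * c * l) + 2 * (s * c) * l' + s * c0); last by ring.
have e : 2 * (s * c) / 2 * l = s * c * l by field.
rewrite e in h2; move: h2 h3; move: (s * c * l) (2 * (s * c) * l') (s * x0) (s * c0) => *; lra.
Qed.

Lemma affine_continuous (a b : R) : continuous (fun x : R => a * x + b).
Proof.
by move=> x; apply: cvgD; [apply: cvgM; [exact: cvg_cst|exact: cvg_id]|exact: cvg_cst].
Qed.

Lemma logistic_continuous : continuous (fun x : R => 4 * expR x / (1 + expR x)).
Proof.
move=> x; have e1 : 1 + expR x != 0 by rewrite gt_eqF// addr_gt0// expR_gt0.
have ec : expR y @[y --> x] --> expR x := @continuous_expR R x.
apply: cvgM; first by apply: cvgM; [exact: cvg_cst|exact: ec].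
by apply: cvgV => //; apply: cvgD; [exact: cvg_cst|exact: ec].
Qed.

End Asymptotics.

(** * Real differentials *)

Section RealDifferentials.
Context {R : realType}.

Lemma derivable_lipschitz (phi : R -> R) (t : R) : derivable phi t 1 ->
  exists2 C : R, 0 < C & exists2 d : R, 0 < d & forall s, `|s - t| < d -> `|phi s - phi t| <= C * `|s - t|.
Proof.
rewrite /derivable => dF.
have /cvgrPdist_lt/(_ _ ltr01)/nbhs_ballP[d d0 Hd] := dF.
set l := lim _ in Hd *.
exists (`|l| + 1); first by rewrite ltr_wpDl.
exists d => // s sd.
have [->|st] := eqVneq s t; first by rewrite !subrr normr0 mulr0.
have st0 : s - t != 0 by rewrite subr_eq0.
have : `|l - (s - t)^-1 * (phi s - phi t)| < 1.
  have := Hd (s - t); rewrite /ball /= sub0r normrN => /(_ sd st0).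
  by rewrite /GRing.scale /= mulr1 subrK.
move=> K; rewrite (_ : phi s - phi t = (s - t) * ((s - t)^-1 * (phi s - phi t))); last by field.
rewrite normrM mulrC ler_wpM2r//.
rewrite -(subrKC l (_ * _)); apply: le_trans (ler_normD _ _) _.
by rewrite lerD2l distrC ltW.
Qed.

Lemma derivable_logit (x : R) : 0 < x < 4 -> derivable (fun x : R => ln x - ln (4 - x)) x 1.
Proof.
move=> /andP[x0 x4]; have y0 : 0 < 4 - x by rewrite subr_gt0.
have d1 := is_derive1_ln x0; have d2 := is_derive1_ln y0.
have d3 : is_derive x (1 : R) (fun x : R => 4 - x) (0 - 1) by exact: is_deriveB.
have d4 := is_derive1_comp (f := @ln R) (g := fun x : R => 4 - x) d2 d3.
exact: (@ex_derive _ _ _ _ _ _ _ (is_deriveB d1 d4)).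
Qed.

Lemma derivable_logistic (x : R) : derivable (fun x : R => 4 * expR x / (1 + expR x)) x 1.
Proof.
have e1 : 1 + expR x != 0 by rewrite gt_eqF// addr_gt0// expR_gt0.
apply: derivableM; first by apply: derivableM => //; exact: derivable_cst.
by apply: derivableV => //; apply: derivableD => //; exact: derivable_cst.
Qed.

(** Real differentiability with differential Re (a dz), in epsilon form. *)
Definition rdiff (u : Cx R -> R) (z0 a : Cx R) : Prop := forall e : R, 0 < e ->
  exists2 d : R, 0 < d & forall z, cmod (z - z0) < d ->
    `|u z - u z0 - re (a * (z - z0))| <= e * cmod (z - z0).

Lemma rdiffP (u : Cx R -> R) z0 a : rdiff u z0 a <->
  (fun z => (u z - u z0 - re (a * (z - z0))) / cmod (z - z0)) @ z0^' --> (0 : R).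
Proof.
split=> [H|/cvgrPdist_lt H e e0].
  apply/cvgrPdist_lt => e e0; have e2 : 0 < e / 2 by rewrite divr_gt0.
  have [d d0 Hd] := H _ e2; apply/dnbhs_cxP; exists d => // z zn zd.
  have c0 : 0 < cmod (z - z0) by rewrite cmod_gt0 subr_eq0.
  rewrite sub0r normrN normrM (gtr0_norm (_ : 0 < (cmod _)^-1)) ?invr_gt0//.
  rewrite ltr_pdivrMr//; apply: le_lt_trans (Hd _ zd) _.
  by rewrite ltr_pM2r// ltr_pdivrMr// ltr_pMr// ltr1n.
have [d d0 Hd] := (dnbhs_cxP _ _).1 (H e e0); exists d => // z zd.
have [->|zn] := eqVneq z z0.
  by rewrite !subrr mulr0 sub0r normrN (_ : re 0 = 0 :> R)// normr0 cmod0 mulr0.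
have c0 : 0 < cmod (z - z0) by rewrite cmod_gt0 subr_eq0.
have := Hd _ zn zd; rewrite sub0r normrN normrM (gtr0_norm (_ : 0 < (cmod _)^-1)) ?invr_gt0//.
by rewrite ltr_pdivrMr// => /ltW.
Qed.

(** The two differentials are compared in the direction of the conjugate of
   a - b. *)
Lemma rdiff_uniq (u : Cx R -> R) z0 a b : rdiff u z0 a -> rdiff u z0 b -> a = b.
Proof.
move=> Ha Hb; apply/eqP; rewrite -subr_eq0; apply: contraT => n0.
set c := a - b in n0; have c0 : 0 < cmod c by rewrite cmod_gt0.
have e0 : 0 < cmod c / 4 by rewrite divr_gt0.
have [d1 d10 H1] := Ha _ e0; have [d2 d20 H2] := Hb _ e0.
pose v := cpair (re c) (- im c).
have cv : cmod v = cmod c.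
  apply/eqP; rewrite -(@eqrXn2 _ 2) ?cmod_ge0// !cmod_sqr /v re_cpair im_cpair sqrrN; exact/eqP.
have m0 : 0 < Num.min d1 d2 by rewrite lt_min d10.
pose t := Num.min d1 d2 / (2 * cmod c).
have t0 : 0 < t by rewrite divr_gt0// mulr_gt0.
have tm : t * cmod c < Num.min d1 d2.
  rewrite /t; move: (Num.min d1 d2) m0 => m m0.
  have -> : m / (2 * cmod c) * cmod c = m / 2 by field; rewrite gt_eqF.
  lra.
pose z := z0 + cpair t 0 * v.
have zE : z - z0 = cpair t 0 * v by rewrite /z addrAC subrr add0r.
have zc : cmod (z - z0) = t * cmod c by rewrite zE cmodM cmod_pair0 gtr0_norm// cv.
move: tm; rewrite lt_min -zc => /andP[/H1 k1 /H2 k2].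
have E : re (a * (z - z0)) - re (b * (z - z0)) = t * cmod c ^+ 2.
  by rewrite -reB -mulrBl -/c zE cmod_sqr (reM c) (reM (cpair t 0)) (imM (cpair t 0)) /v !re_cpair !im_cpair; ring.
have : t * cmod c ^+ 2 <= 2 * (cmod c / 4 * cmod (z - z0)).
  rewrite -E; apply: le_trans (ler_norm _) _.
  set A := re _ in k1 *; set B := re _ in k2 *; set U := u z - u z0 in k1 k2.
  have -> : A - B = (U - B) - (U - A) by ring.
  by apply: le_trans (ler_normB _ _) _; move: k1 k2; lra.
rewrite zc => k3; have : 0 < t * cmod c ^+ 2 by rewrite mulr_gt0// exprn_gt0.
move: k3; rewrite expr2; set x := t * (_ * _); have -> : cmod c / 4 * (t * cmod c) = x / 4.
  by rewrite /x; field.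
lra.
Qed.

(** Critical points are preserved by composition with a differentiable
   function, since such a function is Lipschitz near the point. *)
Lemma rdiff0_comp (u : Cx R -> R) (phi : R -> R) z0 : rdiff u z0 0 ->
  derivable phi (u z0) 1 -> rdiff (fun z => phi (u z)) z0 0.
Proof.
move=> Hu /derivable_lipschitz[C C0 [d d0 Hd]] e e0.
have m0 : 0 < Num.min (e / C) d by rewrite lt_min d0 divr_gt0.
have [d1 d10 H1] := Hu _ m0.
exists (Num.min d1 1) => [|z]; first by rewrite lt_min d10 ltr01.
rewrite lt_min => /andP[z1 z2]; have := H1 _ z1.
rewrite !mul0r (_ : re 0 = 0 :> R)// !subr0 => k.
have c0 := cmod_ge0 (z - z0).
have k1 : `|u z - u z0| <= e / C * cmod (z - z0).
  by apply: le_trans k _; rewrite ler_wpM2r// ge_min lexx.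
have k2 : `|u z - u z0| < d.
  apply: (le_lt_trans k); apply: (@le_lt_trans _ _ (d * cmod (z - z0))).
    by rewrite ler_wpM2r// ge_min lexx orbT.
  by rewrite gtr_pMr.
apply: le_trans (Hd _ k2) _; rewrite mulrC -ler_pdivlMr//.
by rewrite mulrAC.
Qed.

Lemma rdiff_near (u v : Cx R -> R) z0 a : (\forall z \near z0, u z = v z) -> rdiff u z0 a -> rdiff v z0 a.
Proof.
move=> E H e e0; have [d d0 Hd] := H e e0; have E0 := nbhs_singleton E.
have [d' d'0 Hd'] := (nbhs_cxP _ _).1 E.
exists (Num.min d d') => [|z]; first by rewrite lt_min d0.
by rewrite lt_min => /andP[/Hd k /Hd' <-]; rewrite -E0.
Qed.

Lemma rdiff_cder (V : Cx R -> Cx R) z0 a (k : R) : cder V z0 a ->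
  rdiff (fun z => 2 * re (V z) + k) z0 (2 * a).
Proof.
move=> H e e0; have e2 : 0 < e / 2 by rewrite divr_gt0.
have [d d0 Hd] := H _ e2; exists d => // z /Hd zd.
have -> : 2 * re (V z) + k - (2 * re (V z0) + k) - re (2 * a * (z - z0))
   = 2 * re (V z - V z0 - a * (z - z0)).
  have -> : 2 * a * (z - z0) = a * (z - z0) + a * (z - z0) by ring.
  by rewrite !reB reD; ring.
rewrite normrM ger0_norm//.
by have := cmod_re (V z - V z0 - a * (z - z0)); move: zd; lra.
Qed.

End RealDifferentials.

(** Removable singularities: a meromorphic germ that is finite and continuous
   nearby takes the expected value at the centre. *)
Lemma meromorphic_hol_value (R : realType) (F : Cx R -> sphere R) z0 (v : Cx R -> Cx R) :
  meromorphic_at F z0 -> {for z0, continuous v} -> (\forall z \near z0^', F z = Some (v z)) ->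
  F z0 = Some (v z0).
Proof.
move=> [h [hh [FE|[FE hn]]]] vc Fv.
  rewrite (nbhs_singleton FE); congr Some; apply: punctured_eq (hol_cont hh) vc _.
  by apply: filterS2 (near_dnbhs_cx FE) Fv => z -> [].
have E : \forall z \near z0^', h z * v z = 1.
  apply: filterS3 (near_dnbhs_cx FE) Fv hn => z -> /= + h0; rewrite (negbTE h0) => -[<-].
  by rewrite divff.
have E0 : h z0 * v z0 = 1.
  by apply: (punctured_eq (contM_cx (hol_cont hh) vc) (hol_cont (hol_cst 1 z0)) E).
have h0 : h z0 != 0 by apply: contra_eq_neq E0 => ->; rewrite mul0r eq_sym oner_eq0.
rewrite (nbhs_singleton FE) /= (negbTE h0); congr Some.
by rewrite -[LHS]mulr1 -E0 mulKf.
Qed.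

Lemma residue_simple (R : realType) (F : Cx R -> sphere R) z0 (h : Cx R -> Cx R) :
  holomorphic_at h z0 -> (\forall z \near z0^', F z = Some ((z - z0) ^ (-1) * h z)) ->
  residue_at F z0 (h z0).
Proof.
move=> hh HF; exists (h z0 *: 'X), (dquot h z0); split; first exact: hol_dquot.
- apply: filterS2 HF (punctured_neq z0) => z -> zn; congr Some.
  rewrite hornerZ hornerX {1}(dquotE h z0 z) exprN1; field; exact: zn.
- by rewrite coefZ coefX mulr1.
Qed.

Lemma near_punctured_cx (R : realType) (z0 : Cx R) (P : Cx R -> Prop) :
  (\forall z \near z0, P z) <-> P z0 /\ \forall z \near z0^', P z.
Proof.
split=> [H|[P0 /dnbhs_cxP[e e0 He]]]; first by split; [exact: nbhs_singleton|exact: near_dnbhs_cx].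
apply/nbhs_cxP; exists e => // z ze; have [->|zn] := eqVneq z z0; [exact: P0|exact: He].
Qed.

(** * The metric and its character form near a point *)

Section Geometry.
Context {R : realType} {S : topologicalType} {X : riemann_surface R S} {n : nat}.
Context {pt : 'I_n -> S} {alpha : 'I_n -> R} {g : chart X -> S -> R}.
Context {f : multivalued R (~` range pt) (univalent_element X)}.
Context {omega : chart X -> S -> sphere R} {Psi : S -> R}.
Context (S_hausdorff : hausdorff_space S).
Context (S_connected : connected [set: S]).
Context (g_represents : represents pt alpha g).
Context (f_developing : developing g f).
Context (omega_character : character_form f omega).
Context (Psi_height : height_function f Psi).

Let W : set S := ~` range pt.

Lemma W_sparse (p : S) : \forall q \near p^', W q.
Proof.
have H : \forall q \near p^', forall j : 'I_n, q <> pt j.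
  apply: filter_forall => j; apply/near_punctured.
  have [->|/eqP pj] := pselect (p = pt j).
    by apply: filterE => q /eqP.
  have : nbhs p (~` [set pt j]).
    apply: open_nbhs_nbhs; split; last by move=> /= E; rewrite E eqxx in pj.
    by rewrite openC; exact: (accessible_closed_set1 (hausdorff_accessible S_hausdorff)).
  by apply: filterS => q qj _ E; exact: qj.
by apply: filterS H => q H [j _ /esym]; exact: H.
Qed.

Lemma W_near q : W q -> \forall q' \near q, W q'.
Proof.
move=> Wq; have /near_punctured := W_sparse q; apply: filterS => q' H.
by have [->|/H] := eqVneq q' q.
Qed.

(** Continuation of the base element along a path in W, which is path connected. *)
Lemma exists_element q : W q -> exists F, elements f q F.
Proof.
move=> Wq.
have [h hp] := sparse_path_connected X S_connected W_sparse (mv_base_in f) Wq.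
have [G hG] := mv_continuable hp; exists G; by exists h.
Qed.

Lemma element_near q F : elements f q F -> \forall q' \near q, elements f q' F.
Proof.
by move=> fF; apply: elements_near (fF); apply: W_near; have [] := elements_in fF.
Qed.

Lemma Psi_cont : continuous Psi. Proof. by case: Psi_height. Qed.

Lemma PsiE q F : elements f q F -> Psi q = height (F q).
Proof. by case: Psi_height => _; exact. Qed.

Lemma Psi_bounds q : W q -> 0 <= Psi q <= 4.
Proof. by move=> /exists_element[F /PsiE ->]; rewrite height_ge0 height_le4. Qed.

(** A meromorphic germ with a finite value is holomorphic, and the relation that
   defines omega at the nearby points makes omega its logarithmic derivative. *)
Lemma element_chart q F i : elements f q F -> dom i q -> 0 < Psi q < 4 ->
  exists phi, [/\ holomorphic_at phi (zcoord i q), phi (zcoord i q) != 0,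
    \forall z \near zcoord i q, F (param i z) = Some (phi z) &
    \forall z \near zcoord i q, [/\ phi z != 0, cder phi z (derive1 phi z) &
       omega i (param i z) = Some (derive1 phi z / phi z)]].
Proof.
move=> fF iq; rewrite (PsiE fF) => /height_mid[c c0 Fc].
have [_ [Fm _]] := elements_in fF.
have F0 : (F \o param i) (zcoord i q) = Some c by rewrite /= zcoordK.
have [phi ph phE] := meromorphic_fin (Fm i iq) F0.
have ph0 : phi (zcoord i q) = c by have := nbhs_singleton phE; rewrite F0 => -[].
have phn : phi (zcoord i q) != 0 by rewrite ph0.
exists phi; split=> //.
have E1 : \forall z \near zcoord i q, elements f (param i z) F.
  exact: ((near_chart _ iq).1 (element_near fF)).
have hn := cont_neq0 (hol_cont ph) phn.
have rad := near_chart_radius iq.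
apply: filterS3 (filterI E1 rad) (filterI hn (near_cder ph)) (nbhs_interior phE) => z [ez [dz zz]] [pn pd] pE.
split=> //.
have Fz : F (param i z) = Some (phi z) by exact: nbhs_singleton pE.
have [_ oF] := omega_character.
have pn' : phi z <> 0 by apply/eqP.
have n1 : F (param i z) <> None by rewrite Fz.
have n2 : F (param i z) <> Some 0 by rewrite Fz => -[].
rewrite (oF _ _ _ ez dz n1 n2) Fz /=.
have pd' : cder ((@fin R \o F) \o param i) z (derive1 phi z).
  by apply: (cder_eq pd _ erefl); apply: filterS pE => w /= ->.
have -> : dcoord i (@fin R \o F) (param i z) = derive1 phi z by rewrite /dcoord zz (cder_derive1 pd').
by [].
Qed.

(** From df = f omega, the density 4 |f'|^2 / (1 + |f|^2)^2 is |omega|^2 times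
   a function of |f|^2, hence of the height. *)
Lemma metric_formula q i : W q -> dom i q -> 0 < Psi q < 4 ->
  exists2 w, omega i q = Some w & expR (2 * g i q) = cmod w ^+ 2 * (Psi q * (4 - Psi q) / 4).
Proof.
move=> Wq iq P04; have [F fF] := exists_element Wq.
have := P04; rewrite (PsiE fF) => /height_mid[c c0 Fc].
have [_ oF] := omega_character.
have c0' : F q <> Some 0 by rewrite Fc => -[]; apply/eqP.
have cN : F q <> None by rewrite Fc.
exists (dcoord i (@fin R \o F) q / c).
  by rewrite (oF _ _ _ fF iq cN c0') Fc.
rewrite (f_developing fF iq) Fc height_form.
rewrite /pullback_density /= zcoordK// Fc /spherical_density /= zcoordK// Fc /=.
rewrite cmodM cmodV.
rewrite -[(@fin R \o (F \o param i))^`()%classic (zcoord i q)]/(dcoord i (@fin R \o F) q).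
have cc : 0 < cmod c by rewrite cmod_gt0.
field; rewrite gt_eqF ?den_gt0//=; exact: lt0r_neq0.
Qed.

Lemma metric_omega_neq0 q i : W q -> dom i q -> 0 < Psi q < 4 -> omega i q <> Some 0.
Proof.
move=> Wq iq P04; have [w -> e] := metric_formula Wq iq P04 => -[w0].
by have := expR_gt0 (2 * g i q); rewrite e w0 cmod0 expr0n mul0r ltxx.
Qed.

Lemma g_cont q i : W q -> dom i q -> {for zcoord i q, continuous (g i \o param i)}.
Proof.
move=> Wq iq; have [[gs _] _] := g_represents; have [gc _] := gs i 0%N.
by apply: gc; exists q.
Qed.

Lemma omega_meromorphic p i : dom i p -> meromorphic_at (omega i \o param i) (zcoord i p).
Proof. by have [[om _] _] := omega_character; exact: om. Qed.

(** If omega were finite there, the metric formula would force the metric to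
   tend to zero at the point, as Psi (4 - Psi) does. *)
Lemma omega_None q i : W q -> dom i q -> ~ (0 < Psi q < 4) -> omega i q = None.
Proof.
move=> Wq iq nP; case oq : (omega i q) => [c|//]; exfalso.
have o0 : (omega i \o param i) (zcoord i q) = Some c by rewrite /= zcoordK.
have [h hh hE] := meromorphic_fin (omega_meromorphic iq) o0.
have [F fF] := exists_element Wq.
have [_ [_ [U [Uq UF]]]] := elements_in fF.
have P04 : Psi q = 0 \/ Psi q = 4.
  have /andP[h0 h4] := Psi_bounds Wq.
  have [e|n0] := eqVneq (Psi q) 0; first by left.
  have [e|n4] := eqVneq (Psi q) 4; first by right.
  by exfalso; apply: nP; rewrite !lt_neqAle h0 h4 n4 eq_sym n0.
(* B is the factor of the metric formula that vanishes at q; omega is bounded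
   by M near q, and the density of the metric is at least m there. *)
pose B x := Psi x * (4 - Psi x) / 4.
have Bq : B q = 0 by rewrite /B; case: P04 => ->; rewrite ?mul0r ?subrr ?mulr0 ?mul0r.
have M0 : 0 < cmod (h (zcoord i q)) + 1 by rewrite ltr_wpDl// cmod_ge0.
set M := cmod (h (zcoord i q)) + 1 in M0.
have hM : \forall z \near zcoord i q, cmod (h z) < M.
  have [d d0 Hd] := (cont_cxP _ _).1 (hol_cont hh) _ ltr01.
  apply/nbhs_cxP; exists d => // z /Hd zd.
  by apply: le_lt_trans (cmod_le_add _ (h (zcoord i q))) _; rewrite ltrD2l.
have gb : \forall z \near zcoord i q, g i q - 1 < g i (param i z).
  have [d d0 Hd] := (contR_cxP _ _).1 (g_cont Wq iq) _ ltr01.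
  apply/nbhs_cxP; exists d => // z /Hd; rewrite /= zcoordK// ltr_norml => /andP[]; lra.
set m := expR (2 * (g i q - 1)).
have m0 : 0 < m by exact: expR_gt0.
have BM : \forall x \near q, B x < m / M ^+ 2.
  have e0 : 0 < m / M ^+ 2 by rewrite divr_gt0// exprn_gt0.
  have Bc : B x @[x --> q] --> B q.
    apply: cvgMl; apply: cvgM; first exact: Psi_cont.
    by apply: cvgB; [exact: cvg_cst|exact: Psi_cont].
  rewrite Bq in Bc.
  have /cvgrPdist_lt/(_ _ e0) H := Bc.
  by apply: filterS H => x; rewrite sub0r normrN => /(le_lt_trans (ler_norm _)).
have mid : \forall x \near q^', 0 < Psi x < 4.
  have P1 : \forall x \near q^', Psi x != Psi q.
    have Uqq := nbhs_singleton Uq.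
    apply/near_punctured; apply: filterS2 Uq (element_near fF) => x Ux fx; apply: contra_neq.
    rewrite (PsiE fx) (PsiE fF) => E; apply: UF => //.
    case: P04; rewrite (PsiE fF) => h0; rewrite h0 in E.
      by rewrite (height_eq0 h0) (height_eq0 E).
    by rewrite (height_eq4 h0) (height_eq4 E).
  have P2 : \forall x \near q^', `|Psi x - Psi q| < 1.
    apply: dnbhs_near; have /cvgrPdist_lt/(_ _ ltr01) H := @Psi_cont q.
    by apply: filterS H => x; rewrite distrC.
  have P3 := dnbhs_near (W_near Wq).
  apply: filterS3 P1 P2 P3 => x xn xd /Psi_bounds /andP[x0 x4].
  rewrite !lt_neqAle x0 x4 !andbT; move: xd; rewrite ltr_norml => /andP[d1 d2].
  by apply/andP; split; apply/eqP => E; case: P04 => e; rewrite -?E e ?eqxx in xn d1 d2; (try by []); lra.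
have [x _ []] : exists2 x, x != q & [/\ 0 < Psi x < 4, W x /\ dom i x, B x < m / M ^+ 2,
    g i q - 1 < g i x & exists2 w, omega i x = Some w & cmod w < M].
  apply: (dnbhs_ex X).
  have di : \forall x \near q, dom i x by apply: open_nbhs_nbhs; split=> //; exact: dom_open.
  have n1 : \forall x \near q, [/\ W x, dom i x, B x < m / M ^+ 2, g i q - 1 < g i x
      & exists2 w, omega i x = Some w & cmod w < M].
    have n2 : \forall x \near q, g i q - 1 < g i x by apply/(near_chart _ iq).
    have n3 : \forall x \near q, exists2 w, omega i x = Some w & cmod w < M.
      apply/(near_chart _ iq); apply: filterS2 hE hM => z e1 e2; by exists (h z).
    apply: filterS3 (filterI (W_near Wq) di) (filterI BM n2) n3 => x [? ?] [? ?] ?.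
    by split.
  by apply: filterS2 mid (dnbhs_near n1) => x xm [a b c' d e]; split.
move=> xm [Wx ix] xB xg [w ow wM].
have [w' ow' e] := metric_formula Wx ix xm.
rewrite ow in ow'; case: ow' => E; rewrite -E in e.
have : m < expR (2 * g i x) by rewrite ltr_expR ltr_pM2l.
rewrite e -/(B x) ltNge => /negP; apply.
apply: (@le_trans _ _ (M ^+ 2 * B x)).
  apply: ler_wpM2r; last by rewrite lerXn2r ?nnegrE ?cmod_ge0 ?(ltW M0)// ltW.
  case/andP: xm => a b; rewrite /B divr_ge0// mulr_ge0 ?subr_ge0//; exact: ltW.
by rewrite mulrC -ler_pdivlMr ?exprn_gt0// ltW.
Qed.

(** Zeros and poles of f are isolated because they are poles of omega. *)
Lemma near_regular p : \forall q \near p^', W q /\ 0 < Psi q < 4.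
Proof.
have [i ip] := dom_cover X p.
have oN : \forall q \near p^', omega i q <> None.
  by apply/(near_chart_d _ ip); exact: meromorphic_punctured (omega_meromorphic ip).
have di : \forall x \near p, dom i x by apply: open_nbhs_nbhs; split=> //; exact: dom_open.
apply: filterS3 (W_sparse p) oN (dnbhs_near di) => q Wq oq iq; split=> //.
by apply: contrapT => /(omega_None Wq iq).
Qed.

Lemma Psi_bound p : 0 <= Psi p <= 4.
Proof.
suff H x : ~ (x < Psi p /\ (forall q, W q -> Psi q <= x)) /\ ~ (Psi p < x /\ (forall q, W q -> x <= Psi q)).
  have [_ H0] := H 0; have [H4 _] := H 4.
  by apply/andP; split; rewrite leNgt; apply/negP => h; [apply: H0|apply: H4];
     split=> // q /Psi_bounds /andP[].
by split=> -[h Wx]; have h' := h; rewrite -subr_gt0 in h';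
  have /cvgrPdist_lt/(_ _ h') H := @Psi_cont p;
  have [q _ []] := dnbhs_ex X (filterI (W_sparse p) (dnbhs_near H)) => /Wx;
  move=> h1; rewrite ltr_norml; lra.
Qed.

(** A logit that is not bounded above forces Psi (p) = 4; logit_gt is the
   corresponding statement for Psi (p) = 0. *)
Lemma logit_lt p : Psi p < 4 -> exists B, \forall q \near p^', logit (Psi q) < B.
Proof.
move=> p4; pose e := (4 - Psi p) / 2; have e0 : 0 < e by rewrite /e; lra.
have /cvgrPdist_lt/(_ _ e0) H := @Psi_cont p.
exists (ln (4 / e) + 1); apply: filterS2 (near_regular p) (dnbhs_near H) => q [_ /andP[q0 q4]] qe.
apply: (@le_lt_trans _ _ (ln (4 / e))); last by rewrite ltrDl.
rewrite ler_ln ?posrE ?divr_gt0 ?subr_gt0//.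
apply: ler_pM; rewrite ?invr_ge0 ?subr_ge0 ?(ltW q4) ?(ltW q0)//.
rewrite lef_pV2 ?posrE ?subr_gt0//; move: qe; rewrite ltr_norml /e; lra.
Qed.

Lemma logit_gt p : 0 < Psi p -> exists B, \forall q \near p^', B < logit (Psi q).
Proof.
move=> p4; pose e := Psi p / 2; have e0 : 0 < e by rewrite /e; lra.
have /cvgrPdist_lt/(_ _ e0) H := @Psi_cont p.
exists (ln (e / 4) - 1); apply: filterS2 (near_regular p) (dnbhs_near H) => q [_ /andP[q0 q4]] qe.
apply: (@lt_le_trans _ _ (ln (e / 4))); first by rewrite gtrBl.
rewrite ler_ln ?posrE ?divr_gt0 ?subr_gt0//.
apply: ler_pM; rewrite ?invr_ge0 ?(ltW e0)//.
  by move: qe; rewrite ltr_norml /e; lra.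
by rewrite lef_pV2 ?posrE ?subr_gt0//; lra.
Qed.

(** This is log_form for the chart expression of F; the logarithm l of z - z0
   makes the residue term single-valued. *)
Lemma element_log i p F (V v : Cx R -> Cx R) (c l1 : Cx R) :
  let z1 := zcoord i p + cexp l1 in
  dom i (param i z1) -> zcoord i (param i z1) = z1 -> 0 < Psi (param i z1) < 4 ->
  elements f (param i z1) F ->
  (\forall z \near z1, cder V z (v z) /\ omega i (param i z) = Some (v z + c / (z - zcoord i p))) ->
  exists2 C, C != 0 & \forall l \near l1,
    F (param i (zcoord i p + cexp l)) = Some (C * cexp (V (zcoord i p + cexp l) + c * l)).
Proof.
move=> z1 d1 zz1 P1 fF HV.
have [phi [_ _ FE Hphi]] := element_chart fF d1 P1.
rewrite zz1 in FE Hphi.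
have [|C C0 HC] := @log_form R phi V v (zcoord i p) c l1.
  apply: filterS2 HV Hphi => z [dV oz] [p0 dp oz']; split; first by [].
  split; first by [].
  apply: (cder_val dp); move: oz'; rewrite oz => -[->].
  by rewrite mulrC divfK.
exists C; first by [].
have cl : {for l1, continuous (fun l : Cx R => zcoord i p + cexp l)}.
  exact: (cder_cont (cderD (cder_cst (zcoord i p) l1) (cder_cexp l1))).
have FE' := cont_near cl FE.
by apply: filterS2 HC FE' => l e1 ->; rewrite e1.
Qed.

Lemma logit_height (c : Cx R) : c != 0 -> logit (height (Some c)) = 2 * ln (cmod c).
Proof.
move=> c0; rewrite /logit height_ratio lnXn ?cmod_gt0//; ring.
Qed.

(** Near p, in the chart i, omega = (z - z0)^m h dz and (z - z0)^(m+1) K + c log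
   is a primitive of omega, whose real part gives logit Psi. *)
Definition local_form i p (m : int) (h K : Cx R -> Cx R) (c C0 : R) : Prop :=
  [/\ holomorphic_at h (zcoord i p), h (zcoord i p) != 0, holomorphic_at K (zcoord i p),
   \forall z \near (zcoord i p)^', [/\ W (param i z), 0 < Psi (param i z) < 4,
     omega i (param i z) = Some ((z - zcoord i p) ^ m * h z),
     cder (fun w => (w - zcoord i p) ^ (m + 1) * K w) z
       ((z - zcoord i p) ^ m * h z - cpair c 0 / (z - zcoord i p)) &
     logit (Psi (param i z)) = 2 * re ((z - zcoord i p) ^ (m + 1) * K z)
        + 2 * c * ln (cmod (z - zcoord i p)) + C0] &
   [/\ 0 <= m -> [/\ c = 0, K (zcoord i p) != 0 &
      \forall z \near zcoord i p, cder (fun w => (w - zcoord i p) ^ (m + 1) * K w) z ((z - zcoord i p) ^ m * h z)],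
    m = -1 -> cpair c 0 = h (zcoord i p) & m + 1 < 0 -> K (zcoord i p) != 0]].

(** On the half plane of logarithms l of z - z0, the function
   logit Psi - 2 Re (primitive of omega) is locally constant, by element_log,
   hence constant.  Comparing its values at l and l + 2 pi i gives Im c = 0. *)
Lemma local_structure i p : dom i p -> exists m h K c C0, local_form i p m h K c C0.
Proof.
move=> ip; set z0 := zcoord i p.
have reg := (near_chart_d _ ip).1 (near_regular p).
have rad := near_dnbhs_cx (near_chart_radius ip).
have on0 : \forall z \near z0^', (omega i \o param i) z <> Some 0.
  by apply: filterS2 reg rad => z [Wz Pz] [dz _]; exact: metric_omega_neq0.
have [m [h [hh h0 hE]]] := meromorphic_order (omega_meromorphic ip) on0.
have [c [K [Kh KE Km0 Km1 Km2]]] := form_primitive m hh h0.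
pose V z := (z - z0) ^ (m + 1) * K z.
pose v z := (z - z0) ^ m * h z - c / (z - z0).
have [e e0 He] := (dnbhs_cxP _ _).1 (filterI (filterI reg rad) (filterI hE KE)).
(* the difference of ln |f|^2 and of twice the real part of the integral,
   as a function of the logarithm of z - z0 *)
pose U (l : Cx R) := logit (Psi (param i (z0 + cexp l))) - 2 * re (V (z0 + cexp l) + c * l).
have inE (l : Cx R) : re l < ln e -> z0 + cexp l != z0 /\ cmod (z0 + cexp l - z0) < e.
  move=> le; split; first by rewrite -subr_eq0 addrAC subrr add0r cexp_neq0.
  by rewrite addrAC subrr add0r cmod_cexp -(@lnK _ e) ?posrE// ltr_expR.
have U_loc (l : Cx R) : re l < ln e -> \forall l' \near l, U l' = U l.
  move=> le; have [n1 n2] := inE _ le.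
  have [[[Wz Pz] [dz zz]] _] := He _ n1 n2.
  have [F fF] := exists_element Wz.
  have E : \forall z \near z0 + cexp l, cder V z (v z) /\ omega i (param i z) = Some (v z + c / (z - z0)).
    apply/nbhs_cxP.
    have d1 : 0 < Num.min (cmod (cexp l)) (e - cmod (cexp l)).
      by rewrite lt_min cmod_gt0 cexp_neq0 subr_gt0; move: n2; rewrite addrAC subrr add0r.
    exists (Num.min (cmod (cexp l)) (e - cmod (cexp l))) => // z; rewrite lt_min => /andP[a1 a2].
    have zn : z != z0.
      apply: contraTneq a1 => ->; rewrite -leNgt opprD addrA subrr add0r cmodN; exact: lexx.
    have ze : cmod (z - z0) < e.
      apply: (le_lt_trans (cmod_le_add _ (cexp l))); rewrite -ltrBrDl.
      by move: a2; rewrite opprD addrA.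
    have [_ [oa ob]] := He _ zn ze; split; first exact: ob.
    by rewrite /v subrK; exact: oa.
  have [C C0 HC] := element_log dz zz Pz fF E.
  have cl : {for l, continuous (fun l : Cx R => z0 + cexp l)}.
    exact: (cder_cont (cderD (cder_cst z0 l) (cder_cexp l))).
  have fz : \forall z \near z0 + cexp l, elements f (param i z) F.
    by have := (near_chart _ dz).1 (element_near fF); rewrite zz.
  have Uc : \forall l' \near l, U l' = 2 * ln (cmod C).
    apply: filterS2 HC (cont_near cl fz) => l' e1 e2.
    rewrite /U (PsiE e2) e1 logit_height ?mulf_neq0 ?cexp_neq0//.
    rewrite cmodM lnM ?posrE ?cmod_gt0 ?cexp_neq0// cmod_cexp expRK; rewrite /V /z0; ring.
  by have U0 := nbhs_singleton Uc; apply: filterS Uc => l' ->; rewrite U0.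
have Ucst (l l' : Cx R) := halfplane_cst U_loc : re l < ln e -> re l' < ln e -> U l' = U l.
have c0 : im c = 0.
  pose l := cpair (ln e - 1) 0 : Cx R.
  have h1 : re l < ln e by rewrite /l re_cpair gtrBl.
  have h2 : re (l + cpair 0 (2 * pi)) < ln e by rewrite reD re_cpair addr0.
  have := Ucst _ _ h1 h2; rewrite /U cexpD cexp_2pi mulr1 => /addrI/oppr_inj.
  rewrite mulrDr !(reD (V _)) (reD (c * l)) !(reM c) /l !re_cpair !im_cpair => H.
  have P0 := @pi_gt0 R; have : im c * pi = 0 by move: H; lra.
  by move/eqP; rewrite mulf_eq0 (gt_eqF P0) orbF => /eqP.
have cE : cpair (re c) 0 = c by rewrite -c0 cpairK.
exists m, h, K, (re c), (U (cpair (ln e - 1) 0)); split=> //.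
- apply/dnbhs_cxP; exists e => // z zn ze.
  have [[[Wz Pz] _] [oa ob]] := He _ zn ze.
  split; rewrite ?cE//.
  have [l lE lre] : exists2 l, cexp l = z - z0 & re l = ln (cmod (z - z0)).
    by apply: cexp_surj; rewrite subr_eq0.
  have h1 : re l < ln e by rewrite lre ltr_ln ?posrE// cmod_gt0 subr_eq0.
  have h2 : re (cpair (ln e - 1) 0 : Cx R) < ln e by rewrite re_cpair gtrBl.
  have := Ucst _ _ h2 h1; rewrite /U lE addrCA subrr addr0 => <-.
  rewrite (reD (V z)) (reM c) c0 mul0r subr0 lre /V; ring.
- split=> [m0|m1|]; [|by rewrite cE Km1|exact: Km2].
  by have [k1 k2 k3] := Km0 m0; split=> //; rewrite k1.
Qed.

(** Points of W count as cones of angle 2 pi, so that smooth and singular points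
   are treated alike. *)
Definition cone p (a : R) : Prop := (exists j, p = pt j /\ a = alpha j) \/ (W p /\ a = 1).

(** In the chart in which the cone is given this is the continuity of u; a change
   of charts multiplies z - z0 by a nonvanishing holomorphic function. *)
Lemma metric_bound p a i : cone p a -> dom i p ->
  exists C : R, \forall z \near (zcoord i p)^',
    `|g i (param i z) - (a - 1) * ln (cmod (z - zcoord i p))| <= C.
Proof.
move=> [[j [pE ->]]|[Wp ->]] ip; last first.
  have [C HC] := bounded_near (g_cont Wp ip).
  exists C; apply: filterS (near_dnbhs_cx HC) => z; by rewrite subrr mul0r subr0.
have [[_ gt] /(_ j) [j0 [jp [u [uc uE]]]]] := g_represents.
rewrite -pE in jp uc uE; set z0 := zcoord i p.
have uC : \forall z \near z0, `|u (param i z)| <= `|u p| + 1.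
  apply: ((near_chart (fun q => `|u q| <= `|u p| + 1) ip).1 _).
  have /cvgrPdist_lt/(_ _ ltr01) H := nbhs_singleton uc.
  apply: filterS H => q; rewrite distrC => qe.
  by rewrite -(subrKC (u p) (u q)); apply: le_trans (ler_normD _ _) _; rewrite lerD2l ltW.
pose tau := zcoord j0 \o param i.
have th : holomorphic_at tau z0 := trans_hol ip jp.
have t0 : derive1 tau z0 != 0 by exact: (dcoord_neq0 ip jp).
have [C1 H1] := ln_bounded (hol_cont (hol_derive1 th)) t0.
have d0 : dquot tau z0 z0 != 0 by rewrite /dquot eqxx.
have [C2 H2] := ln_bounded (hol_cont (hol_dquot th)) d0.
have n1 := cont_neq0 (hol_cont (hol_dquot th)) d0.
have uE' := (near_chart_d _ ip).1 uE.
have Wd := (near_chart_d _ ip).1 (W_sparse p).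
have dj : \forall x \near p, dom j0 x by apply: open_nbhs_nbhs; split=> //; exact: dom_open.
have dj' := (near_chart _ ip).1 dj.
exists (`|u p| + 1 + `|alpha j - 1| * C2 + C1).
apply: filterS3 (filterI (filterI uE' Wd) (near_dnbhs_cx (filterI (filterI uC dj') (near_chart_radius ip))))
  (near_dnbhs_cx (filterI (filterI H1 H2) n1)) (punctured_neq z0) => z [[ue Wz] [[uz jz] [iz zz]]] [[h1 h2] nz] zn.
have l0 : 0 < cmod (z - z0) by rewrite cmod_gt0.
rewrite (gt _ _ _ Wz iz jz) /dcoord zz -/tau.
have te : zcoord j0 (param i z) - zcoord j0 p = (z - z0) * dquot tau z0 z.
  have := dquotE tau z0 z; rewrite {1 2}/tau /= zcoordK// => ->.
  by rewrite addrAC subrr add0r.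
have l1 : 0 < cmod (dquot tau z0 z) by rewrite cmod_gt0.
move: ue; rewrite te cmodM lnM ?posrE// => ue.
have -> : g j0 (param i z) + ln (cmod (derive1 tau z)) - (alpha j - 1) * ln (cmod (z - z0))
  = u (param i z) + (alpha j - 1) * ln (cmod (dquot tau z0 z)) + ln (cmod (derive1 tau z)).
  by rewrite -ue; ring.
apply: le_trans (ler_normD _ _) _; apply: lerD => //.
apply: le_trans (ler_normD _ _) _; apply: lerD => //.
by rewrite normrM ler_wpM2l.
Qed.

(** By the metric formula, 2 g is 2 m ln |z - z0| - |logit Psi| up to a bounded
   error, and it is 2 (a - 1) ln |z - z0| up to a bounded error as well. *)
Lemma metric_exponent p a i m h K c C0 (b C : R) : cone p a -> dom i p ->
  local_form i p m h K c C0 ->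
  (\forall z \near (zcoord i p)^', `|logit (Psi (param i z)) - 2 * b * ln (cmod (z - zcoord i p))| <= C) ->
  a - 1 = m%:~R + `|b|.
Proof.
move=> ca ip [hh h0 _ H _] HL; set z0 := zcoord i p in hh h0 H HL.
have [C1 H1] := metric_bound ca ip.
have [C2 H2] := ln_bounded (hol_cont hh) h0.
have n1 := cont_neq0 (hol_cont hh) h0.
have small : \forall z \near z0, cmod (z - z0) < 1 by apply/nbhs_cxP; exists 1.
(* the two expansions of 2 g differ by 2 x ln |z - z0| up to a bounded error *)
pose x := a - 1 - m%:~R - `|b|.
suff [D HD] : exists D : R, \forall z \near z0^', `|x * ln (cmod (z - z0))| <= D.
  suff : x = 0 by rewrite /x; lra.
  have [r r0 Hr] := (dnbhs_cxP _ _).1 HD.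
  apply: (@log_bounded_eq0 R x D r) => // t /andP[t0 tr].
  have e : cmod (z0 + cpair t 0 - z0) = t by rewrite addrAC subrr add0r cmod_pair0 gtr0_norm.
  rewrite -{1}e; apply: Hr; last by rewrite e.
  by rewrite -subr_eq0 -cmod_eq0 e gt_eqF.
exists (C1 + C2 + ln 2 + ln 2 + C).
apply: filterS3 (filterI (filterI H1 HL) H)
  (near_dnbhs_cx (filterI (filterI H2 n1) (filterI small (near_chart_radius ip)))) (punctured_neq z0) => z [[k1 k2] [Wz Pz oz _ _]] [[k3 hz] [sm [dz zz]]] zn.
have [w ow e] := metric_formula Wz dz Pz.
have wE : w = (z - z0) ^ m * h z by rewrite ow in oz; case: oz.
have l0 : 0 < cmod (z - z0) by rewrite cmod_gt0.
have hz0 : 0 < cmod (h z) by rewrite cmod_gt0.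
set L := logit (Psi (param i z)) in k2.
have ge : 2 * g i (param i z) = 2 * (m%:~R * ln (cmod (z - z0)) + ln (cmod (h z)))
   + (ln 4 + L - 2 * ln (1 + expR L)).
  rewrite -(expRK (2 * _)) e lnM ?posrE; last 2 first.
  - by rewrite exprn_gt0// wE cmodM cmodXz mulr_gt0// exprz_gt0.
  - by case/andP: Pz => p0 p4; rewrite divr_gt0// mulr_gt0// subr_gt0.
  rewrite logit_form// lnXn; last by rewrite wE cmodM cmodXz mulr_gt0// exprz_gt0.
  rewrite wE cmodM lnM ?posrE ?cmodXz ?exprz_gt0//.
  have -> : ln (cmod (z - z0) ^ m) = m%:~R * ln (cmod (z - z0)).
    case: (m) => k; first by rewrite -exprnP lnXn// -mulr_natl pmulrn.
    by rewrite NegzE -invr_expz lnV ?posrE ?exprz_gt0// -exprnP lnXn// -mulr_natl rmorphN /= mulNr pmulrn.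
  rewrite /L; ring.
have s := log_softmax L.
have ln4 : ln 4 = 2 * ln 2 :> R.
  by rewrite (_ : 4 = 2 ^+ 2 :> R); [rewrite lnXn// mulr_natl|ring].
have lt0 : ln (cmod (z - z0)) < 0 by rewrite ln_lt0// l0.
set t := ln (cmod (z - z0)) in k1 k2 ge lt0 *.
have Lb : `| `|L| + 2 * `|b| * t | <= C.
  have -> : 2 * `|b| * t = - `|2 * b * t|.
    by rewrite !normrM (ltr0_norm lt0) (ger0_norm (ler0n _ 2)); ring.
  by apply: le_trans k2; exact: ler_dist_dist.
have -> : x * t = - (g i (param i z) - (a - 1) * t) + ln (cmod (h z)) + ln 2
     + 2^-1 * (L - 2 * ln (1 + expR L) + `|L|) - 2^-1 * (`|L| + 2 * `|b| * t).
  have -> : g i (param i z) = 2^-1 * (2 * g i (param i z)) by rewrite mulrA mulVf ?mul1r.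
  by rewrite ge ln4 /x; field.
have n2 : 0 <= ln 2 :> R by rewrite ln_ge0//; lra.
have l1 : `|ln 2 : R| = ln 2 by rewrite ger0_norm.
have C0' : 0 <= C by apply: le_trans Lb.
apply: le_trans (ler_normD _ _) (lerD _ _); last first.
  by rewrite normrN normrM ger0_norm ?invr_ge0//; have := Lb; lra.
apply: le_trans (ler_normD _ _) (lerD _ _); last first.
  by rewrite normrM ger0_norm ?invr_ge0//; have := s; lra.
apply: le_trans (ler_normD _ _) (lerD _ _); last by rewrite l1.
apply: le_trans (ler_normD _ _) (lerD _ k3).
by rewrite normrN.
Qed.

Lemma cont_coord (u : S -> R) (i : chart X) p : dom i p -> {for p, continuous u} ->
  {for zcoord i p, continuous (u \o param i)}.
Proof.
move=> ip uc; apply/contR_cxP => e e0.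
have /cvgrPdist_lt/(_ _ e0) H := uc.
have [d d0 Hd] := (nbhs_cxP _ _).1 ((near_chart _ ip).1 H).
by exists d => // w /Hd; rewrite distrC /= zcoordK.
Qed.

Lemma punctured_eqR (u v : Cx R -> R) z0 : {for z0, continuous u} -> {for z0, continuous v} ->
  (\forall z \near z0^', u z = v z) -> u z0 = v z0.
Proof.
move=> /contR_cxP uc /contR_cxP vc H; apply/eqP; apply: contraT => n0.
have d0 : 0 < `|u z0 - v z0| / 2 by rewrite divr_gt0// normr_gt0 subr_eq0.
have [d1 d10 H1] := uc _ d0; have [d2 d20 H2] := vc _ d0; have [d3 d30 H3] := (dnbhs_cxP _ _).1 H.
have m0 : 0 < Num.min d1 (Num.min d2 d3) by rewrite !lt_min d10 d20 d30.
have [t t0] : exists2 t, 0 < t & t < Num.min d1 (Num.min d2 d3) by exists (Num.min d1 (Num.min d2 d3) / 2); lra.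
rewrite !lt_min => /and3P[t1 t2 t3].
have e : cmod (z0 + cpair t 0 - z0) = t by rewrite addrAC subrr add0r cmod_pair0 gtr0_norm.
have z1 := H1 (z0 + cpair t 0); have z2 := H2 (z0 + cpair t 0); have z3 := H3 (z0 + cpair t 0).
rewrite e in z1 z2 z3.
have zn : z0 + cpair t 0 != z0 by rewrite -subr_eq0 -cmod_eq0 e gt_eqF.
have := z1 t1; have := z2 t2; rewrite (z3 zn t3); set w := v _ => k1 k2.
have : `|u z0 - v z0| <= `|w - v z0| + `|w - u z0|.
  by rewrite (distrC w (u z0)) [leRHS]addrC; exact: ler_distD.
lra.
Qed.

Lemma near_ex (P : Cx R -> Prop) z0 v d : v != 0 -> 0 < d -> (\forall z \near z0^', P z) ->
  exists2 t : R, 0 < t < d & P (z0 + cpair t 0 * v).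
Proof.
move=> v0 d0 /dnbhs_cxP[e e0 He].
have cv : 0 < cmod v by rewrite cmod_gt0.
have ev : 0 < e / cmod v by rewrite divr_gt0.
have m0 : 0 < Num.min d (e / cmod v) by rewrite lt_min d0.
have [t t0] : exists2 t, 0 < t & t < Num.min d (e / cmod v) by exists (Num.min d (e / cmod v) / 2); lra.
rewrite lt_min => /andP[td te]; exists t; first by rewrite t0.
have E : cmod (z0 + cpair t 0 * v - z0) = t * cmod v.
  by rewrite addrAC subrr add0r cmodM cmod_pair0 gtr0_norm.
by apply: He; rewrite ?E -?ltr_pdivlMr// -subr_eq0 -cmod_eq0 E mulf_neq0 ?gt_eqF.
Qed.

Definition local_type p a i : Prop := exists m h K c C0, local_form i p m h K c C0 /\
  ([/\ 0 <= m, a = m%:~R + 1, 0 < Psi p < 4 & C0 = logit (Psi p)] \/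
   [/\ m = -1, cpair c 0 = h (zcoord i p) & (Psi p = 0 /\ c = a) \/ (Psi p = 4 /\ c = - a)]).

(** Along suitable rays, (z - z0)^(m+1) K dominates the logarithm with either
   sign, and logit Psi is unbounded above and below, which the continuity of
   Psi at p excludes. *)
Lemma order_ge_minus_one i p m h K c C0 : dom i p -> local_form i p m h K c C0 -> m + 1 < 0 -> False.
Proof.
move=> ip [hh h0 Kh H [_ _ /[swap] m0 /(_ m0) K0]].
set z0 := zcoord i p in hh h0 Kh H K0.
have m10 : m + 1 != 0 by rewrite lt_eqF.
(* the sign s = 1 or -1 treats both directions at once *)
have key s (B : R) : s * s = 1 -> ~ (\forall z \near z0^', s * logit (Psi (param i z)) < B).
  move=> s2 HB.
  have sK0 : cpair s 0 * K z0 != 0.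
    rewrite mulf_neq0// -cmod_eq0 cmod_pair0 normr_eq0; apply: contra_eq_neq s2 => ->.
    by rewrite mul0r eq_sym oner_eq0.
  have Kc : {for z0, continuous (fun z => cpair s 0 * K z)}.
    exact: (hol_cont (holM (hol_cst _ _) Kh)).
  have [v v0 [d d0 Hd]] := ray_re Kc sK0 m10.
  pose x := 2 * (s * c).
  have [d' d'0 Hd'] := inv_beats_log (x / 2) ((B - s * C0 - x * ln (cmod v)) / 2).
  have dm : 0 < Num.min d (Num.min 1 d') by rewrite !lt_min d0 d'0 ltr01.
  have [t] := near_ex v0 dm (filterI H HB).
  rewrite !lt_min => /andP[t0 /and3P[td t1 td']] [[_ _ _ _ ->]].
  rewrite (addrAC z0 _ (- z0)) subrr add0r cmodM cmod_pair0 gtr0_norm// lnM ?posrE ?cmod_gt0//.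
  have := Hd t; rewrite t0 td => /(_ isT).
  have := Hd' t; rewrite t0 td' => /(_ isT).
  have tm : t^-1 <= t ^ (m + 1).
    rewrite -exprN1; apply: (ler_wniXz2l (ltW t0) (ltW t1)); rewrite ?inE //; clear -m0; lia.
  set Z := (_ ^ (m + 1) : Cx R); set k := K _.
  rewrite (_ : re (Z * (cpair s 0 * k)) = s * re (Z * k)); last first.
    by rewrite mulrCA (reM (cpair s 0)) re_cpair im_cpair mul0r subr0.
  rewrite /x; move=> h1 h2; rewrite ltNge => /negP; apply.
  exact: (@ray_bound R (t ^ (m + 1)) t^-1 (re (Z * k)) (ln t) (ln (cmod v)) s c C0 B).
have [P4|P4] := ltP (Psi p) 4.
  have [B HB] := logit_lt P4; apply: (key 1 B); first by rewrite mulr1.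
  by have := (near_chart_d _ ip).1 HB; apply: filterS => z; rewrite mul1r.
have P0 : 0 < Psi p by apply: lt_le_trans P4.
have [B HB] := logit_gt P0; apply: (key (-1) (- B)); first by rewrite mulrNN mulr1.
by have := (near_chart_d _ ip).1 HB; apply: filterS => z; rewrite mulN1r ltrN2.
Qed.

(** In the first case logit Psi is bounded; in the second it is 2 c ln |z - z0|
   up to a bounded error.  Both feed metric_exponent. *)
Lemma local_trichotomy p a i : cone p a -> 0 < a -> dom i p -> local_type p a i.
Proof.
move=> ca a0 ip; have [m [h [K [c [C0 LF]]]]] := local_structure ip.
exists m, h, K, c, C0; split; first exact: LF.
have [hh h0 Kh H [H0 H1 H2]] := LF; set z0 := zcoord i p in hh h0 Kh H H0 H1 *.
have [m0|m0] := leP 0 m.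
  left; have [c0 K0 KE] := H0 m0.
  pose w z := 2 * re ((z - z0) ^ (m + 1) * K z) + C0.
  have wc : {for z0, continuous w}.
    have V := cder_cont (nbhs_singleton KE).
    have RV : {for z0, continuous (fun z => re ((z - z0) ^ (m + 1) * K z))}.
      exact: (continuous_comp V (@re_continuous R _)).
    exact: (continuous_comp RV (@affine_continuous R 2 C0 _)).
  have Lw : \forall z \near z0^', logit (Psi (param i z)) = w z.
    by apply: filterS H => z [_ _ _ _ ->]; rewrite c0 mulr0 mul0r addr0.
  have [C HC] := bounded_near wc.
  have HL : \forall z \near z0^', `|logit (Psi (param i z)) - 2 * 0 * ln (cmod (z - z0))| <= C.
    by apply: filterS2 Lw (near_dnbhs_cx HC) => z ->; rewrite mulr0 mul0r subr0.
  have := metric_exponent ca ip LF HL; rewrite normr0 addr0 => am.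
  have aE : a = m%:~R + 1 by lra.
  have PE : Psi p = 4 * expR (w z0) / (1 + expR (w z0)).
    have -> : Psi p = (Psi \o param i) z0 by rewrite /= zcoordK.
    apply: (@punctured_eqR (Psi \o param i) (fun z => 4 * expR (w z) / (1 + expR (w z)))).
    - exact: (cont_coord ip (@Psi_cont p)).
    - exact: (continuous_comp wc (@logistic_continuous R _)).
    - by apply: filterS2 H Lw => z [_ Pz _ _ _] <-; exact: logitK.
  split=> //.
    have e0 := expR_gt0 (w z0); set e := expR _ in PE e0.
    have e1 : 0 < 1 + e by rewrite addr_gt0.
    rewrite PE divr_gt0 ?mulr_gt0//= ltr_pdivrMr//; lra.
  rewrite PE logit_logistic /w subrr; case: (m) m0 => // k _.
  by rewrite -PoszD addn1 exp0rz mul0r (_ : re 0 = 0 :> R)// mulr0 add0r.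
have [mE|mE] := eqVneq m (-1); last by exfalso; apply: (order_ge_minus_one ip LF); lia.
right; split=> //; first exact: H1.
have K0 : \forall z \near z0^', logit (Psi (param i z)) = 2 * re (K z) + 2 * c * ln (cmod (z - z0)) + C0.
  by apply: filterS H => z [_ _ _ _ ->]; rewrite mE addNr expr0z mul1r.
have RK : {for z0, continuous (fun z => re (K z))}.
  exact: (continuous_comp (hol_cont Kh) (@re_continuous R _)).
have [C HC] := bounded_near RK.
have HL : \forall z \near z0^', `|logit (Psi (param i z)) - 2 * c * ln (cmod (z - z0))| <= 2 * C + `|C0|.
  apply: filterS2 K0 (near_dnbhs_cx HC) => z -> zC.
  rewrite (_ : _ - _ = 2 * re (K z) + C0); last by ring.
  by apply: le_trans (ler_normD _ _) _; rewrite lerD2r normrM ger0_norm// ler_wpM2l.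
have := metric_exponent ca ip LF HL; rewrite mE => am.
have aE : a = `|c| by move: am; rewrite rmorphN1; lra.
have c0 : c != 0 by rewrite -normr_eq0 -aE gt_eqF.
have blow s B : s * c < 0 -> s * s = 1 -> ~ (\forall z \near z0^', s * logit (Psi (param i z)) < B).
  move=> sc s2 HB.
  have s1 : `|s| = 1.
    by apply/eqP; rewrite -(@eqrXn2 _ 2) ?expr1n// -normrX expr2 s2 normr1.
  have v0 : (1 : Cx R) != 0 by exact: oner_neq0.
  pose Y := (B + 2 * C + `|C0|) / (2 * (s * c)).
  have [t /andP[t0 tY] [Bt HLt]] := near_ex v0 (expR_gt0 Y) (filterI HB HL).
  move: Bt HLt; rewrite mulr1 addrAC subrr add0r cmod_pair0 (gtr0_norm t0).
  set L := logit _ => Bt HLt.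
  have lY : ln t < Y by rewrite -(expRK Y) ltr_ln ?posrE ?expR_gt0.
  have : B + 2 * C + `|C0| < 2 * (s * c) * ln t.
    have sc2 : 2 * (s * c) < 0 by rewrite pmulr_rlt0.
    have e : Y * (2 * (s * c)) = B + 2 * C + `|C0| by rewrite /Y divfK// lt_eqF.
    by rewrite -e [ltRHS]mulrC ltr_nM2r.
  have : `|s * (L - 2 * c * ln t)| <= 2 * C + `|C0| by rewrite normrM s1 mul1r.
  rewrite ler_norml => /andP[k1 _]; have -> : 2 * (s * c) * ln t = s * L - s * (L - 2 * c * ln t) by ring.
  lra.
have /andP[P0 P4] := Psi_bound p.
have [cn|cp|cz] := ltgtP c 0; last by rewrite cz eqxx in c0.
  right; split; last by rewrite aE ltr0_norm// opprK.
  apply/eqP; rewrite eq_le P4 leNgt; apply/negP => hP.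
  have [B HB] := logit_lt hP; apply: (blow 1 B); rewrite ?mul1r//.
  by have := (near_chart_d _ ip).1 HB; apply: filterS => z; rewrite mul1r.
left; split; last by rewrite aE gtr0_norm.
apply/eqP; rewrite eq_le P0 andbT leNgt; apply/negP => hP.
have [B HB] := logit_gt hP; apply: (blow (-1) (- B)); rewrite ?mulN1r ?oppr_lt0 ?opprK//.
by have := (near_chart_d _ ip).1 HB; apply: filterS => z; rewrite mulN1r ltrN2.
Qed.

(** * The local types at the points of the surface *)

Context {Y : chart X -> S -> sphere R}.
Context (alpha_gt0 : forall j, 0 < alpha j).
Context (alpha_neq1 : forall j, alpha j != 1).
Context (Y_dual : dual_vector_field f Y).

Definition regular p : Prop := 0 < Psi p < 4.

Lemma cone_ex p : exists a, cone p a /\ 0 < a.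
Proof.
have [[j _ <-]|Wp] := pselect (range pt p).
  by exists (alpha j); split=> //; left; exists j.
by exists 1; split=> //; right.
Qed.

Lemma local_form_order i p m h K c C0 : local_form i p m h K c C0 ->
  order_at (omega i \o param i) (zcoord i p) m.
Proof. by case=> hh h0 _ H _; exists h; split=> //; apply: filterS H => z []. Qed.

Lemma regular_local p i : regular p -> dom i p -> exists m h K C0,
  [/\ cone p (m.+1%:R), local_form i p m%:Z h K 0 C0 & C0 = logit (Psi p)].
Proof.
move=> /andP[P0 P4] ip; have [a [ca a0]] := cone_ex p.
have [m [h [K [c [C0 [LF [[m0 aE _ CE]|[_ _ H]]]]]]]] := local_trichotomy ca a0 ip; last first.
  by case: H P0 P4 => -[-> _]; rewrite ltxx.
case: m m0 aE LF => // m _ aE LF.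
have c0 : c = 0 by case: (LF) => _ _ _ _ [/(_ isT)[]].
exists m, h, K, C0; split=> //; last by rewrite -c0.
by rewrite -natr1 -(_ : a = m%:R + 1)//.
Qed.

Lemma cone_uniq p (a b : R) : injective pt -> cone p a -> cone p b -> a = b.
Proof.
move=> pt_inj [[j [pj ->]]|[Wp ->]] [[k [pk ->]]|[Wp' ->]] //.
- by congr alpha; apply: pt_inj; rewrite -pj.
- by exfalso; apply: Wp'; exists j.
- by exfalso; apply: Wp; exists k.
Qed.

Lemma extremal_local p i : ~ regular p -> dom i p -> exists h K c C0 a,
  [/\ cone p a, 0 < a, local_form i p (-1) h K c C0, cpair c 0 = h (zcoord i p) &
      (Psi p = 0 /\ c = a) \/ (Psi p = 4 /\ c = - a)].
Proof.
move=> nP ip; have [a [ca a0]] := cone_ex p.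
have [m [h [K [c [C0 [LF [[_ _ P _]|[mE h0 H]]]]]]]] := local_trichotomy ca a0 ip; first by [].
by exists h, K, c, C0, a; rewrite -mE.
Qed.

Lemma irregular p : ~ regular p -> Psi p = 0 \/ Psi p = 4.
Proof.
move=> nP; have [i ip] := dom_cover X p.
by have [h [K [c [C0 [a [_ _ _ _ [[-> _]|[-> _]]]]]]]] := extremal_local nP ip; [left|right].
Qed.

Lemma logit_le (x y : R) : 0 < x < 4 -> 0 < y < 4 -> x <= y -> logit x <= logit y.
Proof.
move=> /andP[x0 x4] /andP[y0 y4] xy.
rewrite /logit ler_ln ?posrE ?divr_gt0 ?subr_gt0//.
apply: ler_pM; rewrite ?invr_ge0 ?subr_ge0 ?(ltW x4) ?(ltW x0)//.
by rewrite lef_pV2 ?posrE ?subr_gt0//; lra.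
Qed.

(** On the rays of ray_re for K and for - K, logit Psi lies above and below its
   value at p. *)
Lemma regular_not_extremal p : regular p -> ~ extremal_point Psi p.
Proof.
move=> rp ext; have [i ip] := dom_cover X p.
have [m [h [K [C0 [_ [hh h0 Kh H [/(_ isT) [_ K0 _] _ _]] CE]]]]] := regular_local rp ip.
set z0 := zcoord i p in hh h0 Kh H K0.
have m1 : m%:Z + 1 != 0 by rewrite -PoszD addn1.
have key s : s * s = 1 -> (\forall q \near p, s * Psi q <= s * Psi p) -> False.
  move=> s2 Hs.
  have sK0 : cpair s 0 * K z0 != 0.
    rewrite mulf_neq0// -cmod_eq0 cmod_pair0 normr_eq0; apply: contra_eq_neq s2 => ->.
    by rewrite mul0r eq_sym oner_eq0.
  have Kc : {for z0, continuous (fun z => cpair s 0 * K z)}.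
    exact: (hol_cont (holM (hol_cst _ _) Kh)).
  have [v v0 [d d0 Hd]] := ray_re Kc sK0 m1.
  have Hs' : \forall z \near z0^', s * Psi (param i z) <= s * Psi p := near_dnbhs_cx ((near_chart _ ip).1 Hs).
  have [t td [sP [_ Pz _ _ LE]]] := near_ex v0 d0 (filterI Hs' H).
  have t0 : 0 < t by case/andP: td.
  have sL : s * logit (Psi (param i (z0 + cpair t 0 * v))) <= s * logit (Psi p).
    have [s1|s1] : s = 1 \/ s = -1.
      have : (s - 1) * (s + 1) = 0 by rewrite -subr_sqr expr1n expr2 s2 subrr.
      by move/eqP; rewrite mulf_eq0 subr_eq0 addr_eq0 => /orP[/eqP ->|/eqP ->]; [left|right].
    - by move: sP; rewrite s1 !mul1r; exact: logit_le.
    - by move: sP; rewrite s1 !mulN1r !lerN2; exact: logit_le.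
  have := Hd _ td; have t1 : 0 < t ^ (m%:Z + 1) by exact: exprz_gt0.
  move: LE sL; rewrite mulr0 mul0r addr0 CE (addrAC z0 _ (- z0)) subrr add0r => ->.
  set Z := (_ ^ (m%:Z + 1) : Cx R); set k := K _.
  rewrite (_ : re (Z * (cpair s 0 * k)) = s * re (Z * k)); last first.
    by rewrite mulrCA (reM (cpair s 0)) re_cpair im_cpair mul0r subr0.
  move: t1; rewrite mulrDr mulrCA; move: (t ^ _) (s * re _) (s * logit _) => x y w; lra.
case: ext => H'.
  apply: (key (-1)); first by rewrite mulrNN mulr1.
  by apply: filterS H' => q; rewrite !mulN1r lerN2.
apply: (key 1); first by rewrite mulr1.
by apply: filterS H' => q; rewrite !mul1r.
Qed.

Lemma minimal_Psi p : minimal_point Psi p -> Psi p = 0.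
Proof.
move=> mp; have np : ~ regular p by move=> /regular_not_extremal; apply; left.
have [//|P4] := irregular np; exfalso.
have [q _ [[_ /andP[_ q4]] ]] := dnbhs_ex X (filterI (near_regular p) (dnbhs_near mp)).
by rewrite P4 leNgt q4.
Qed.

Lemma maximal_Psi p : maximal_point Psi p -> Psi p = 4.
Proof.
move=> mp; have np : ~ regular p by move=> /regular_not_extremal; apply; right.
have [P0|//] := irregular np; exfalso.
have [q _ [[_ /andP[q0 _]] ]] := dnbhs_ex X (filterI (near_regular p) (dnbhs_near mp)).
by rewrite P0 leNgt q0.
Qed.

Lemma extremal_irregular p : extremal_point Psi p <-> ~ regular p.
Proof.
split=> [e r|/irregular [P0|P4]]; first exact: regular_not_extremal r e.
  by left; apply: filterE => q; rewrite P0; case/andP: (Psi_bound q).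
by right; apply: filterE => q; rewrite P4; case/andP: (Psi_bound q).
Qed.

(** The order of omega is a - 1 in every chart, so that it does not depend on
   the chart. *)
Lemma regular_order p : injective pt -> regular p ->
  exists2 m, cone p (m.+1%:R) & has_order omega p m%:Z.
Proof.
move=> pt_inj rp; have [i ip] := dom_cover X p.
have [m [h [K [C0 [ca _ _]]]]] := regular_local rp ip.
exists m => // j jp; have [m' [h' [K' [C0' [ca' LF _]]]]] := regular_local rp jp.
have := cone_uniq pt_inj ca ca' => /eqP; rewrite eqr_nat eqSS => /eqP ->.
exact: local_form_order LF.
Qed.

Lemma irregular_order p : ~ regular p -> has_order omega p (-1).
Proof.
move=> np i ip; have [h [K [c [C0 [a [_ _ LF _ _]]]]]] := extremal_local np ip.
exact: local_form_order LF.
Qed.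

Lemma Y_omega q i w : W q -> dom i q -> regular q -> omega i q = Some w -> Y i q = Some w^-1.
Proof.
move=> Wq iq rq ow; have [F fF] := exists_element Wq.
have := rq; rewrite /regular (PsiE fF) => /height_mid[c c0 Fc].
have [_ oF] := omega_character; have [_ yF] := Y_dual.
have n1 : F q <> None by rewrite Fc.
have n2 : F q <> Some 0 by rewrite Fc => -[]; exact/eqP.
move: ow; rewrite (oF _ _ _ fF iq n1 n2) (yF _ _ _ fF iq n1 n2) => -[<-].
by rewrite invf_div.
Qed.

Lemma Y_order p m : has_order omega p m -> has_order Y p (- m).
Proof.
move=> om i ip; have [h [hh h0 HE]] := om i ip.
exists (fun z => (h z)^-1); split; [exact: holV|by rewrite invr_eq0|].
have rad := near_dnbhs_cx (near_chart_radius ip).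
have reg := (near_chart_d _ ip).1 (near_regular p).
apply: filterS3 HE rad reg => z oz [dz zz] [Wz rz].
have ow : omega i (param i z) = Some ((z - zcoord i p) ^ m * h z) by exact: oz.
by rewrite /= (Y_omega Wz dz rz ow) invfM invr_expz.
Qed.

Lemma Y_value p m : has_order omega p m ->
  [/\ m < 0 -> is_zero Y p, 0 < m -> is_pole Y p & m = 0 -> ~ is_zero Y p /\ ~ is_pole Y p].
Proof.
move=> om; have [[Ym _] _] := Y_dual.
have V i (ip : dom i p) := meromorphic_value (Ym i p ip) (Y_order om ip).
split=> [m0 i ip|m0 i ip|m0].
- by have [H _ _] := V i ip; have := H; rewrite /= zcoordK// oppr_gt0; exact.
- by have [_ H _] := V i ip; have := H; rewrite /= zcoordK// oppr_lt0; exact.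
- have [i ip] := dom_cover X p; have [_ _ H] := V i ip.
  move: H; rewrite m0 oppr0 /= zcoordK// => /(_ erefl) [c c0 e].
  split=> /(_ i ip); rewrite e// => -[] ce; by rewrite ce eqxx in c0.
Qed.

Context (S_compact : compact [set: S]).
Context (pt_inj : injective pt).

(** By local_form, logit Psi is twice the real part of a primitive of omega, up to
   a constant; this is 2 Re omega = d (log |f|^2), also at the saddle points. *)
Lemma regular_rdiff p i : regular p -> dom i p -> exists2 w, omega i p = Some w &
  rdiff (fun z => logit (Psi (param i z))) (zcoord i p) (2 * w).
Proof.
move=> rp ip; have [m [h [K [C0 [_ [hh h0 Kh H [/(_ isT) [_ _ KE] _ _]] CE]]]]] := regular_local rp ip.
set z0 := zcoord i p in hh h0 Kh H KE *.
exists ((z0 - z0) ^ m%:Z * h z0).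
  have := @meromorphic_hol_value R (omega i \o param i) z0 (fun z => (z - z0) ^+ m * h z)
    (omega_meromorphic ip) (hol_cont (holM (hol_subX m z0 z0) hh)).
  by rewrite /= zcoordK//; apply; apply: filterS H => z [_ _ -> _ _].
have rd := rdiff_cder C0 (nbhs_singleton KE).
apply: rdiff_near rd; apply/near_punctured_cx; split; last first.
  by apply: filterS H => z [_ _ _ _ ->]; rewrite mulr0 mul0r addr0.
rewrite subrr -PoszD addn1 exp0rz mul0r (_ : re 0 = 0 :> R)// mulr0 add0r.
by rewrite CE zcoordK.
Qed.

(** Psi and logit Psi are differentiable functions of each other, hence they have
   the same critical points among the regular ones. *)
Lemma regular_critical p : regular p -> critical_point X Psi p <-> is_zero omega p.
Proof.
move=> rp.
have near_mid (i : chart X) : dom i p -> \forall z \near zcoord i p, 0 < Psi (param i z) < 4.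
  move=> ip; apply: ((near_chart (fun q => 0 < Psi q < 4) ip).1 _).
  have /near_punctured H : \forall q \near p^', 0 < Psi q < 4 by apply: filterS (near_regular p) => q [].
  by apply: filterS H => q H; have [->|/H] := eqVneq q p.
split=> [H i ip|H i ip].
  have [w -> dw] := regular_rdiff rp ip.
  suff d0 : rdiff (fun z => logit (Psi (param i z))) (zcoord i p) 0.
    have := rdiff_uniq dw d0; move/eqP; rewrite mulf_eq0 pnatr_eq0 /= => /eqP ->; by [].
  have dP : rdiff (fun z => Psi (param i z)) (zcoord i p) 0.
    by apply: (rdiffP (fun z => Psi (param i z)) _ _).2; rewrite zcoordK//; exact: H.
  have P04 : 0 < Psi (param i (zcoord i p)) < 4 by rewrite zcoordK.
  have := rdiff0_comp dP (derivable_logit P04); apply: rdiff_near.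
  apply: filterS (near_mid i ip) => z /andP[z0 z4].
  by rewrite /logit ln_div ?posrE ?subr_gt0.
have [w ow dw] := regular_rdiff rp ip.
have w0 : w = 0 by have := H i ip; rewrite ow => -[].
rewrite w0 mulr0 in dw.
have dP := rdiff0_comp dw (@derivable_logistic R _).
have dP' : rdiff (fun z => Psi (param i z)) (zcoord i p) 0.
  apply: rdiff_near dP; apply: filterS (near_mid i ip) => z Pz.
  by rewrite -logitK.
by have := (rdiffP (fun z => Psi (param i z)) _ _).1 dP'; rewrite zcoordK.
Qed.

Lemma regular_zero p (m : nat) : has_order omega p m%:Z -> is_zero omega p <-> (0 < m)%N.
Proof.
move=> om; have [[Om _] _] := omega_character.
have V i (ip : dom i p) := meromorphic_value (Om i p ip) (om i ip).
split=> [H|m0 i ip].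
  rewrite lt0n; apply/eqP => m0; have [i ip] := dom_cover X p.
  have [_ _ H0] := V i ip; move: H0; rewrite m0 => /(_ erefl)[c c0].
  by rewrite /= zcoordK// (H i ip) => -[ce]; rewrite -ce eqxx in c0.
by have [H _ _] := V i ip; have := H; rewrite /= zcoordK//; exact.
Qed.

Lemma saddleP p : saddle_point X Psi p <-> regular p /\ exists j, p = pt j.
Proof.
split=> [[cp np]|[rp [j pj]]].
  have rp : regular p by apply: contrapT => /extremal_irregular.
  split=> //; have [m ca om] := regular_order pt_inj rp.
  have m0 := (regular_zero om).1 ((regular_critical rp).1 cp).
  case: ca => [[j [pj _]]|[_ /eqP]]; first by exists j.
  by rewrite -[1]/(1%:R) eqr_nat eqSS (gtn_eqF m0).
have [m ca om] := regular_order pt_inj rp.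
split; last by move=> /extremal_irregular.
apply/(regular_critical rp)/(regular_zero om).
case: ca => [[k [_ ak]]|[Wp _]]; last by exfalso; apply: Wp; exists j.
by have := alpha_neq1 k; rewrite -ak -[1]/(1%:R) eqr_nat eqSS lt0n.
Qed.

Lemma regular_pt j : regular (pt j) ->
  exists2 m : nat, (0 < m)%N & alpha j = m.+1%:R /\ has_order omega (pt j) m%:Z.
Proof.
move=> rp; have [m ca om] := regular_order pt_inj rp.
have ca' : cone (pt j) (alpha j) by left; exists j.
have aE := cone_uniq pt_inj ca' ca.
exists m => //; by have := alpha_neq1 j; rewrite aE -[1]/(1%:R) eqr_nat eqSS lt0n.
Qed.

Lemma regular_W p : regular p -> W p -> has_order omega p 0.
Proof.
move=> rp Wp; have [m ca om] := regular_order pt_inj rp.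
have ca' : cone p 1 by right.
have := cone_uniq pt_inj ca' ca => /eqP; rewrite -[1]/(1%:R) eqr_nat eqSS => /eqP m0.
by rewrite -m0 in om.
Qed.

Lemma regular_omega p i : regular p -> dom i p -> omega i p <> None.
Proof. by move=> rp ip; have [w ->] := regular_rdiff rp ip. Qed.

(** * Zeros and poles of the dual vector field *)

Lemma zero_Y p : is_zero Y p <-> extremal_point Psi p.
Proof.
rewrite extremal_irregular; split=> [zY rp|/irregular_order om]; last first.
  by have [H _ _] := Y_value om; exact: H.
have [m _ om] := regular_order pt_inj rp; have [_ Hp H0] := Y_value om.
have [i ip] := dom_cover X p.
case: m om Hp H0 => [|m] om Hp H0; first by have [n0 _] := H0 erefl.
by have := Hp isT i ip; rewrite (zY i ip).
Qed.

Lemma pole_Y p : is_pole Y p <-> saddle_point X Psi p.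
Proof.
rewrite saddleP; split=> [pY|[rp [j pj]]].
  have rp : regular p.
    apply: contrapT => /extremal_irregular/zero_Y zY; have [i ip] := dom_cover X p.
    by have := pY i ip; rewrite (zY i ip).
  split=> //; apply: contrapT => nj.
  have Wp : W p by move=> -[j _ pj]; apply: nj; exists j.
  by have [_ _ /(_ erefl) []] := Y_value (regular_W rp Wp).
rewrite pj in rp *; have [m m0 [_ om]] := regular_pt rp.
by have [_ H _] := Y_value om; exact: H.
Qed.

Lemma pole_Y_order p : is_pole Y p -> exists j (m : nat),
  [/\ p = pt j, (1 < m)%N, alpha j = m%:R & has_order Y p (1 - m%:Z)].
Proof.
move=> /pole_Y/saddleP[rp [j pj]]; rewrite pj in rp *.
have [m m0 [aE om]] := regular_pt rp.
exists j, m.+1; split=> //; have := Y_order om.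
by rewrite -addn1 PoszD opprD addrCA subrr addr0.
Qed.

Lemma zero_Y_order p : is_zero Y p -> has_order Y p 1.
Proof. by move=> /zero_Y/extremal_irregular/irregular_order/Y_order; rewrite opprK. Qed.

Lemma nonint_zero j : alpha j \isn't a Num.int -> is_zero Y (pt j).
Proof.
move=> nj; apply/zero_Y/extremal_irregular => /regular_pt[m _ [aE _]].
by rewrite aE natr_int in nj.
Qed.

(** * The divisor and the residues of the character form *)

(** Extremal points are isolated, by near_regular, and S is compact. *)
Lemma finite_extremal : exists s : seq S, uniq s /\
  forall p, p \in s <-> extremal_point Psi p /\ W p.
Proof.
pose E p := extremal_point Psi p /\ W p.
suff [s Hs] : exists s : seq S, forall p, E p -> p \in s.
  exists (undup [seq p <- s | `[< E p >]]); split; first exact: undup_uniq.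
  move=> p; rewrite mem_undup mem_filter; split=> [/andP[/asboolP] //|Ep].
  by apply/andP; split; [exact/asboolP|exact: Hs].
(* the filter of sections of the directed set of finite subsets of S *)
pose Fs : set_system (seq S) := [set A | exists s : seq S, forall s' : seq S, {subset s <= s'} -> A s'].
have FF : Filter Fs.
  split.
  - by exists [::].
  - move=> A B [s1 H1] [s2 H2]; exists (s1 ++ s2) => s' ss; split; [apply: H1|apply: H2];
      by move=> x xs; apply: ss; rewrite mem_cat xs ?orbT.
  - by move=> A B AB [s H]; exists s => s' /H; exact: AB.
have : \forall s \near Fs, [set: S] `<=` [set p | E p -> p \in s].
  apply: ((compact_near_coveringP [set: S]).1 S_compact (seq S) Fs (fun s p => E p -> p \in s) FF) => p _.
  have /near_punctured H := near_regular p.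
  exists ([set q | q != p -> W q /\ 0 < Psi q < 4], [set s : seq S | p \in s]).
    split; first exact: H.
    by exists [:: p] => s' ss; apply: ss; rewrite inE.
  move=> [q s] /= [Hq ps] [eq _]; have [->|qp] := eqVneq q p; first exact: ps.
  by have [_ rq] := Hq qp; have := (extremal_irregular q).1 eq rq.
by move=> [s /(_ s (fun x h => h)) H]; exists s => p; exact: H.
Qed.

Section Enumeration.
Context {N : nat} {e : 'I_N -> S}.
Context (e_inj : injective e).
Context (e_range : range e = [set p | extremal_point Psi p /\ ~ range pt p]).

Let Sigma' : set S :=
  ~` ([set p | exists2 k, extremal_point Psi (pt k) & p = pt k] `|` range e).

Lemma Sigma'P p : Sigma' p <-> regular p.
Proof.
split=> [np|rp [[k /extremal_irregular nr pk]|]].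
- apply: contrapT => /extremal_irregular ext; apply: np.
  have [[k _ pk]|Wp] := pselect (range pt p); first by left; exists k; rewrite ?pk.
  by right; rewrite e_range.
- by apply: nr; rewrite -pk.
- by rewrite e_range => -[/extremal_irregular].
Qed.

Lemma e_extremal l : extremal_point Psi (e l) /\ W (e l).
Proof. by have : range e (e l) by [exists l]; rewrite e_range. Qed.

Lemma divisor_omega p : exists2 m : int, has_order omega p m &
  m%:~R = \sum_(j < n | `[< saddle_point X Psi (pt j) >]) (alpha j - 1) * (pt j == p)%:R
        - \sum_(k < n | `[< extremal_point Psi (pt k) >]) (pt k == p)%:R
        - \sum_(l < N) (e l == p)%:R :> R.
Proof.
rewrite !sum_mul1; have [[j _ <-]|Wp] := pselect (range pt p).
  have eo : \sum_(l < N) 1 * (e l == pt j)%:R = 0 :> R.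
    by apply: sum_out => l el; have [_ []] := e_extremal l; rewrite el; exists j.
  rewrite eo !sum_at//; have [rp|nr] := pselect (regular (pt j)).
    have [m m0 [aE om]] := regular_pt rp; exists m%:Z; first exact: om.
    have -> : `[< saddle_point X Psi (pt j) >] by apply/asboolP/saddleP; split=> //; exists j.
    have /negbTE -> : ~~ `[< extremal_point Psi (pt j) >] by apply/asboolPn => /extremal_irregular.
    by rewrite aE -natr1 mul0r !subr0 mul1r addrK.
  exists (-1); first exact: irregular_order.
  have -> : `[< extremal_point Psi (pt j) >] by apply/asboolP/extremal_irregular.
  have /negbTE -> : ~~ `[< saddle_point X Psi (pt j) >] by apply/asboolPn => /saddleP[].
  by rewrite mul0r !mul1r sub0r subr0 rmorphN1.
have po j : pt j <> p by move=> pj; apply: Wp; exists j.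
rewrite !(sum_out _ _ po); have [rp|nr] := pselect (regular p).
  exists 0; first exact: regular_W.
  rewrite sum_out ?subr0// => l el; have [/extremal_irregular + _] := e_extremal l.
  by rewrite el.
exists (-1); first exact: irregular_order.
have [l _ <-] : range e p by rewrite e_range; split=> //; exact/extremal_irregular.
by rewrite subrr sub0r sum_at// mul1r rmorphN1.
Qed.

End Enumeration.

Lemma third_kind_omega : third_kind omega.
Proof.
have [om _] := omega_character; split=> // p pp; apply: irregular_order => rp.
by have [i ip] := dom_cover X p; apply: (regular_omega rp ip); exact: pp.
Qed.

(** At an extremal point omega = h dz / (z - z0) and h (z0) is the residue c of
   the local form, which is a at a zero of f and - a at a pole. *)
Lemma residue_omega p a : cone p a ->
  (minimal_point Psi p -> has_residue omega p (cpair a 0)) /\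
  (maximal_point Psi p -> has_residue omega p (cpair (- a) 0)).
Proof.
have four0 : 4 <> 0 :> R by apply/eqP; rewrite pnatr_eq0.
move=> ca; split=> [mp|mp] i ip.
  have P0 := minimal_Psi mp; have nr : ~ regular p by apply/extremal_irregular; left.
  have [h [K [c [C0 [a' [ca' _ [hh h0 _ H _] hc HP]]]]]] := extremal_local nr ip.
  have -> : a = c by rewrite (cone_uniq pt_inj ca ca'); case: HP => -[] //; rewrite P0 => /esym/four0.
  by rewrite hc; apply: (residue_simple hh); apply: filterS H => z [].
have P0 := maximal_Psi mp; have nr : ~ regular p by apply/extremal_irregular; right.
have [h [K [c [C0 [a' [ca' _ [hh h0 _ H _] hc HP]]]]]] := extremal_local nr ip.
have -> : - a = c by rewrite (cone_uniq pt_inj ca ca'); case: HP => -[] //; rewrite P0 => /four0.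
by rewrite hc; apply: (residue_simple hh); apply: filterS H => z [].
Qed.

Lemma regular_element q F : regular q -> elements f q F ->
  exists2 z, F q = Some z & z != 0 /\ logit (Psi q) = ln (cmod z ^+ 2).
Proof.
move=> rq fF; have := rq; rewrite /regular (PsiE fF) => /height_mid[c c0 Fc].
by exists c => //; split=> //; rewrite Fc logit_height// lnXn ?cmod_gt0// mulr_natl.
Qed.

Lemma regular_differential p : regular p ->
  real_differential (fun q => logit (Psi q)) p (fun i => 2 * fin (omega i p)).
Proof.
move=> rp i ip; have [w -> dw] := regular_rdiff rp ip.
by have := (rdiffP (fun z => logit (Psi (param i z))) _ _).1 dw; rewrite zcoordK.
Qed.

(** * Monodromy at the saddle points and at the extremal points *)

(** This is |f|, which is single-valued since it is a function of Psi. *)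
Definition modulus q : \bar R :=
  if Psi q < 4 then (Num.sqrt (Psi q / (4 - Psi q)))%:E else +oo%E.

Lemma modulusE q F : elements f q F -> modulus q = sphere_mod (F q).
Proof.
move=> fF; rewrite /modulus (PsiE fF); case: (F q) => [c|]; last by rewrite /= ltxx.
have -> : height (Some c) < 4 by rewrite -subr_gt0 heightC divr_gt0// den_gt0.
by rewrite height_ratio sqrtr_sqr /= ger0_norm// cmod_ge0.
Qed.

Lemma modulus_minimal p : minimal_point Psi p -> modulus @ p^' --> 0%E.
Proof.
move=> /minimal_Psi P0; have Pc := @Psi_cont p; rewrite /prop_for /continuous_at P0 in Pc.
have rc : Psi q / (4 - Psi q) @[q --> p] --> (0 : R).
  rewrite -[X in _ --> X](mul0r (4 - 0)^-1); apply: cvgM; first exact: Pc.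
  by apply: cvgV; [rewrite subr0 pnatr_eq0|apply: cvgB; [exact: cvg_cst|exact: Pc]].
have sc : Num.sqrt (Psi q / (4 - Psi q)) @[q --> p] --> (0 : R).
  by rewrite -(@sqrtr0 R); apply: continuous_cvg rc; exact: sqrt_continuous.
have Pn : \forall q \near p, Psi q < 4.
  have /cvgrPdist_lt/(_ _ ltr01) := Pc; apply: filterS => q; rewrite sub0r normrN => k.
  by apply: le_lt_trans (ler_norm _) _; apply: lt_trans k _; rewrite ltr1n.
have mc : modulus @ p --> 0%E.
  apply: (@cvg_trans _ ((fun q => (Num.sqrt (Psi q / (4 - Psi q)))%:E) @ p)).
    by apply: near_eq_cvg; apply: filterS Pn => q qn; rewrite /modulus qn.
  by apply: cvg_EFin; [exact: filterE|exact: sc].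
by move=> A /mc HA; exact: dnbhs_near.
Qed.

Lemma modulus_maximal p : maximal_point Psi p -> modulus @ p^' --> +oo%E.
Proof.
move=> /maximal_Psi P4; apply/cvgeyPge => M.
pose b := 2 / (M ^+ 2 + 1).
have M0 : 0 < M ^+ 2 + 1 by rewrite ltr_wpDl// sqr_ge0.
have b0 : 0 < Num.min b 2 by rewrite lt_min divr_gt0//= ltr0n.
have /cvgrPdist_lt/(_ _ b0) H := @Psi_cont p.
apply: filterS2 (near_regular p) (dnbhs_near H) => q [_ /andP[q0 q4]].
rewrite P4 gtr0_norm ?subr_gt0// lt_min => /andP[k1 k2].
rewrite /modulus q4 lee_fin; apply: le_trans (ler_norm M) _.
rewrite -sqrtr_sqr ler_wsqrtr// ler_pdivlMr ?subr_gt0//.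
have : (4 - Psi q) * (M ^+ 2 + 1) < 2 by rewrite -ltr_pdivlMr.
rewrite mulrDr mulr1 mulrC; lra.
Qed.

Lemma ball_near (z0 z1 : Cx R) (r : R) : cmod (z1 - z0) < r -> \forall z \near z1, cmod (z - z0) < r.
Proof.
move=> h1; apply/nbhs_cxP; exists (r - cmod (z1 - z0)); first by rewrite subr_gt0.
move=> z; rewrite ltrBrDr => h2; apply: le_lt_trans h2.
by rewrite (_ : z - z0 = (z - z1) + (z1 - z0)) ?cmodD//; ring.
Qed.

Definition primitive_near i q (V v : Cx R -> Cx R) : Prop :=
  \forall z \near zcoord i q, cder V z (v z) /\ omega i (param i z) = Some (v z).

(** The quotient of F by exp (V) has derivative zero. *)
Lemma element_ode i q F V v : elements f q F -> dom i q -> regular q -> primitive_near i q V v ->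
  exists2 C, C != 0 & \forall x \near q, F x = Some (C * cexp (V (zcoord i x))).
Proof.
move=> fF iq rq HV; have [phi [_ p0 FE Hphi]] := element_chart fF iq rq.
pose psi z := phi z * cexp (- V z).
have dpsi : \forall z \near zcoord i q, cder psi z 0.
  apply: filterS2 HV Hphi => z [dV oz] [pz dp]; rewrite oz => -[vE].
  apply: (cder_val (cderM dp (cder_cexp_comp (cderN dV)))).
  by rewrite vE; field.
have [e e0 He] := (nbhs_cxP _ _).1 dpsi.
have near_e : \forall z \near zcoord i q, cmod (z - zcoord i q) < e by apply/nbhs_cxP; exists e.
exists (psi (zcoord i q)); first by rewrite mulf_neq0// cexp_neq0.
apply/(near_chart _ iq); apply: filterS3 FE near_e (near_chart_radius iq) => z -> ze [_ ->].
have q0 : cmod (zcoord i q - zcoord i q) < e by rewrite subrr cmod0.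
rewrite (cder0_cst He q0 ze) /psi -mulrA -cexpD addNr cexp0 mulr1.
by [].
Qed.

(** The derivative of exp (V) is exp (V) omega, which vanishes nowhere on the
   regular part of W. *)
Lemma univalent_exp i q V v C : W q -> dom i q -> regular q -> primitive_near i q V v -> C != 0 ->
  univalent_element X q (fun x => Some (C * cexp (V (zcoord i x)))).
Proof.
move=> Wq iq rq HV C0; pose h z := C * cexp (V z).
have dh : \forall z \near zcoord i q, cder h z (C * (cexp (V z) * v z)).
  by apply: filterS HV => z [dV _]; apply: cderZ; exact: cder_cexp_comp.
have hh : holomorphic_at h (zcoord i q) := hol_cder dh.
split=> [j jq|].
  apply: (meromorphic_trans jq iq); exists h; split; first exact: hh.
  by left; apply: filterS (near_chart_radius iq) => z [_ zz] /=; rewrite zz.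
have v0 : v (zcoord i q) != 0.
  have [_ o] := nbhs_singleton HV; have := metric_omega_neq0 Wq iq rq.
  by rewrite zcoordK// in o; rewrite o => nv; apply/eqP => v0; apply: nv; rewrite v0.
have d0 : derive1 h (zcoord i q) != 0.
  by rewrite (cder_derive1 (nbhs_singleton dh)) !mulf_neq0// cexp_neq0.
have [r r0 Hr] := hol_inj hh d0.
exists (disc i q r); split.
  by apply: open_nbhs_nbhs; split; [exact: disc_open|exact: disc_center].
by move=> x y [ix xr] [iy yr] [] E; apply: (zcoord_inj ix iy); exact: Hr.
Qed.

Lemma regular_primitive p i : regular p -> dom i p -> exists V v r,
  [/\ chart_radius i p r, (forall q, disc i p r q -> regular q /\ primitive_near i q V v),
     (forall q, disc i p r q -> q <> p -> W q) & {for zcoord i p, continuous V}].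
Proof.
move=> rp ip; have [m [h [K [C0 [_ [hh h0 Kh H [/(_ isT) [_ _ KE] _ _]] CE]]]]] := regular_local rp ip.
set z0 := zcoord i p in hh h0 Kh H KE *.
have oE : \forall z \near z0, omega i (param i z) = Some ((z - z0) ^ m%:Z * h z).
  apply/near_punctured_cx; split; last by apply: filterS H => z [].
  have := @meromorphic_hol_value R (omega i \o param i) z0 (fun z => (z - z0) ^+ m * h z)
    (omega_meromorphic ip) (hol_cont (holM (hol_subX m z0 z0) hh)).
  by apply; apply: filterS H => z [_ _ oz _ _]; exact: oz.
have rE : \forall z \near z0, regular (param i z).
  apply/near_punctured_cx; split; last by apply: filterS H => z [].
  by rewrite zcoordK.
have [e e0 He] := (nbhs_cxP _ _).1 (filterI (filterI KE oE) (filterI rE (near_chart_radius ip))).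
have [d d0 Hd] := (dnbhs_cxP _ _).1 H.
have m0 : 0 < Num.min e d by rewrite lt_min e0.
exists (fun z => (z - z0) ^ (m%:Z + 1) * K z), (fun z => (z - z0) ^ m%:Z * h z), (Num.min e d).
split.
- by split=> // z; rewrite lt_min => /andP[/He[_ []]].
- move=> q [iq]; rewrite lt_min => /andP[qe _]; split.
    by have [_ [+ _]] := He _ qe; rewrite zcoordK.
  by apply: filterS (ball_near qe) => z /He[[]].
- move=> q [iq]; rewrite lt_min => /andP[_ qd] qp.
  have qz : zcoord i q != z0 by apply/eqP => /(zcoord_inj iq ip).
  by have [+ _ _ _ _] := Hd _ qz qd; rewrite zcoordK.
- exact: cder_cont (nbhs_singleton KE).
Qed.

(** Both elements are multiples of the same exponential. *)
Lemma elements_ratio q F F' a k : regular q -> elements f q F -> elements f q F' ->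
  F q = Some a -> F' q = Some (k * a) -> \forall x \near q, F' x = sphere_scale k (F x).
Proof.
move=> rq fF fF' Fa Fa'; have [i iq] := dom_cover X q.
have [V [v [r [rr HV _ _]]]] := regular_primitive rq iq.
have [_ Pq] := HV q (disc_center iq rr.1).
have [C C0 HC] := element_ode fF iq rq Pq; have [C' C'0 HC'] := element_ode fF' iq rq Pq.
have := nbhs_singleton HC; have := nbhs_singleton HC'; rewrite Fa Fa' => -[E'] [E].
have CE : C' = k * C.
  by apply: (mulIf (cexp_neq0 (V (zcoord i q)))); rewrite -E' E mulrA.
by apply: filterS2 HC HC' => x -> -> /=; rewrite CE mulrA.
Qed.

Lemma disc_open_nbhs (i : chart X) p (r : R) : dom i p -> 0 < r -> open_nbhs p (disc i p r).
Proof. by move=> ip r0; split; [exact: disc_open|exact: disc_center]. Qed.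

(** A primitive V of omega exists on a whole disc around p, including p, and the
   elements of f on the punctured disc are the multiples of exp (V). *)
Lemma regular_locally_trivial p : regular p -> locally_trivial_at f p.
Proof.
move=> rp; have [i ip] := dom_cover X p.
have [V [v [r [rr HV HW Vc]]]] := regular_primitive rp ip.
have dW : disc i p r `\ p `<=` W by move=> q [dq qp]; exact: HW.
exists (disc i p r); split; [exact: (disc_open_nbhs ip rr.1)|exact: dW| |].
- move=> gam q F F' gp fF cF.
  have gpW : path_in W gam q q by exact: path_sub gp.
  have [g_c g0 g1 gD] := gp.
  have [d ld] := lift_continuation gpW cF.
  have fF' := elements_lift fF ld.
  have rq : regular q by have [] := HV q; have := gD 0; rewrite g0 bound_itvE => /(_ ler01) [].
  have [t H d' t01 ld'|C [E E']] := path_constant (E := fun s => V (zcoord i (gam s))) gpW cF.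
    have fH := elements_lift fF ld'.
    rewrite -itv01 in t01; have [dt _] := gD t t01; have [rt Pt] := HV _ dt.
    have [C C0 HC] := element_ode fH dt.1 rt Pt.
    by exists C; have := (within_nearP gam).1 g_c t t01 _ HC; apply: filterS => s; rewrite -itv01.
  have HR := @elements_ratio q F F' _ 1 rq fF fF' E.
  rewrite mul1r E' g0 g1 in HR; have := HR erefl.
  by apply: filterS => x ->; case: (F x) => [w|] //=; rewrite mul1r.
- move=> q F [dq qp] fF; have [rq Pq] := HV q dq.
  have [C C0 HC] := element_ode fF dq.1 rq Pq.
  pose G x := C * cexp (V (zcoord i x)).
  have Gu x : (disc i p r `\ p) x -> univalent_element X x (fun y => Some (G y)).
    by move=> [dx xp]; have [rx Px] := HV x dx; exact: (univalent_exp (HW _ dx xp) dx.1 rx Px C0).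
  have fG : elements f q (fun y => Some (G y)) by apply: elements_germ (fF) (Gu q _) HC.
  exists G; split; first exact: HC.
    move=> x [dx xp]; have [gam gp] := punctured_path ip rr dq dx qp xp.
    apply: (elements_path fG (path_sub dW gp)) => t t01.
    by apply: Gu; have [_ _ _ gD] := gp; apply: gD; rewrite itv01.
  exists (C * cexp (V (zcoord i p))); first by rewrite mulf_neq0// cexp_neq0.
  have hc : {for zcoord i p, continuous (fun z => C * cexp (V z))}.
    exact: (contM_cx (hol_cont (hol_cst C _)) (continuous_comp Vc (@cexp_continuous R _))).
  have Gc : G @ p --> C * cexp (V (zcoord i p)).
    exact: (@continuous_comp _ _ _ (zcoord i) (fun z => C * cexp (V z)) p (zcoord_continuous ip) hc).
  by move=> A /Gc HA; exact: dnbhs_near.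
Qed.

Lemma cexp_polar (z : Cx R) (theta : R) : z != 0 -> z = cpair (cmod z) 0 * cexp (cpair 0 theta) ->
  cexp (cpair (ln (cmod z)) theta) = z.
Proof.
move=> z0 zE; have -> : cpair (ln (cmod z)) theta = cpair (ln (cmod z)) 0 + cpair 0 theta.
  by rewrite -cpairD addr0 add0r.
rewrite cexpD [RHS]zE; congr (_ * _); rewrite /cexp re_cpair im_cpair cos0 sin0 mulr1 mulr0 lnK//.
by rewrite posrE cmod_gt0.
Qed.

(** Along the loop, the primitive of omega is a single-valued function plus
   c times the logarithm ln |z - z0| + i theta, and theta grows by 2 pi. *)
Lemma irregular_multiplier p i h K c C0 : dom i p -> local_form i p (-1) h K c C0 ->
  exists V, [/\ open_nbhs p V, V `<=` dom i, V `\ p `<=` W &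
      forall (gamma : R -> S) q F F',
        path_in (V `\ p) gamma q q -> simple_loop gamma ->
        winds_once i p gamma -> elements f q F ->
        continuation (univalent_element X) gamma F F' ->
        \forall x \near q, F' x = sphere_scale (cexp (cpair 0 (2 * pi * c))) (F x)].
Proof.
move=> ip [hh h0 Kh H _]; set z0 := zcoord i p in hh h0 Kh H *.
pose V z := (z - z0) ^ (-1 + 1) * K z.
pose v z := (z - z0) ^ (-1) * h z - cpair c 0 / (z - z0).
have [e e0 He] := (dnbhs_cxP _ _).1 (filterI H (near_dnbhs_cx (near_chart_radius ip))).
have dP q : disc i p e q -> q <> p -> [/\ dom i q, zcoord i q != z0, cmod (zcoord i q - z0) < e, W q & regular q].
  move=> [iq qe] qp; have qz : zcoord i q != z0 by apply/eqP => /(zcoord_inj iq ip).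
  by have [[Wq Pq _ _ _] _] := He _ qz qe; rewrite zcoordK// in Wq Pq.
have dW : disc i p e `\ p `<=` W by move=> q [dq qp]; have [] := dP q dq qp.
exists (disc i p e); split; [exact: (disc_open_nbhs ip e0)|by move=> q []|exact: dW|].
move=> gam q F F' gp _ [theta [th_c thE th1]] fF cF.
have gpW : path_in W gam q q by exact: path_sub gp.
have [g_c g0 g1 gD] := gp.
have [d ld] := lift_continuation gpW cF.
have fF' := elements_lift fF ld.
have qD : (disc i p e `\ p) q by have := gD 0; rewrite g0 bound_itvE; apply; exact: ler01.
have [iq qz qe _ rq] := dP q qD.1 qD.2.
(* the continuous logarithm of z - z0 along the loop *)
pose l (t : R) := cpair (ln (cmod (zcoord i (gam t) - z0))) (theta t).
have lE (t : R) : t \in `[0, 1]%R -> z0 + cexp (l t) = zcoord i (gam t).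
  move=> t01; have [_ tz _ _ _] := dP _ (gD t t01).1 (gD t t01).2.
  by rewrite /l cexp_polar ?subr_eq0//; [rewrite addrC subrK|exact: thE].
have [t M d' t01 ld'|C [E E']] := path_constant (E := fun s => V (zcoord i (gam s)) + cpair c 0 * l s) gpW cF.
  have fM := elements_lift fF ld'; rewrite -itv01 in t01.
  have [it tz te _ rt] := dP _ (gD t t01).1 (gD t t01).2.
  have zE := lE t t01.
  have zK : param i (z0 + cexp (l t)) = gam t by rewrite zE zcoordK.
  have HV : \forall z \near z0 + cexp (l t), cder V z (v z) /\ omega i (param i z) = Some (v z + cpair c 0 / (z - z0)).
    rewrite zE.
    apply/nbhs_cxP.
    have m0 : 0 < Num.min (cmod (zcoord i (gam t) - z0)) (e - cmod (zcoord i (gam t) - z0)).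
      by rewrite lt_min cmod_gt0 subr_eq0 tz subr_gt0.
    exists (Num.min (cmod (zcoord i (gam t) - z0)) (e - cmod (zcoord i (gam t) - z0))) => // z.
    rewrite lt_min => /andP[k1 k2].
    have zn : z != z0 by apply: contraTneq k1 => ->; rewrite cmodBC ltxx.
    have ze : cmod (z - z0) < e.
      rewrite (_ : z - z0 = (z - zcoord i (gam t)) + (zcoord i (gam t) - z0)); last by ring.
      by apply: le_lt_trans (cmodD _ _) _; rewrite -ltrBrDr.
    have [[_ _ oz dz _] _] := He _ zn ze.
    by split; [exact: dz|rewrite /v subrK; exact: oz].
  have := @element_log i p M V v (cpair c 0) (l t); rewrite /= -/z0 zK => /(_ it (esym zE) rt fM HV)[C _ HC].
  exists C.
  have [k k0 Hk] := (nbhs_cxP _ _).1 HC.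
  have k2 : 0 < k / 2 by rewrite divr_gt0.
  have n1 : \forall s \near t, s \in `[0, 1]%R -> `|theta s - theta t| < k / 2.
    have nt : nbhs (theta t) [set x | `|x - theta t| < k / 2].
      by apply/nbhs_ballP; exists (k / 2) => //= x; rewrite /ball /= distrC.
    exact: ((within_nearP theta).1 th_c t t01 _ nt).
  have lc : {for gam t, continuous (fun x => ln (cmod (zcoord i x - z0)))}.
    have c1 : {for zcoord i (gam t), continuous (fun z : Cx R => cmod (z - z0))}.
      have c2 : {for zcoord i (gam t), continuous (fun z : Cx R => z - z0)}.
        exact: (cder_cont (cderB (cder_id _) (cder_cst z0 _))).
      exact: (continuous_comp c2 (@cmod_continuous R _)).
    have c3 : {for gam t, continuous (fun x => cmod (zcoord i x - z0))}.
      exact: (@continuous_comp _ _ _ (zcoord i) (fun z => cmod (z - z0)) _ (zcoord_continuous it) c1).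
    apply: (@continuous_comp _ _ _ (fun x => cmod (zcoord i x - z0)) (@ln R) _ c3).
    by apply: continuous_ln; rewrite cmod_gt0 subr_eq0.
  have n2 : \forall s \near t, s \in `[0, 1]%R ->
      `|ln (cmod (zcoord i (gam s) - z0)) - ln (cmod (zcoord i (gam t) - z0))| < k / 2.
    have nt : nbhs (gam t) [set x | `|ln (cmod (zcoord i x - z0)) - ln (cmod (zcoord i (gam t) - z0))| < k / 2].
      have /cvgrPdist_lt/(_ _ k2) nt := lc; by apply: filterS nt => x; rewrite distrC.
    exact: ((within_nearP gam).1 g_c t t01 _ nt).
  apply: filterS2 n1 n2 => s h1 h2; rewrite -itv01 => s01.
  have ls : cmod (l s - l t) < k.
    apply: le_lt_trans (cmod_sum _) _; rewrite reB imB /l !re_cpair !im_cpair.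
    by have := h1 s01; have := h2 s01; lra.
  have [is_ _ _ _ _] := dP _ (gD s s01).1 (gD s s01).2.
  by have := Hk _ ls; rewrite (lE s s01) zcoordK.
apply: (@elements_ratio q F F' _ _ rq fF fF' E).
rewrite E' g0 g1 mulrCA -cexpD; congr (Some (_ * cexp _)).
rewrite addrCA; congr (_ + _); rewrite /l th1 g0 g1.
by apply: cx_eqP; rewrite !(reD, imD, reM, imM, re_cpair, im_cpair); ring.
Qed.

Lemma multiplier_at p a : cone p a ->
  (minimal_point Psi p -> local_multiplier f p (cexp (cpair 0 (2 * pi * a)))) /\
  (maximal_point Psi p -> local_multiplier f p (cexp (cpair 0 (2 * pi * - a)))).
Proof.
have four0 : 4 <> 0 :> R by apply/eqP; rewrite pnatr_eq0.
move=> ca; split=> [mp|mp] i ip.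
  have P0 := minimal_Psi mp; have nr : ~ regular p by apply/extremal_irregular; left.
  have [h [K [c [C0 [a' [ca' _ LF hc HP]]]]]] := extremal_local nr ip.
  have -> : a = c by rewrite (cone_uniq pt_inj ca ca'); case: HP => -[] //; rewrite P0 => /esym/four0.
  exact: irregular_multiplier LF.
have P0 := maximal_Psi mp; have nr : ~ regular p by apply/extremal_irregular; right.
have [h [K [c [C0 [a' [ca' _ LF hc HP]]]]]] := extremal_local nr ip.
have -> : - a = c by rewrite (cone_uniq pt_inj ca ca'); case: HP => -[] //; rewrite P0 => /four0.
exact: irregular_multiplier LF.
Qed.

(** * The integral of the character form *)

Lemma univalent_germ p (F F' : S -> sphere R) : univalent_element X p F ->
  (\forall x \near p, F x = F' x) -> univalent_element X p F'.
Proof.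
move=> [Fm [U [Up UF]]] E; split=> [i ip|].
  have [h [hh H]] := Fm i ip; exists h; split; first exact: hh.
  have E' : \forall z \near zcoord i p, F (param i z) = F' (param i z) by exact: ((near_chart _ ip).1 E).
  case: H => [H|[H hn]]; [left|right; split; last exact: hn];
    by apply: filterS2 E' H => z e1 e2; rewrite /= -e1; exact: e2.
exists (U `&` [set x | F x = F' x]); split; first exact: filterI.
by move=> x y [Ux /= <-] [Uy /= <-]; exact: UF.
Qed.

Lemma near_neq (x y : S) : \forall y' \near y^', y' <> x.
Proof.
apply/near_punctured; have [->|/eqP xy] := pselect (y = x); first by apply: filterE => z /eqP.
have : nbhs y (~` [set x]).
  apply: open_nbhs_nbhs; split; last by move=> /= E; rewrite E eqxx in xy.
  by rewrite openC; exact: (accessible_closed_set1 (hausdorff_accessible S_hausdorff)).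
by apply: filterS => z zx _ E; exact: zx.
Qed.

(** The transformation rule of omega matches the chain rule, so that a primitive
   in one chart is a primitive in all charts. *)
Lemma primitive_at i y V v k j : dom i y -> dom j y -> primitive_near i y V v ->
  holomorphic_at ((fun x => V (zcoord i x) + k) \o param j) (zcoord j y) /\
  omega j y = Some (dcoord j (fun x => V (zcoord i x) + k) y).
Proof.
move=> iy jy HV; set H := fun x => _.
have dH : \forall z \near zcoord i y, cder (H \o param i) z (v z).
  have rad := nbhs_interior (near_chart_radius iy).
  apply: filterS2 HV rad => z [dV _] rz.
  apply: (cder_eq (F := fun z => V z + k) (a := v z + 0)); first exact: (cderD dV (cder_cst k z)).
    by apply: filterS rz => w [_ ww]; rewrite /H /= ww.
  by rewrite addr0.
have [h1 h2] := dcoord_chain jy iy (hol_cder dH); split; first exact: h1.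
have [[_ tr] _] := omega_character; rewrite (tr _ _ _ jy iy) h2.
have [_ o] := nbhs_singleton HV; rewrite zcoordK// in o; rewrite o /=.
by have -> : dcoord i H y = v (zcoord i y) := cder_derive1 (nbhs_singleton dH).
Qed.

Lemma integral_chart i q V v k : dom i q -> primitive_near i q V v ->
  integral_element omega q (fun x => V (zcoord i x) + k).
Proof.
move=> iq HV; split=> [j jq|]; first by have [] := primitive_at k iq jq HV.
have di : \forall x \near q, dom i x by apply: open_nbhs_nbhs; split=> //; exact: dom_open.
have n1 : \forall x \near q, primitive_near i x V v.
  exact: (near_zcoord iq (nbhs_interior HV)).
by apply: filterS2 di n1 => x ix Px j jx; have [] := primitive_at k ix jx Px.
Qed.

Lemma integral_unique i q V v h : integral_element omega q h -> dom i q -> primitive_near i q V v ->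
  exists k, \forall x \near q, h x = V (zcoord i x) + k.
Proof.
move=> [hh ho] iq HV; have dh := near_cder (hh i iq).
have ho' := (near_chart _ iq).1 ho.
have d0 : \forall z \near zcoord i q, cder (fun z => (h \o param i) z - V z) z 0.
  apply: filterS3 (filterI HV dh) ho' (near_chart_radius iq) => z [[dV o] dz] oz [iz zz].
  apply: (cder_val (cderB dz dV)).
  have := oz i iz; rewrite o => -[vE]; rewrite vE /dcoord zz subrr.
  by [].
have [e e0 He] := (nbhs_cxP _ _).1 d0.
exists (h q - V (zcoord i q)).
have near_e : \forall z \near zcoord i q, cmod (z - zcoord i q) < e by apply/nbhs_cxP; exists e.
apply/(near_chart _ iq); apply: filterS2 near_e (near_chart_radius iq) => z ze [_ zz].
have q0 : cmod (zcoord i q - zcoord i q) < e by rewrite subrr cmod0.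
have := cder0_cst He ze q0; rewrite /= zcoordK// zz => <-; by rewrite subrKC.
Qed.

Lemma integral_near q h : integral_element omega q h -> \forall x \near q, integral_element omega x h.
Proof.
move=> [hh ho]; have [i iq] := dom_cover X q.
have di : \forall x \near q, dom i x by apply: open_nbhs_nbhs; split=> //; exact: dom_open.
have n1 : \forall x \near q, holomorphic_at (h \o param i) (zcoord i x).
  exact: (near_zcoord (P := fun z => holomorphic_at (h \o param i) z) iq (hol_near (hh i iq))).
apply: filterS3 di n1 (nbhs_interior ho) => x ix hx ox; split; last exact: ox.
by move=> j jx; have [] := dcoord_chain jx ix hx.
Qed.

(** Primitives extend to the disc on which one primitive is known; this is the
   hypothesis of continuable. *)
Lemma integral_extend x : regular x -> exists2 U : set S, nbhs x U & forall y h, U y ->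
  integral_element omega y h -> exists G, (forall y', U y' -> integral_element omega y' G) /\
     \forall w \near y, h w = G w.
Proof.
move=> rx; have [i ix] := dom_cover X x.
have [V [v [r [rr HV _ _]]]] := regular_primitive rx ix.
exists (disc i x r); first exact: (disc_near (disc_center ix rr.1)).
move=> y h dy iy; have [_ Py] := HV y dy; have [k hk] := integral_unique iy dy.1 Py.
exists (fun x => V (zcoord i x) + k); split; last exact: hk.
by move=> y' dy'; have [_ Py'] := HV y' dy'; exact: (integral_chart k dy'.1 Py').
Qed.

Lemma element_integral y H h : elements f y H -> regular y -> integral_element omega y h ->
  exists k, \forall w \near y, H w = Some (k * cexp (h w)).
Proof.
move=> fH ry iy; have [i iy'] := dom_cover X y.
have [V [v [r [rr HV _ _]]]] := regular_primitive ry iy'.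
have [_ Py] := HV y (disc_center iy' rr.1).
have [C C0 HC] := element_ode fH iy' ry Py; have [k hk] := integral_unique iy iy' Py.
exists (C / cexp k); apply: filterS2 HC hk => w -> ->.
by rewrite addrC cexpD mulrA divfK// cexp_neq0.
Qed.

Definition exp_germ (h : S -> Cx R) : S -> sphere R := fun x => Some (cexp (h x)).

Lemma integral_univalent y h : W y -> regular y -> integral_element omega y h ->
  univalent_element X y (exp_germ h).
Proof.
move=> Wy ry iy; have [i iy'] := dom_cover X y.
have [V [v [r [rr HV _ _]]]] := regular_primitive ry iy'.
have [_ Py] := HV y (disc_center iy' rr.1); have [k hk] := integral_unique iy iy' Py.
apply: (univalent_germ (univalent_exp Wy iy' ry Py (cexp_neq0 k))).
by apply: filterS hk => x e; rewrite /exp_germ e addrC cexpD.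
Qed.

(** A property that propagates along punctured discs can be tested near any point
   y of the disc.  The case y = x serves to pass through zeros and poles of f and
   through saddle points, where one of the two functions has no element. *)
Lemma punctured_disc_iff i x r (P : S -> Prop) y : @disc R S X i x r y ->
  (forall y0 y1, (disc i x r `\ x) y0 -> (disc i x r `\ x) y1 -> P y0 -> P y1) ->
  (\forall y' \near y^', P y') <-> (forall y', (disc i x r `\ x) y' -> P y').
Proof.
move=> dy HP; have D : \forall y' \near y^', (disc i x r `\ x) y'.
  by apply: filterS2 (dnbhs_near (disc_near dy)) (near_neq x y) => y' d1 d2; split.
split=> [H y' dy'|H]; last by apply: filterS D => y'; exact: H.
by have [y0 _ [d0 P0]] := dnbhs_ex X (filterI D H); exact: HP P0.
Qed.

Lemma regular_disc x (P : S -> Prop) : (\forall y \near x, P y) -> exists (i : chart X) (r : R),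
  [/\ dom i x, chart_radius i x r, forall y, disc i x r y -> P y &
      forall y, (disc i x r `\ x) y -> W y /\ regular y].
Proof.
move=> HP; have [i ix] := dom_cover X x.
have /near_punctured HR := near_regular x.
have [r rr HD] := chart_nbhd ix (filterI HP HR).
exists i, r; split=> // y; first by move=> /HD[].
by move=> [/HD[_ H] yx]; apply: H; apply/eqP.
Qed.

Section Integral.
Context {T : set S}.
Context (TP : forall p, T p <-> regular p).

(** The relation F = exp (integral) is kept under continuation along a path that
   joins two points of a punctured disc on which F is an element throughout. *)
Lemma integral_persist (I : multivalued R T (integral_element omega)) (i : chart X) x (r : R) H y0 y1 :
  dom i x -> chart_radius i x r ->
  (forall y, (disc i x r `\ x) y -> [/\ W y, regular y & elements f y H]) ->
  (disc i x r `\ x) y0 -> (disc i x r `\ x) y1 ->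
  (exists2 h, elements I y0 h & \forall w \near y0, H w = exp_germ h w) ->
  (exists2 h, elements I y1 h & \forall w \near y1, H w = exp_germ h w).
Proof.
move=> ix rr HD d0 d1 [h0 I0 E0].
have [gam gp] := punctured_path ix rr d0.1 d1.1 d0.2 d1.2.
have [_ i0] := elements_in I0.
have DT y : (disc i x r `\ x) y -> T y by move=> /HD[_ ry _]; apply/TP.
have ext z : (disc i x r `\ x) z -> exists2 U : set S, nbhs z U & forall y h, U y ->
  integral_element omega y h -> exists G, (forall y', U y' -> integral_element omega y' G) /\
     \forall w \near y, h w = G w.
  by move=> /HD[_ rz _]; exact: integral_extend.
have [G cG] := continuable ext gp i0.
have [d ld] := lift_continuation (path_sub DT gp) cG.
exists G; first exact: elements_lift I0 ld.
have [d' ld'] := lift_continuation gp cG.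
apply: (lift_ind (Q := fun y h => \forall w \near y, H w = exp_germ h w) ld') E0 => y h dy iy.
have [_ ry fy] := HD y dy; have [k Hk] := element_integral fy ry iy.
exists [set y' | \forall w \near y', H w = Some (k * cexp (h w))]; first exact: nbhs_interior Hk.
have key (z : S) (h' : S -> Cx R) : (\forall w \near z, H w = Some (k * cexp (h w))) ->
    (\forall w \near z, h' w = h w) -> (\forall w \near z, H w = exp_germ h' w) <-> k = 1.
  move=> Hz hz; split=> [E|k1].
    have := nbhs_singleton E; rewrite (nbhs_singleton Hz) /exp_germ (nbhs_singleton hz) => -[].
    by rewrite -[RHS]mul1r => /(mulIf (cexp_neq0 _)).
  by apply: filterS2 Hz hz => w -> e; rewrite /exp_germ e k1 mul1r.
move=> y' h' Uy' _ _ hh'; rewrite (key _ _ Uy' hh') (key y h)//.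
exact: filterE.
Qed.

(** The integral is based at a point b near the base point of f, where the base
   element of f is the exponential of a primitive.  Both implications are
   inductions along continuations; the statements are made on punctured
   neighbourhoods, because a path of f may cross zeros and poles of f, where the
   integral is undefined, and a path of the integral may cross saddle points,
   where f has no function elements. *)
Lemma integral_multivalued : exists I : multivalued R T (integral_element omega),
  forall q F, T q -> ~ range pt q ->
    (elements f q F <-> exists2 h, elements I q h & \forall x \near q, F x = Some (cexp (h x))).
Proof.
pose b0 := mv_base f; pose F0 := mv_germ f.
have fF0 : elements f b0 F0 := elements_base f.
have [i0 [r0 [ib0 rr0 D0 D0r]]] := regular_disc (element_near fF0).
have [b _ db] : exists2 b, b != b0 & (disc i0 b0 r0 `\ b0) b.
  apply: (dnbhs_ex X); apply: filterS2 (dnbhs_near (disc_near (disc_center ib0 rr0.1))) (near_neq b0 b0) => y d1 d2.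
  by split.
have [Wb rb] := D0r b db; have fb := D0 b db.1.
have [i ib] := dom_cover X b.
have [V [v [r [rr HV _ _]]]] := regular_primitive rb ib.
have [_ Pb] := HV b (disc_center ib rr.1).
have [C C0 HC] := element_ode fb ib rb Pb.
have [k kC _] := cexp_surj C0.
pose hb x := V (zcoord i x) + k.
have ihb : integral_element omega b hb := integral_chart k ib Pb.
have Ehb : \forall x \near b, F0 x = exp_germ hb x.
  by apply: filterS HC => x ->; rewrite /exp_germ /hb addrC cexpD kC.
have Tb : T b by apply/TP.
have cont (gam : R -> S) y : path_in T gam b y -> exists G, continuation (integral_element omega) gam hb G.
  by move=> gp; apply: continuable gp ihb => x /TP; exact: integral_extend.
pose I := @Multivalued R S (Cx R) T (integral_element omega) b hb Tb cont.
exists I => q F Tq Wq; have rq : regular q := (TP q).1 Tq.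
split=> [fF|[h Ih E]].
- pose P H y := exists2 h, elements I y h & \forall w \near y, H w = exp_germ h w.
  have QF : elements f q F /\ \forall y \near q^', P F y.
    have [d ld] := (elementsP f q F).1 fF.
    apply: (lift_ind (Q := fun x H => elements f x H /\ \forall y \near x^', P H y) ld); last first.
      split; first exact: fF0.
      apply/(punctured_disc_iff (disc_center ib0 rr0.1)).
        move=> y0 y1 d0 d1; apply: (integral_persist ib0 rr0 _ d0 d1) => y dy.
        by have [Wy ry] := D0r y dy; split=> //; apply: D0; case: dy.
      move=> y dy; apply: (integral_persist ib0 rr0 _ db dy).
        by move=> z dz; have [Wz rz] := D0r z dz; split=> //; apply: D0; case: dz.
      by exists hb; [exact: elements_base|exact: Ehb].
    move=> x H Wx ux; have [j [s [jx ss Dj Djr]]] := regular_disc (univalent_near ux).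
    have DW y : disc j x s y -> W y.
      by move=> dy; have [->//|yx] := pselect (y = x); have [] := Djr y (conj dy yx).
    exists (disc j x s); first exact: (disc_near (disc_center jx ss.1)).
    move=> y H' dy Wy uy HH'.
    have fxy z z' : disc j x s z -> disc j x s z' -> elements f z H -> elements f z' H.
      move=> dz dz' fz; have [gam gp] := disc_path ss dz dz'.
      apply: (elements_path fz (path_sub DW gp)) => t t01.
      by apply: Dj; have [_ _ _ gD] := gp; apply: gD; rewrite itv01.
    have fyH : elements f y H' <-> elements f x H.
      split=> [fy|fx].
        by apply: (fxy y x dy (disc_center jx ss.1)); apply: elements_germ fy (Dj _ dy) HH'.
      have fy := fxy x y (disc_center jx ss.1) dy fx.
      by apply: elements_germ fy uy _; apply: filterS HH' => w ->.
    have PP : elements f x H -> (\forall y' \near y^', P H' y') <-> (\forall y' \near x^', P H y').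
      move=> fx.
      have step y0 y1 : (disc j x s `\ x) y0 -> (disc j x s `\ x) y1 -> P H y0 -> P H y1.
        move=> d0 d1; apply: (integral_persist jx ss _ d0 d1) => z dz.
        by have [Wz rz] := Djr z dz; split=> //; exact: (fxy x z (disc_center jx ss.1) dz.1 fx).
      rewrite (punctured_disc_iff (disc_center jx ss.1) step) -(punctured_disc_iff dy step).
      have HH2 := dnbhs_near (nbhs_interior HH').
      split=> Hn; apply: filterS2 Hn HH2 => z [h Ih E] e; exists h => //;
        by apply: filterS2 E e => w -> ->.
    split=> -[fz Pz].
      by have fx := fyH.1 fz; split=> //; apply/(PP fx).
    by split; [exact/fyH|exact/(PP fz)].
  have [_ Pq] := QF; have [j jq] := dom_cover X q.
  have [V' [v' [s [ss HV' _ _]]]] := regular_primitive rq jq.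
  have [_ Pq'] := HV' q (disc_center jq ss.1).
  have [C' _ HC'] := element_ode fF jq rq Pq'.
  have [y _ [[h Ih E] [Fy dy]]] := dnbhs_ex X (filterI Pq (dnbhs_near (filterI (nbhs_interior HC') (disc_near (disc_center jq ss.1))))).
  have [_ ih] := elements_in Ih; have [_ Py] := HV' y dy.
  have [k' hk'] := integral_unique ih dy.1 Py.
  have DT z : disc j q s z -> T z by move=> /HV'[rz _]; apply/TP.
  have int z : disc j q s z -> integral_element omega z (fun x => V' (zcoord j x) + k').
    by move=> dz; have [_ Pz] := HV' z dz; exact: (integral_chart k' dz.1 Pz).
  exists (fun x => V' (zcoord j x) + k').
    have Iy : elements I y (fun x => V' (zcoord j x) + k') by apply: elements_germ Ih (int y dy) hk'.
    have [gam gp] := disc_path ss dy (disc_center jq ss.1).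
    apply: (elements_path Iy (path_sub DT gp)) => t t01.
    by apply: int; have [_ _ _ gD] := gp; apply: gD; rewrite itv01.
  have CE : C' = cexp k'.
    have := nbhs_singleton E; rewrite (nbhs_singleton Fy) /exp_germ (nbhs_singleton hk') addrC cexpD.
    by move=> -[] /(mulIf (cexp_neq0 _)).
  by apply: filterS HC' => x ->; rewrite CE addrC cexpD.
- have Qq : \forall y \near q^', elements f y (exp_germ h).
    have [d ld] := (elementsP I q h).1 Ih.
    apply: (lift_ind (Q := fun x h => \forall y \near x^', elements f y (exp_germ h)) ld); last first.
      have Wn := W_near Wb; have rn := near_regular b.
      apply: filterS3 (dnbhs_near (element_near fb))
        (dnbhs_near (filterI (nbhs_interior Ehb) (integral_near ihb))) rn => y fy [Ey iy] [Wy ry].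
      exact: elements_germ fy (integral_univalent Wy ry iy) Ey.
    move=> x h1 Tx ix1; have [j [s [jx ss Dj Djr]]] := regular_disc (integral_near ix1).
    exists (disc j x s); first exact: (disc_near (disc_center jx ss.1)).
    move=> y h' dy Ty iy hh'.
    have Dun z : (disc j x s `\ x) z -> univalent_element X z (exp_germ h1).
      by move=> dz; have [Wz rz] := Djr z dz; exact: (integral_univalent Wz rz (Dj z dz.1)).
    have step y0 y1 : (disc j x s `\ x) y0 -> (disc j x s `\ x) y1 ->
        elements f y0 (exp_germ h1) -> elements f y1 (exp_germ h1).
      move=> d0 d1 f0; have [gam gp] := punctured_path jx ss d0.1 d1.1 d0.2 d1.2.
      have DW z : (disc j x s `\ x) z -> W z by move=> /Djr[].
      apply: (elements_path f0 (path_sub DW gp)) => t t01.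
      by apply: Dun; have [_ _ _ gD] := gp; apply: gD; rewrite itv01.
    rewrite (punctured_disc_iff (disc_center jx ss.1) step) -(punctured_disc_iff dy step).
    have HH2 := dnbhs_near (nbhs_interior hh').
    have Dn : \forall z \near y^', (disc j x s `\ x) z.
      by apply: filterS2 (dnbhs_near (disc_near dy)) (near_neq x y) => z d1 d2; split.
    have un' : \forall z \near y^', univalent_element X z (exp_germ h').
      apply: filterS2 HH2 Dn => z e dz; apply: (univalent_germ (Dun z dz)).
      by apply: filterS e => w; rewrite /exp_germ => ->.
    split=> Hn.
      apply: filterS3 Hn HH2 Dn => z fz e dz; apply: elements_germ fz (Dun z dz) _.
      by apply: filterS e => w; rewrite /exp_germ => ->.
    apply: filterS3 Hn HH2 un' => z fz e uz; apply: elements_germ fz uz _.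
    by apply: filterS e => w; rewrite /exp_germ => ->.
  have [_ ih] := elements_in Ih.
  have [j [s [jq ss Dj Djr]]] := regular_disc (integral_near ih).
  have DWr y : disc j q s y -> W y /\ regular y.
    by move=> dy; have [->//|yx] := pselect (y = q); exact: Djr y (conj dy yx).
  have DW y : disc j q s y -> W y by move=> /DWr[].
  have [y _ [fy dy]] := dnbhs_ex X (filterI Qq (dnbhs_near (disc_near (disc_center jq ss.1)))).
  have [gam gp] := disc_path ss dy (disc_center jq ss.1).
  have fq : elements f q (exp_germ h).
    apply: (elements_path fy (path_sub DW gp)) => t t01.
    have [_ _ _ gD] := gp; have dt : disc j q s (gam t) by apply: gD; rewrite itv01.
    by have [Wt rt] := DWr _ dt; exact: integral_univalent (Dj _ dt).
  have E' : \forall x \near q, exp_germ h x = F x by apply: filterS E => x ->.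
  have [_ uq] := elements_in fq.
  exact: elements_germ fq (univalent_germ uq E') E'.
Qed.

End Integral.

End Geometry.

Theorem theorem1p1 (R : realType) (S : topologicalType)
    (X : riemann_surface R S) (n : nat) (pt : 'I_n -> S) (alpha : 'I_n -> R)
    (g : chart X -> S -> R)
    (f : multivalued R (~` range pt) (univalent_element X))
    (omega Y : chart X -> S -> sphere R) (Psi : S -> R)
    (S_hausdorff : hausdorff_space S) (S_connected : connected [set: S])
    (S_compact : compact [set: S])
    (pt_inj : injective pt)
    (alpha_gt0 : forall j, 0 < alpha j) (alpha_neq1 : forall j, alpha j != 1)
    (g_represents : represents pt alpha g)
    (g_curvature : curvature_one (~` range pt) g)
    (g_reducible : reducible (~` range pt) g)
    (f_developing : developing g f)
    (f_multiplicative :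
       nontrivial_reducible (~` range pt) g -> multiplicative_map f)
    (omega_character : character_form f omega)
    (Y_dual : dual_vector_field f Y)
    (Psi_height : height_function f Psi) :
  (* part (1) *)
  [/\ forall p, is_zero Y p <-> extremal_point Psi p,
      forall p, is_zero Y p -> has_order Y p 1,
      forall j, alpha j \isn't a Num.int -> is_zero Y (pt j),
      forall p, is_pole Y p <-> saddle_point X Psi p &
      forall p, is_pole Y p -> exists j (m : nat),
        [/\ p = pt j, (1 < m)%N, alpha j = m%:R & has_order Y p (1 - m%:Z)]]
  /\
  (* e lists the smooth extremal points *)
  exists (N : nat) (e : 'I_N -> S),
  let Sigma' :=
    ~` ([set p | exists2 k, extremal_point Psi (pt k) & p = pt k]
        `|` range e) in
  [/\ injective e,
      range e = [set p | extremal_point Psi p /\ ~ range pt p],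
      forall p, saddle_point X Psi p -> range pt p &
      forall j, saddle_point X Psi (pt j) \/ extremal_point Psi (pt j)]
  /\
  (* part (2) *)
  [/\ forall p, exists2 m : int, has_order omega p m &
        m%:~R = \sum_(j < n | `[< saddle_point X Psi (pt j) >])
                   (alpha j - 1) * (pt j == p)%:R
                - \sum_(k < n | `[< extremal_point Psi (pt k) >])
                   (pt k == p)%:R
                - \sum_(l < N) (e l == p)%:R :> R,
      third_kind omega,
      forall l, (minimal_point Psi (e l) -> has_residue omega (e l) 1) /\
                (maximal_point Psi (e l) -> has_residue omega (e l) (-1)),
      forall k,
        (minimal_point Psi (pt k) ->
           has_residue omega (pt k) (cpair (alpha k) 0)) /\
        (maximal_point Psi (pt k) ->
           has_residue omega (pt k) (cpair (- alpha k) 0)) &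
      [/\ ~` range pt `\` range e `<=` Sigma',
          forall p i, Sigma' p -> dom i p -> omega i p <> None &
          exists u : S -> R,
            (forall p, Sigma' p ->
               real_differential u p (fun i => 2 * fin (omega i p))) /\
            (forall q F, Sigma' q -> elements f q F ->
               exists2 z, F q = Some z & z != 0 /\ u q = ln (cmod z ^+ 2))]]
  /\
  (* part (3) *)
  [/\ exists I : multivalued R Sigma' (integral_element omega),
        forall q F, Sigma' q -> ~ range pt q ->
          (elements f q F <-> exists2 h, elements I q h &
             \forall x \near q, F x = Some (cexp (h x))),
      forall j, saddle_point X Psi (pt j) -> locally_trivial_at f (pt j),
      forall k,
        (minimal_point Psi (pt k) ->
           local_multiplier f (pt k) (cexp (cpair 0 (2 * pi * alpha k)))) /\
        (maximal_point Psi (pt k) ->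
           local_multiplier f (pt k) (cexp (cpair 0 (2 * pi * - alpha k)))) &
      exists A : S -> \bar R,
        (forall q F, elements f q F -> A q = sphere_mod (F q)) /\
        (forall p, (exists k, p = pt k) \/ (exists l, p = e l) ->
           (minimal_point Psi p -> A @ p^' --> 0%E) /\
           (maximal_point Psi p -> A @ p^' --> +oo%E))].
Proof.
have [s [s_uniq sP]] := finite_extremal S_hausdorff S_connected g_represents f_developing
    omega_character Psi_height alpha_gt0 S_compact.
pose e (l : 'I_(size s)) := tnth (in_tuple s) l.
have e_inj : injective e by apply/tuple_uniqP.
have e_range : range e = [set p | extremal_point Psi p /\ ~ range pt p].
  apply/seteqP; split=> [p [l _ <-]|p /sP ps]; first by apply/sP; exact: mem_tnth.
  by have /tnthP[l pl] : p \in in_tuple s := ps; exists l.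
have ext_irr := extremal_irregular S_hausdorff S_connected g_represents f_developing
    omega_character Psi_height alpha_gt0.
have sadP := saddleP S_hausdorff S_connected g_represents f_developing
    omega_character Psi_height alpha_gt0 alpha_neq1 pt_inj.
have cone_pt k : @cone R S n pt alpha (pt k) (alpha k) by left; exists k.
have cone_e l : @cone R S n pt alpha (e l) 1.
  by right; split=> //; have : range e (e l) by [exists l]; rewrite e_range => -[].
have SP := Sigma'P S_hausdorff S_connected g_represents f_developing
    omega_character Psi_height alpha_gt0 e_range.
split.
  split.
  - exact: (zero_Y S_hausdorff S_connected g_represents f_developing
    omega_character Psi_height alpha_gt0 Y_dual pt_inj).
  - exact: (zero_Y_order S_hausdorff S_connected g_represents f_developing
    omega_character Psi_height alpha_gt0 Y_dual pt_inj).
  - exact: (nonint_zero S_hausdorff S_connected g_represents f_developing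
    omega_character Psi_height alpha_gt0 alpha_neq1 Y_dual pt_inj).
  - exact: (pole_Y S_hausdorff S_connected g_represents f_developing
    omega_character Psi_height alpha_gt0 alpha_neq1 Y_dual pt_inj).
  - exact: (pole_Y_order S_hausdorff S_connected g_represents f_developing
    omega_character Psi_height alpha_gt0 alpha_neq1 Y_dual pt_inj).
exists (size s), e => Sigma'; split.
  split; [exact: e_inj|exact: e_range|by move=> p /sadP[_ [j ->]]; exists j|].
  move=> j; have [rj|/ext_irr] := pselect (@regular R S Psi (pt j)); last by right.
  by left; apply/sadP; split; last by exists j.
split.
  split.
  - exact: (divisor_omega S_hausdorff S_connected g_represents f_developing
    omega_character Psi_height alpha_gt0 alpha_neq1 pt_inj e_inj e_range).
  - exact: (third_kind_omega S_hausdorff S_connected g_represents f_developing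
    omega_character Psi_height alpha_gt0).
  - move=> l; have := residue_omega S_hausdorff S_connected g_represents f_developing
    omega_character Psi_height alpha_gt0 pt_inj (cone_e l).
    rewrite (_ : cpair 1 0 = 1)// (_ : cpair (- 1) 0 = -1)//.
    by apply: cx_eqP; rewrite ?reN ?imN ?oppr0.
  - by move=> k; exact: (residue_omega S_hausdorff S_connected g_represents f_developing
    omega_character Psi_height alpha_gt0 pt_inj (cone_pt k)).
  split.
  - move=> p [Wp ne]; apply/SP; apply: contrapT => /ext_irr ext; apply: ne.
    by rewrite e_range.
  - by move=> p i /SP rp ip; exact: (regular_omega S_hausdorff S_connected g_represents f_developing
    omega_character Psi_height alpha_gt0 rp ip).
  exists (fun q => logit (Psi q)); split=> [p /SP rp|q F /SP rq fF].
    exact: (regular_differential S_hausdorff S_connected g_represents f_developing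
    omega_character Psi_height alpha_gt0 rp).
  exact: (regular_element Psi_height rq fF).
split.
- exact: (integral_multivalued S_hausdorff S_connected g_represents f_developing
    omega_character Psi_height alpha_gt0 SP).
- by move=> j /sadP[rj _]; exact: (regular_locally_trivial S_hausdorff S_connected g_represents f_developing
    omega_character Psi_height alpha_gt0 rj).
- by move=> k; exact: (multiplier_at S_hausdorff S_connected g_represents f_developing
    omega_character Psi_height alpha_gt0 pt_inj (cone_pt k)).
exists (@modulus R S Psi); split=> [q F fF|p _]; first exact: (modulusE Psi_height fF).
split=> mp; first exact: (modulus_minimal S_hausdorff S_connected g_represents f_developing
    omega_character Psi_height alpha_gt0 mp).
exact: (modulus_maximal S_hausdorff S_connected g_represents f_developing
    omega_character Psi_height alpha_gt0 mp).
Qed.
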